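(* Let $(X,d,m)$ be a locally compact, connected, separable uniform local tree with a Radon measure $m$ of full support satisfying the uniform volume control with volume growth function $\Phi(r)=r^{d_h}$, $d_h\ge1$ (see context). Let $1\le p<\infty$ and $\alpha_p=1+\frac{d_h-1}{p}$. There exist $r_1>0$ and $C_1,C_2>0$ such that for every $f\in L^p(X,m)+W^{1,p}(X,m)$ if $p>1$, respectively every $f\in L^1(X,m)+BV(X,m)$ if $p=1$, and every $0<r<r_1$, $$C_1E_{p,0}(f,r)^{1/p}\le K(f,r^{\alpha_p})\le C_2E_{p,0}(f,r)^{1/p}.$$ Therefore, if $X$ is compact, then for $0\le\alpha\le\alpha_p$ $$\mathcal B^{\alpha,p}(X,m)=\begin{cases}(L^1(X,m),BV(X,m))_{\alpha/\alpha_1,\infty},&p=1,\\(L^p(X,m),W^{1,p}(X,m))_{\alpha/\alpha_p,\infty},&p>1.\end{cases}$$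
   Context: Balls are $B(x,r)=\{y:d(x,y)<r\}$. A metric space $(T,d)$ is a (real) tree if (1) for all $u,v\in T$ there is a unique isometric embedding $\phi_{u,v}:[0,d(u,v)]\to T$ with $\phi_{u,v}(0)=u$, $\phi_{u,v}(d(u,v))=v$; (2) every injective continuous $\kappa:[0,1]\to T$ satisfies $\kappa([0,1])=\phi_{\kappa(0),\kappa(1)}([0,d(\kappa(0),\kappa(1))])$. A metric space $(X,d)$ is a local tree if for every $x\in X$ there is $\iota(x)>0$ such that $B(x,\iota(x))$ is a tree. Standing assumption: $(X,d)$ is a locally compact, connected, separable local tree. For $u,v\in B(x,\iota(x))$, $[u,v]=\phi_{u,v}([0,d(u,v)])$ and $]u,v[=\phi_{u,v}(]0,d(u,v)[)$, geodesics being taken in the tree $B(x,\iota(x))$. The skeleton is $\mathcal S=\bigcup_{x\in X}\bigcup_{y\in B(x,\iota(x))}]x,y[$. Let $\mathcal V$ be a countable dense subset of $\mathcal S$. The length measure $\nu$ is the unique measure on the $\sigma$-field generated by the sets $]x,y[$ ($x,y\in\mathcal V$, $d(x,y)<\iota(x)$) with $\nu(]x,y[)=d(x,y)$ for all $x,y\in\mathcal S$ with $d(x,y)<\iota(x)$. Weak gradient: $f\in C(X)$ is absolutely continuous in $B(x,\iota(x))$ if there is $g\in L^1_{loc}(\mathcal S\cap B(x,\iota(x)),\nu)$ (integrable on segments) with $f(u)-f(x)=\int_{]x,u[}g\,d\nu$ for every $u\in B(x,\iota(x))$; $g=:\partial_xf$ is unique $\nu$-a.e. $f\in AC(X)$ means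 $f$ is absolutely continuous in $B(x,\iota(x))$ for all $x\in X$; then $|\partial_xf|=|\partial_yf|$ $\nu$-a.e. on common domains, and one writes $|\partial f|$. $AC^p(X)$ is the set of $f\in AC(X)$ with $|\partial f|\in L^p(\mathcal S,\nu)$. $m$ is a Radon measure on $X$ with full support. $W^{1,p}(X,m)$ is the set of $f\in L^p(X,m)$ having an $m$-representative $\tilde f\in AC^p(X)$, with $|\partial f|:=|\partial\tilde f|$. For $f\in L^1(X,m)$, $\|\partial f\|(X)=\inf_{(f_n)}\liminf_{n\to\infty}\int_{\mathcal S}|\partial f_n|\,d\nu$, the infimum over sequences $f_n\in W^{1,1}(X,m)$ with $f_n\to f$ in $L^1(X,m)$; $BV(X,m)=\{f\in L^1(X,m):\|\partial f\|(X)<+\infty\}$. Uniform volume control with $\Phi(r)=r^{d_h}$: there are $r_0>0$ and constants $c,C>0$ such that $c\,r^{d_h}\le m(B(x,r))\le C\,r^{d_h}$ for all $x\in X$, $0<r<r_0$. Uniform local tree: there is $0<\underline\iota\le\mathrm{diam}(X)$ such that $B(x,\underline\iota)$ is a tree for every $x\in X$. For $p\ge1$, $\alpha\ge0$, $E_{p,\alpha}(f,r)=\int_X\frac1{m(B(x,r))}\int_{B(x,r)}\frac{|f(y)-f(x)|^p}{r^{p\alpha}}\,dm(y)\,dm(x)$ and $\mathcal B^{\alpha,p}(X,m)=\{f\in L^p(X,m):\sup_{0<r<1}E_{p,\alpha}(f,r)<+\infty\}$. Real interpolation: for a compatible couple $(X_0,X_1)$ of seminormed spaces, $K(f,t,X_0,X_1)=\inf\{\|f_0\|_{X_0}+t\|f_1\|_{X_1}:f=f_0+f_1\}$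 and, for $0\le\theta\le1$, $(X_0,X_1)_{\theta,\infty}=\{f\in X_0+X_1:\sup_{t>0}t^{-\theta}K(f,t,X_0,X_1)<\infty\}$. Here $X_0=L^p(X,m)$ with its norm; for $p>1$, $X_1=W^{1,p}(X,m)$ with the seminorm $\|\partial f\|_{L^p(\mathcal S,\nu)}$; for $p=1$, $X_1=BV(X,m)$ with the seminorm $\|\partial f\|(X)$; and $K(f,t)$ denotes the $K$-functional of this couple. *)

(* Defs.v *)
From HB Require Import structures.
From mathcomp Require Import all_boot all_order all_algebra.
From mathcomp Require Import all_classical all_reals all_analysis.

Set Implicit Arguments.
Unset Strict Implicit.
Unset Printing Implicit Defensive.

Import Order.TTheory GRing.Theory Num.Theory.
Import numFieldNormedType.Exports.

Local Open Scope classical_set_scope.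
Local Open Scope ring_scope.

(* The distinguished point carries no mathematical content: the library's
   [measurableType] requires its carrier to be pointed. *)
#[short(type="pointedMetricType")]
HB.structure Definition PointedMetric (K : numDomainType) :=
  {M of Pointed M & PseudoMetric K M & PseudoMetric_isMetric K M}.

Notation borel X := (g_sigma_algebraType (@open X)).

Section local_trees.
Context {R : realType} {X : pointedMetricType R}.
Implicit Types (T : set X) (u v x y z : X) (iota : X -> R).

Local Notation d := (@mdist R X).

(* [phi] is only relevant on [0, d u v]. *)
Definition is_geodesic T u v (phi : R -> X) :=
  [/\ forall s, s \in `[0, d u v] -> T (phi s),
      forall s t, s \in `[0, d u v] -> t \in `[0, d u v] ->
        d (phi s) (phi t) = `|s - t|,
      phi 0 = u & phi (d u v) = v].

(* [u, v] and ]u, v[, for geodesics inside T; when T is a tree the geodesic is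
   unique, so these are the images of phi_{u,v}. *)
Definition cseg T u v : set X :=
  [set z | exists phi, is_geodesic T u v phi /\
    exists2 s, s \in `[0, d u v] & z = phi s].

Definition oseg T u v : set X :=
  [set z | exists phi, is_geodesic T u v phi /\
    exists2 s, s \in `]0, d u v[ & z = phi s].

Definition is_tree T :=
  (forall u v, T u -> T v ->
     (exists phi, is_geodesic T u v phi) /\
     (forall phi psi, is_geodesic T u v phi -> is_geodesic T u v psi ->
        {in `[0, d u v], phi =1 psi})) /\
  (forall kappa : R -> X,
     {within `[0, 1], continuous kappa} ->
     {in `[0, 1] &, injective kappa} ->
     kappa @` `[0, 1] `<=` T ->
     kappa @` `[0, 1] = cseg T (kappa 0) (kappa 1)).

Definition is_local_tree iota :=
  forall x, 0 < iota x /\ is_tree (ball x (iota x)).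

Definition diam : \bar R := ereal_sup [set (d xy.1 xy.2)%:E | xy in [set: X * X]].

(* In a uniform local tree the radii iota x are chosen bounded below by the
   uniform radius; [iota := fun=> iota0] is always a possible choice. *)
Definition is_uniform_local_tree iota :=
  exists iota0 : R,
    [/\ 0 < iota0, (iota0%:E <= diam)%E,
        forall x, is_tree (ball x iota0) & forall x, iota0 <= iota x].

Definition skeleton iota : set X :=
  [set z | exists x y, ball x (iota x) y /\ oseg (ball x (iota x)) x y z].

Definition seg_generators iota (V : set X) : set (set X) :=
  [set A | exists x y, [/\ V x, V y, d x y < iota x &
                           A = oseg (ball x (iota x)) x y]].

End local_trees.

Definition separable (X : topologicalType) :=
  exists2 D : set X, countable D & dense D.

(* X with the sigma-field generated by the segments ]x, y[, x, y in V. *)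
Notation skel_type iota V := (g_sigma_algebraType (seg_generators iota V)).

Section weak_gradient.
Context {R : realType} {X : pointedMetricType R} {iota : X -> R} {V : set X}.
Variable nu : {measure set (skel_type iota V) -> \bar R}.
Implicit Types (f g h : X -> R) (x u v : X) (p : R).

Local Notation S := (skeleton iota).
Local Notation B x := (ball x (iota x)).

(* The length measure lives on the skeleton; it is seen here as a measure on X
   carried by the skeleton. *)
Definition is_length_measure :=
  (forall x y : X, S x -> S y -> mdist x y < iota x ->
     nu (oseg (B x) x y) = (mdist x y)%:E) /\
  nu (~` S) = 0%E.

(* g is a version of partial_x f; integrability on segments is the meaning of
   L^1_loc here. *)
Definition is_gradient_at f x g :=
  [/\ measurable_fun (S `&` B x : set (skel_type iota V)) g,
      forall u v, B x u -> B x v ->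
        nu.-integrable (oseg (B x) u v) (EFin \o g) &
      forall u, B x u -> f u - f x = \int[nu]_(z in oseg (B x) x u) g z].

Definition AC f :=
  continuous f /\ forall x, exists g, is_gradient_at f x g.

Definition is_abs_gradient f h :=
  measurable_fun (S : set (skel_type iota V)) h /\
  forall x g, is_gradient_at f x g ->
    (fun z => `|g z|) = h %[ae nu in S `&` B x].

(* |partial f|, unique up to nu-null sets for f in AC(X). *)
Definition abs_gradient f : X -> R := xget (cst 0) (is_abs_gradient f).

Definition ACp p : set (X -> R) :=
  [set f | AC f /\ (\int[nu]_(z in S) (`|abs_gradient f z| `^ p)%:E < +oo)%E].

Variable m : {measure set (borel X) -> \bar R}.

Definition Lp p : set (X -> R) := [set f | f \in Lfun m p%:E].

Definition Lp_norm p f : \bar R := ('N[m]_p%:E [EFin \o f])%E.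

Definition is_ACp_version p f ft := ACp p ft /\ ft = f %[ae m].

Definition W1p p : set (X -> R) :=
  [set f | Lp p f /\ exists ft, is_ACp_version p f ft].

(* |partial f| for f in W^{1,p}; the version of f in AC^p(X) is unique, being
   continuous, when m has full support. *)
Definition sobolev_gradient p f : X -> R :=
  abs_gradient (xget f (is_ACp_version p f)).

Definition sobolev_seminorm p f : \bar R :=
  ((\int[nu]_(z in S) (`|sobolev_gradient p f z| `^ p)%:E) `^ p^-1)%E.

Definition BV_seminorm f : \bar R :=
  ereal_inf [set limn_einf
      (fun n => \int[nu]_(z in S) (`|sobolev_gradient 1 (f_ n) z|%:E))%E |
    f_ in [set f_ : nat -> X -> R | (forall n, W1p 1 (f_ n)) /\
             (fun n => Lp_norm 1 (fun x => f_ n x - f x)) @ \oo --> 0%E]].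

Definition BV : set (X -> R) :=
  [set f | Lp 1 f /\ (BV_seminorm f < +oo)%E].

Definition energy_space p : set (X -> R) := if p == 1 then BV else W1p p.

Definition energy_seminorm p : (X -> R) -> \bar R :=
  if p == 1 then BV_seminorm else sobolev_seminorm p.

End weak_gradient.

Section interpolation.
Context {R : realType} {X : Type}.
Variables (X0 X1 : set (X -> R)) (n0 n1 : (X -> R) -> \bar R).

Definition sum_space : set (X -> R) :=
  [set f | exists f0 f1, [/\ X0 f0, X1 f1 & f = f0 \+ f1]].

Definition K_functional (f : X -> R) (t : R) : \bar R :=
  ereal_inf [set k | exists f0 f1, [/\ X0 f0, X1 f1, f = f0 \+ f1 &
                                       k = (n0 f0 + t%:E * n1 f1)%E]].

Definition interpolation_space (theta : R) : set (X -> R) :=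
  [set f | sum_space f /\
    (ereal_sup [set (t `^ (- theta))%:E * K_functional f t |
                t in [set t : R | 0 < t]%R] < +oo)%E].

End interpolation.

Section metric_measure.
Context {R : realType} {X : pointedMetricType R}.
Variable m : {measure set (borel X) -> \bar R}.

Definition is_radon :=
  (forall x : X, exists2 U : set X, open_nbhs x U & (m U < +oo)%E) /\
  (forall A : set (borel X), measurable A ->
     m A = ereal_sup [set m K | K in [set K : set X | compact K /\ K `<=` A]]).

Definition full_support :=
  forall U : set X, open U -> U !=set0 -> (0 < m U)%E.

Definition uniform_volume_control (Phi : R -> R) :=
  exists r0 c C : R, [/\ 0 < r0, 0 < c, 0 < C &
    forall (x : X) (r : R), 0 < r < r0 ->
      ((c * Phi r)%:E <= m (ball x r) <= (C * Phi r)%:E)%E].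

Definition KS_energy (p alpha : R) (f : X -> R) (r : R) : \bar R :=
  (\int[m]_x ((m (ball (x : X) r))^-1 *
     \int[m]_(y in ball (x : X) r)
        (`|f y - f x| `^ p / r `^ (p * alpha))%:E))%E.

Definition besov (alpha p : R) : set (X -> R) :=
  [set f | Lp m p f /\
    (ereal_sup [set KS_energy p alpha f r |
                r in [set r : R | 0 < r < 1]%R] < +oo)%E].

End metric_measure.

(* Main.v *)
Require Import Defs.
From mathcomp Require Import all_boot all_order all_algebra.
From mathcomp Require Import all_classical all_reals all_analysis.
From mathcomp Require Import measurable_realfun ring lra.
Set Implicit Arguments.
Unset Strict Implicit.
Unset Printing Implicit Defensive.
Import Order.TTheory GRing.Theory Num.Theory.
Import numFieldNormedType.Exports.
Local Open Scope classical_set_scope.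
Local Open Scope ring_scope.

(** Let E be the Korevaar-Schoen energy at scale r and t = r^alpha_p, so that
t^p = r^(p + dh - 1).

Lower bound for K. Given f = f0 + f1 with f1 of finite energy, cover the space
by balls of radius r around a separated net. By the volume control boundedly
many of the doubled balls meet at a point. On such a ball the part f0
contributes at most its norm to E, and |f1 y - f1 x| is at most the integral of
|df1| over the segment from x to y, so that Jensen's inequality gives the
contribution r^(p-1) times the integral of |df1|^p over the skeleton of the
doubled ball, times the volume r^dh of the ball. Altogether
E <= C (|f0|^p + t^p |df1|^p) in the respective norms ([KS_energy_le]). For
p = 1 the definition of BV by approximation lets one replace f1 by Sobolev
functions ([energy_approx]).

Upper bound. Let delta = r / 16 and take the means f_k of f on the balls of
radius 2 delta around the points a_k of a delta-separated net. With D the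
distance to the net, put
  f1 y = min_k (f_k + L_k (d(a_k, y) - D y))
over the net points close to y, where L_k is the largest difference quotient of
the means around a_k. This function is Lipschitz, lies between the means of the
net points close to y, and is piecewise affine along segments; its slope
vanishes except at the points that lie on a segment between two close net
points, because elsewhere d(a_k, y) and D y vary in parallel ([interp_germ]).
So f1 varies on boundedly many segments of length comparable to delta per net
point, with slopes controlled by the oscillation of f at scale r. Summation over
the net gives |f - f1|^p + t^p |df1|^p <= C E ([interpolant_of_means],
[energy_upper]). It is essential here that f1 is locally constant off these
segments: the skeleton of a ball may have infinite length, and a partition of
unity made of Lipschitz functions would vary on all of it.

Two facts about the weak gradient support these arguments. Its modulus does not
depend on the base point: the gradient at x is, up to sign, the density of f
along every segment, and such a density is unique by a Dynkin argument on sets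
whose trace on a segment is convex ([seg_density_uniq]). And a Lipschitz
function which is affine near every point in every direction has the slope
towards the base point as its gradient ([gradient_of_slopes]). The geometric
input is that geodesics issued from a point, once separated, form a geodesic
together ([junction], the arc axiom); it yields medians, convexity of balls and
the measurability of segments.

On a compact space the energies with exponent alpha differ from E by the factor
r^(-p alpha), which is t^(-p alpha / alpha_p), and scales bounded below only
see the norm of f; this identifies the Besov and the interpolation spaces
([besov_interpolation]). *)

(** * Geometry of real trees *)

Section tree_geometry.
Context {R : realType} {X : pointedMetricType R}.
Local Notation d := (@mdist R X).
Implicit Types (u v w x y z c : X) (T : set X) (s t a b : R).

Definition btw u z v := d u z + d z v = d u v.

Lemma dC u v : d u v = d v u. Proof. exact: metric_sym. Qed.
Lemma dtri v u w : d u w <= d u v + d v w. Proof. exact: metric_triangle. Qed.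
Lemma d_ge0 u v : 0 <= d u v. Proof. exact: mdist_ge0. Qed.
Lemma dxx u : d u u = 0. Proof. exact: mdistxx. Qed.
Lemma d_eq0 u v : d u v = 0 -> u = v. Proof. exact: mdist_positivity. Qed.

Lemma d_gt0 u v : u <> v -> 0 < d u v.
Proof. by move=> uv; rewrite mdist_gt0; apply/eqP. Qed.

Lemma in_ball x (e : R) y : ball x e y <-> d x y < e.
Proof. by rewrite ballEmdist. Qed.

Lemma btwC u z v : btw u z v -> btw v z u.
Proof. by rewrite /btw (dC v z) (dC z u) (dC v u) addrC. Qed.

Lemma btwl u v : btw u u v. Proof. by rewrite /btw dxx add0r. Qed.
Lemma btwr u v : btw u v v. Proof. by rewrite /btw dxx addr0. Qed.

Definition isom_on a (g : R -> X) :=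
  forall s t, 0 <= s -> s <= t -> t <= a -> d (g s) (g t) = t - s.

Lemma lip_within (g : R -> X) (A : set R) (L : R) : 0 <= L ->
  (forall s t, A s -> A t -> d (g s) (g t) <= L * `|s - t|) ->
  {within A, continuous g}.
Proof.
move=> L0 gL; apply/subspace_continuousP => s As.
apply/cvg_ballP => e e0; rewrite near_withinE.
have e1 : 0 < e / (L + 1) by apply: divr_gt0 => //; lra.
near=> t => At; apply/in_ball.
apply: (le_lt_trans (gL _ _ As At)).
have st : `|s - t| < e / (L + 1).
  by near: t; exact: (@nbhsx_ballx _ _ s _ e1).
rewrite ltr_pdivlMr in st; last lra.
have := normr_ge0 (s - t).
nra.
Unshelve. all: by end_near. Qed.

(** The concatenation of two geodesics that only meet at their common origin
is an injective path, so the arc axiom turns it into a geodesic. *)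
Lemma junction T a b (g1 g2 : R -> X) : is_tree T -> 0 <= a -> 0 <= b ->
  isom_on a g1 -> isom_on b g2 ->
  (forall s, 0 <= s <= a -> T (g1 s)) -> (forall s, 0 <= s <= b -> T (g2 s)) ->
  g1 0 = g2 0 ->
  (forall s t, 0 <= s <= a -> 0 <= t <= b -> g1 s = g2 t -> s = 0) ->
  d (g1 a) (g2 b) = a + b.
Proof.
move=> [_ Tarc] a0 b0 i1 i2 T1 T2 c12 meet.
have [ab0|ab0] := leP (a + b) 0.
  have -> : a = 0 by lra.
  have -> : b = 0 by lra.
  by rewrite c12 dxx addr0.
pose sg t := if t <= 0 then g1 (- t) else g2 t.
have sgL s t : - a <= s <= b -> - a <= t <= b -> d (sg s) (sg t) <= `|s - t|.
  wlog st : s t / s <= t.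
    move=> H sI tI; have [st|/ltW ts] := leP s t; first exact: H.
    by rewrite dC distrC; exact: H.
  move=> sI tI; rewrite distrC ger0_norm; last lra.
  rewrite /sg; case: (leP s 0) => s0; case: (leP t 0) => t0.
  - by rewrite dC i1; lra.
  - apply: (le_trans (dtri (g1 0) _ _)); rewrite {2}c12 dC.
    by rewrite i1 ?i2; lra.
  - by exfalso; lra.
  - by rewrite i2; lra.
have sginj s t : - a <= s <= b -> - a <= t <= b -> sg s = sg t -> s = t.
  wlog st : s t / s <= t.
    move=> H sI tI; have [st|/ltW ts] := leP s t; first exact: H.
    by move=> /esym sgts; apply/esym; exact: H.
  move=> sI tI; rewrite /sg; case: (leP s 0) => s0; case: (leP t 0) => t0 E.
  - have := i1 (- t) (- s); rewrite E dxx; lra.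
  - have s00 : - s = 0 by apply: (meet _ t) => //; lra.
    move: E; rewrite s00 c12 => E.
    have := i2 0 t; rewrite E dxx; lra.
  - by exfalso; lra.
  - have := i2 s t; rewrite E dxx; lra.
pose ka tau := sg (- a + tau * (a + b)).
have kaI tau : tau \in `[0, 1] -> - a <= - a + tau * (a + b) <= b.
  rewrite in_itv/= => /andP[t0 t1]; nra.
have := Tarc ka.
have ka0 : ka 0 = g1 a.
  by rewrite /ka mul0r addr0 /sg oppr_le0 a0 opprK.
have ka1 : ka 1 = g2 b.
  rewrite /ka mul1r addKr /sg; case: (leP b 0) => // b0'.
  by have -> : b = 0 by [lra]; rewrite oppr0 c12.
rewrite ka0 ka1 => /(_ _ _ _)-H.
have {}H : ka @` `[0, 1] = cseg T (g1 a) (g2 b).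
  apply: H.
  - apply: (@lip_within _ _ (a + b)); first lra.
    move=> s t sI tI; apply: le_trans (sgL _ _ (kaI _ sI) (kaI _ tI)) _.
    by rewrite opprD addrACA subrr add0r -mulrBl normrM mulrC ger0_norm//; lra.
  - move=> s t sI tI /sginj-/(_ (kaI _ sI) (kaI _ tI)) /addrI.
    by apply: mulIf; rewrite gt_eqF.
  - move=> _ [tau tauI <-]; rewrite /ka /sg; have := kaI _ tauI.
    by case: (leP _ 0) => ? ?; [apply: T1; lra|apply: T2; lra].
have : (ka @` `[0, 1]) (g1 0).
  exists (a / (a + b)).
    rewrite /= in_itv/=; apply/andP; split; first by apply: divr_ge0; lra.
    by rewrite ler_pdivrMr//; lra.
  by rewrite /ka divfK ?gt_eqF// addNr /sg lexx oppr0.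
rewrite H => -[phi [[_ phiI p0 p1] [s sI sE]]].
have e1 : 0 \in `[0, d (g1 a) (g2 b)] by rewrite in_itv/= lexx d_ge0.
have e2 : d (g1 a) (g2 b) \in `[0, d (g1 a) (g2 b)].
  by rewrite in_itv/= lexx d_ge0.
have A1 := phiI 0 s e1 sI.
have A2 := phiI s _ sI e2.
move: sI; rewrite in_itv/= => /andP[s0 s1].
rewrite p0 -sE dC i1// in A1.
rewrite p1 -sE c12 i2// in A2.
rewrite distrC ger0_norm in A1; last lra.
rewrite distrC ger0_norm in A2; last lra.
lra.
Qed.

Lemma isom_shift a b g (c : R) : isom_on a g -> 0 <= c -> c + b <= a ->
  isom_on b (fun t => g (c + t)).
Proof.
by move=> gi c0 cba s t s0 st tb; rewrite gi; lra.
Qed.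

(** The parameters at which two isometric paths agree form a closed set. *)
Lemma last_meeting a (g1 g2 : R -> X) : 0 <= a ->
  isom_on a g1 -> isom_on a g2 -> g1 0 = g2 0 ->
  exists s, [/\ 0 <= s <= a, g1 s = g2 s &
    forall t, s < t -> t <= a -> g1 t <> g2 t].
Proof.
move=> a0 i1 i2 g0.
pose C := [set s | 0 <= s <= a /\ g1 s = g2 s].
have C0 : C 0 by split => //; rewrite lexx.
have Cub : ubound C a by move=> s [/andP[_ ?] _].
have Csup : has_sup C by split; [exists 0|exists a].
have sI : 0 <= sup C <= a.
  apply/andP; split; first exact: ub_le_sup (proj2 Csup) _ C0.
  by apply: ge_sup => //; exists 0.
exists (sup C); split => //.
- apply: d_eq0; apply/eqP; rewrite eq_le d_ge0 andbT.
  apply/ler_addgt0Pl => e e0; rewrite addr0.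
  have e2 : 0 < e / 2 by lra.
  have [s [sIa gs] se] := sup_adherent e2 Csup.
  have ss : s <= sup C by exact: ub_le_sup (proj2 Csup) _ _.
  apply: (le_trans (dtri (g1 s) _ _)); rewrite {2}gs dC.
  by rewrite i1 ?i2; lra.
- move=> t st ta gt; have : t <= sup C; last lra.
  by apply: ub_le_sup (proj2 Csup) _ _; split => //; lra.
Qed.

Section in_tree.
Variable T : set X.
Hypotheses (Ttree : is_tree T) (Topen : open T).

Lemma tree_nbhs x : T x -> exists2 e, 0 < e & forall y, d x y < e -> T y.
Proof.
move=> Tx; have : nbhs x T by exact: open_nbhs_nbhs.
by move=> /nbhs_ballP[e/= e0 eT]; exists e => // y xy; apply: eT; apply/in_ball.
Qed.

(** A geodesic leaving the geodesic of the tree would, by the junction lemma,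
get too far from the end point. *)
Lemma tree_convex u v (g phi : R -> X) : T u -> T v ->
  is_geodesic T u v g -> isom_on (d u v) phi -> phi 0 = u ->
  phi (d u v) = v -> forall s, 0 <= s <= d u v -> phi s = g s.
Proof.
move=> Tu Tv [gT gI g0 g1] phiI phi0 phi1 s0 s0I.
have {}gI : isom_on (d u v) g.
  by move=> s t sa st td; rewrite gI ?in_itv/=; first (rewrite distrC ger0_norm; lra); lra.
apply: contrapT => ne.
have s0I' : isom_on s0 g by move=> s t ? ? ?; apply: gI; lra.
have s0I'' : isom_on s0 phi by move=> s t ? ? ?; apply: phiI; lra.
have [||s1 [s1I E1 after]] := last_meeting _ s0I' s0I''; first lra.
  by rewrite g0.
have s1s0 : s1 < s0.
  rewrite lt_neqAle andbC; have [_ ->] := andP s1I; apply/eqP => E.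
  by apply: ne; rewrite -E E1.
have [|eta eta0 etaT] := @tree_nbhs (g s1).
  by apply: gT; rewrite in_itv/=; lra.
pose e := Num.min (eta / 2) (s0 - s1).
have e0 : 0 < e by rewrite lt_min; lra.
have es : e <= s0 - s1 by rewrite ge_min lexx orbT.
have ee : e < eta by apply: (@le_lt_trans _ _ (eta / 2)); [rewrite ge_min lexx|lra].
have := @junction T (d u v - s1) e (fun t => g (s1 + t)) (fun t => phi (s1 + t)).
move=> /(_ Ttree _ (ltW e0))-J.
have {}J : d (g (s1 + (d u v - s1))) (phi (s1 + e)) = d u v - s1 + e.
  apply: J; first lra.
  - by apply: (isom_shift gI); lra.
  - by apply: (isom_shift phiI); lra.
  - by move=> s ?; apply: gT; rewrite in_itv/=; lra.
  - move=> s sI; apply: etaT; rewrite E1 phiI; lra.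
  - by rewrite addr0.
  - move=> s t sI tI E.
    have A : d u (g (s1 + s)) = s1 + s.
      by rewrite -{1}g0 gI; lra.
    have B : d u (phi (s1 + t)) = s1 + t.
      by rewrite -{1}phi0 phiI; lra.
    have st : s = t by move: B; rewrite -E A; lra.
    have [//|sp] := eqVneq s 0; exfalso.
    apply: (after (s1 + s)); [|lra|by rewrite E st].
    by rewrite ltrDl lt_neqAle eq_sym sp; lra.
move: J; rewrite [X in g X]addrC subrK g1 -{1}phi1 dC phiI; lra.
Qed.

Lemma tree_geo u v : T u -> T v -> exists g, is_geodesic T u v g.
Proof. by move=> Tu Tv; have [/(_ u v Tu Tv)[]] := Ttree. Qed.

Lemma geo_isom u v g : is_geodesic T u v g -> isom_on (d u v) g.
Proof.
move=> [_ gI _ _] s t s0 st td.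
by rewrite gI ?in_itv/=; first (rewrite distrC ger0_norm; lra); lra.
Qed.

Lemma geo_dl u v g s : is_geodesic T u v g -> 0 <= s <= d u v ->
  d u (g s) = s.
Proof.
move=> gg sI; have gi := geo_isom gg; have [_ _ g0 _] := gg.
by rewrite -{1}g0 gi; lra.
Qed.

Lemma geo_dr u v g s : is_geodesic T u v g -> 0 <= s <= d u v ->
  d (g s) v = d u v - s.
Proof.
move=> gg sI; have gi := geo_isom gg; have [_ _ _ g1] := gg.
by rewrite -{1}g1 gi; lra.
Qed.

(** Geodesics from u to z and from z to v concatenate to an isometric path, so
betweenness in the metric sense is membership in the geodesic. *)
Lemma tree_btw_geo u v z g : T u -> T v -> T z -> is_geodesic T u v g ->
  btw u z v -> z = g (d u z).
Proof.
move=> Tu Tv Tz gg uzv.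
have [h1 h1g] := tree_geo Tu Tz; have [h2 h2g] := tree_geo Tz Tv.
have i1 := geo_isom h1g; have i2 := geo_isom h2g.
have [_ _ h10 h11] := h1g; have [_ _ h20 h21] := h2g.
pose m := d u z.
have m0 : 0 <= m by exact: d_ge0.
have zv0 := d_ge0 z v.
have uzv' : m + d z v = d u v by [].
pose phi t := if t <= m then h1 t else h2 (t - m).
have phi0 : phi 0 = u by rewrite /phi m0.
have phi1 : phi (d u v) = v.
  rewrite /phi; case: (leP _ m) => H.
    have E : z = v by apply: d_eq0; lra.
    have -> : d u v = m by rewrite /m E.
    by rewrite h11.
  by have -> : d u v - m = d z v by [lra]; rewrite h21.
have dl t : 0 <= t <= d u v -> d u (phi t) <= t.
  move=> tI; rewrite /phi; case: (leP _ m) => H.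
    by rewrite (geo_dl h1g)// H; lra.
  apply: (le_trans (dtri z _ _)); rewrite (geo_dl h2g); rewrite -/m; lra.
have dr t : 0 <= t <= d u v -> d (phi t) v <= d u v - t.
  move=> tI; rewrite /phi; case: (leP _ m) => H.
    apply: (le_trans (dtri z _ _)); rewrite (geo_dr h1g) -/m; lra.
  by rewrite (geo_dr h2g); rewrite -/m; lra.
have phiI : isom_on (d u v) phi.
  move=> s t s0 st td; have sI : 0 <= s <= d u v by lra.
  have tI : 0 <= t <= d u v by lra.
  apply/eqP; rewrite eq_le; apply/andP; split; last first.
    have := dl _ sI; have := dr _ tI; have := dtri (phi s) u v.
    by have := dtri (phi t) (phi s) v; lra.
  rewrite /phi; case: (leP s m) => sm; case: (leP t m) => tm.
  - by rewrite i1 //; rewrite -/m; lra.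
  - apply: (le_trans (dtri z _ _)); rewrite (geo_dr h1g) ?(geo_dl h2g) -/m; lra.
  - by lra.
  - by rewrite i2; lra.
have := tree_convex Tu Tv gg phiI phi0 phi1 (s := m).
by rewrite /phi lexx h11; apply; lra.
Qed.

Lemma tree_sub u v (a b : X) : T u -> T v -> T a -> T b ->
  btw u a v -> btw u b v -> d u a <= d u b -> d a b = d u b - d u a.
Proof.
move=> Tu Tv Ta Tb ua ub ab; have [g gg] := tree_geo Tu Tv.
have gi := geo_isom gg; have b0 := d_ge0 b v.
rewrite {1}(tree_btw_geo Tu Tv Ta gg ua) {1}(tree_btw_geo Tu Tv Tb gg ub).
by apply: gi => //; [exact: d_ge0|move: ub; rewrite /btw; lra].
Qed.

Lemma tree_btw_uniq u v z z' : T u -> T v -> T z -> T z' ->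
  btw u z v -> btw u z' v -> d u z = d u z' -> z = z'.
Proof.
move=> Tu Tv Tz Tz' zb zb' zz'; have [g gg] := tree_geo Tu Tv.
by rewrite (tree_btw_geo Tu Tv Tz gg zb) (tree_btw_geo Tu Tv Tz' gg zb') zz'.
Qed.

Lemma tree_point u v s : T u -> T v -> 0 <= s <= d u v ->
  exists z, [/\ T z, d u z = s & d z v = d u v - s].
Proof.
move=> Tu Tv sI; have [g gg] := tree_geo Tu Tv.
exists (g s); split; [|exact: geo_dl gg sI|exact: geo_dr gg sI].
by have [gT _ _ _] := gg; apply: gT; rewrite in_itv/=.
Qed.

(** The point where the geodesics from u to v and from u to w part; by the
junction lemma their remainders form a geodesic. *)
Lemma tree_median u v w : T u -> T v -> T w ->
  exists c, [/\ T c, btw u c v, btw u c w & btw v c w].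
Proof.
move=> Tu Tv Tw.
have [g gg] := tree_geo Tu Tv; have [h hg] := tree_geo Tu Tw.
have gi := geo_isom gg; have hi := geo_isom hg.
have [gT _ g0 g1] := gg; have [hT _ h0 h1] := hg.
pose a := Num.min (d u v) (d u w).
have a0 : 0 <= a by rewrite le_min !d_ge0.
have av : a <= d u v by rewrite ge_min lexx.
have aw : a <= d u w by rewrite ge_min lexx orbT.
have gi' : isom_on a g by move=> s t ? ? ?; apply: gi; lra.
have hi' : isom_on a h by move=> s t ? ? ?; apply: hi; lra.
have [|s1 [s1I E1 after]] := last_meeting a0 gi' hi'; first by rewrite g0.
have Tc : T (g s1) by apply: gT; rewrite in_itv/=; lra.
exists (g s1); split => //.
- by rewrite /btw (geo_dl gg) ?(geo_dr gg); lra.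
- by rewrite E1 /btw (geo_dl hg) ?(geo_dr hg); lra.
rewrite /btw dC (geo_dr gg); last lra.
rewrite E1 (geo_dr hg); last lra.
have := @junction T (d u v - s1) (d u w - s1)
  (fun t => g (s1 + t)) (fun t => h (s1 + t)) Ttree.
have -> : s1 + (d u v - s1) = d u v by lra.
have -> : s1 + (d u w - s1) = d u w by lra.
rewrite g1 h1 => J.
apply/esym/J; [lra|lra|..].
- by apply: (isom_shift gi); lra.
- by apply: (isom_shift hi); lra.
- by move=> s ?; apply: gT; rewrite in_itv/=; lra.
- by move=> s ?; apply: hT; rewrite in_itv/=; lra.
- by rewrite addr0.
- move=> s t sI tI E.
  have A : d u (g (s1 + s)) = s1 + s by rewrite (geo_dl gg)//; lra.
  have B : d u (h (s1 + t)) = s1 + t by rewrite (geo_dl hg)//; lra.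
  have st : s = t by move: B; rewrite -E A; lra.
  have [//|sp] := eqVneq s 0; exfalso.
  apply: (after (s1 + s)); [| |by rewrite E st].
    by rewrite ltrDl lt_neqAle eq_sym sp; lra.
  by rewrite le_min; lra.
Qed.

Lemma osegP u v z : T u -> T v ->
  oseg T u v z <-> [/\ T z, btw u z v, z <> u & z <> v].
Proof.
move=> Tu Tv; split.
- move=> [phi [pg [s]]]; rewrite in_itv/= => sI ->.
  have sI' : 0 <= s <= d u v by lra.
  have [pT _ p0 p1] := pg.
  have A := geo_dl pg sI'; have B := geo_dr pg sI'.
  split; first by apply: pT; rewrite in_itv.
  + by rewrite /btw A B; lra.
  + by move=> E; move: A; rewrite E dxx; lra.
  + by move=> E; move: B; rewrite E dxx; lra.
- move=> [Tz zb zu zv]; have [g gg] := tree_geo Tu Tv.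
  exists g; split; first exact: gg.
  exists (d u z); last exact: (tree_btw_geo Tu Tv Tz gg zb).
  rewrite in_itv/=; have := d_gt0 (nesym zu); have := d_gt0 zv.
  by move: zb; rewrite /btw; lra.
Qed.

(** The median c of u, v and w splits [u, v] into a part of [u, w] and a part
of [w, v]. *)
Lemma tree_side u v z w : T u -> T v -> T z -> T w -> btw u z v ->
  btw u z w \/ btw w z v.
Proof.
move=> Tu Tv Tz Tw zb; have [c [Tc cuv cuw cvw]] := tree_median Tu Tv Tw.
have [le|/ltW le] := leP (d u z) (d u c).
- left; have [z' [Tz' z'1 z'2]] := @tree_point u c (d u z) Tu Tc
    ltac:(by rewrite d_ge0 le).
  have -> : z = z'.
    apply: (tree_btw_uniq Tu Tv Tz Tz' zb) => //.
    move: cuv; rewrite /btw.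
    by have := dtri z' u v; have := dtri c z' v; lra.
  move: cuw; rewrite /btw.
  by have := dtri z' u w; have := dtri c z' w; lra.
- right; have [z' [Tz' z'1 z'2]] := @tree_point c v (d u z - d u c) Tc Tv
    ltac:(by move: zb cuv; rewrite /btw; have := d_ge0 z v; lra).
  have E : z = z'.
    apply: (tree_btw_uniq Tu Tv Tz Tz' zb) => //;
    move: cuv zb; rewrite /btw;
    by have := dtri z' u v; have := dtri c u z'; lra.
  rewrite E; move: cuv zb cvw; rewrite /btw (dC v c) (dC v w).
  have := dtri z' w v; have := dtri c w z'; rewrite (dC c w); lra.
Qed.

End in_tree.

End tree_geometry.

(** * Short segments and the skeleton *)

Section skeleton.
Context {R : realType} {X : pointedMetricType R} (iota : X -> R) (V : set X).
Variables (nu : {measure set (skel_type iota V) -> \bar R}) (i0 : R).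
Local Notation d := (@mdist R X).
Local Notation S := (skeleton iota).
Local Notation B x := (ball x (iota x)).
Implicit Types (u v w x y z c : X).

(** What the analysis of the weak gradient uses of the space, V and nu; i0 is a
radius at which all balls are trees. *)
Record length_tree : Prop := LengthTree {
  lt_i0 : 0 < i0 ;
  lt_tree0 : forall x, is_tree (ball x i0) ;
  lt_tree : forall x, is_tree (B x) ;
  lt_iota : forall x, i0 <= iota x ;
  lt_conn : connected [set: X] ;
  lt_two : exists x y : X, x <> y ;
  lt_count : countable V ;
  lt_sub : V `<=` S ;
  lt_dense : S `<=` closure V ;
  lt_length : is_length_measure nu }.

(** The open segment in terms of the metric alone: for short segments it agrees
with the segments of all the trees that contain the end points, which makes
these comparable. *)
Definition seg u v : set X := [set z | [/\ btw u z v, z <> u & z <> v]].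

Hypothesis H : length_tree.
Lemma i0_gt0 : 0 < i0. Proof. exact: lt_i0 H. Qed.
Lemma iota_gt0 x : 0 < iota x.
Proof. by have := i0_gt0; have := lt_iota H x; lra. Qed.
Local Notation M A := (measurable (A : set (skel_type iota V))).

Lemma open_ballX x e : open (ball x e).
Proof.
rewrite openE => y /= /in_ball xy; apply/nbhs_ballP.
exists (e - d x y) => /=; first lra.
by move=> z /in_ball yz; apply/in_ball; have := dtri y x z; lra.
Qed.

Lemma ball0_center x : ball x i0 x.
Proof. by apply/in_ball; rewrite dxx i0_gt0. Qed.

Lemma B_center x : B x x.
Proof. by apply/in_ball; rewrite dxx iota_gt0. Qed.

Lemma btw_ball x e u z : btw x z u -> d x u < e -> ball x e z.
Proof. by rewrite /btw => xzu xu; apply/in_ball; have := d_ge0 z u; lra. Qed.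

Lemma seg_mk u v z : btw u z v -> 0 < d u z -> 0 < d z v -> seg u v z.
Proof. by move=> zb zu zv; split => // E; subst z; rewrite dxx ltxx in zu zv. Qed.

Lemma seg_sym u v : seg u v = seg v u.
Proof. by apply/seteqP; split => z [/btwC ? ? ?]. Qed.

Lemma seg0 u : seg u u = set0.
Proof.
apply/seteqP; split => // z [zb zu _]; apply: zu; apply: d_eq0.
by move: zb; rewrite /btw dxx (dC u z); have := d_ge0 z u; lra.
Qed.

(** By uniqueness of geodesics, the geodesic of T is also the one of a small
ball, which contains all the points that are metrically between u and v. *)
Lemma small_convex T u v z : is_tree T -> open T -> T u -> T v ->
  d u v < i0 -> btw u z v -> T z.
Proof.
move=> Tt To Tu Tv uv uzv.
have B0 := lt_tree0 H u; have O0 := @open_ballX u i0.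
have Bu := ball0_center u; have Bv : ball u i0 v by apply/in_ball.
have [g gg] := tree_geo B0 Bu Bv; have [h hh] := tree_geo Tt Tu Tv.
have zE := tree_btw_geo B0 O0 Bu Bv (btw_ball uzv uv) gg uzv.
have [_ _ g0 g1] := gg; have [hT _ _ _] := hh.
have zI : 0 <= d u z <= d u v.
  by move: uzv; rewrite /btw; have := d_ge0 u z; have := d_ge0 z v; lra.
rewrite zE (tree_convex Tt To Tu Tv hh (geo_isom gg) g0 g1 zI).
by apply: hT; rewrite in_itv.
Qed.

Lemma oseg_seg T u v : is_tree T -> open T -> T u -> T v -> d u v < i0 ->
  oseg T u v = seg u v.
Proof.
move=> Tt To Tu Tv uv; apply/seteqP; split => z.
  by move=> /(osegP Tt To _ Tu Tv)[].
move=> [zb zu zv]; apply/osegP => //; split => //.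
exact: small_convex zb.
Qed.

Lemma oseg_segB u v : d u v < i0 -> oseg (B u) u v = seg u v.
Proof.
move=> uv; apply: oseg_seg => //; first exact: (lt_tree H).
- exact: open_ballX.
- exact: B_center.
- by apply/in_ball; have := lt_iota H u; lra.
Qed.

Lemma seg_S u v z : d u v < i0 -> seg u v z -> S z.
Proof.
move=> uv zuv; exists u, v; rewrite oseg_segB//; split => //.
by apply/in_ball; have := lt_iota H u; lra.
Qed.

(** The tree axioms for short segments, where the balls of radius i0 no longer
appear. *)
Lemma seg_point u v s : d u v < i0 -> 0 <= s <= d u v ->
  exists z, d u z = s /\ d z v = d u v - s.
Proof.
move=> uv sI; have Bv : ball u i0 v by apply/in_ball.
have [z [_ ? ?]] := tree_point (lt_tree0 H u) (ball0_center u) Bv sI.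
by exists z.
Qed.

Lemma side u v z w : d u v < i0 -> d u w < i0 -> btw u z v ->
  btw u z w \/ btw w z v.
Proof.
move=> uv uw zb; apply: (tree_side (lt_tree0 H u) (@open_ballX u i0)) (zb).
- exact: ball0_center.
- by apply/in_ball.
- exact: btw_ball zb _.
- by apply/in_ball.
Qed.

Lemma uniq_pt u v z z' : d u v < i0 -> btw u z v -> btw u z' v ->
  d u z = d u z' -> z = z'.
Proof.
move=> uv zb zb'.
apply: (tree_btw_uniq (lt_tree0 H u) (@open_ballX u i0)) (zb) (zb').
- exact: ball0_center.
- by apply/in_ball.
- exact: btw_ball zb _.
- exact: btw_ball zb' _.
Qed.

Lemma median u v w : d u v < i0 -> d u w < i0 ->
  exists c, [/\ btw u c v, btw u c w & btw v c w].
Proof.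
move=> uv uw; have Bv : ball u i0 v by apply/in_ball.
have Bw : ball u i0 w by apply/in_ball.
have [c [_ ? ? ?]] := tree_median (lt_tree0 H u) (ball0_center u) Bv Bw.
by exists c.
Qed.

Lemma oseg_short T x y z e : is_tree T -> open T -> T x -> T y ->
  oseg T x y z -> 0 < e -> exists u v,
  [/\ seg u v z, d u z < e, d z v < e & d u v < i0].
Proof.
move=> Tt To Tx Ty /(osegP Tt To z Tx Ty)[Tz zb zx zy] e0.
have I0 := i0_gt0.
have xz := d_gt0 (nesym zx); have zy' := d_gt0 zy.
pose r := Num.min (Num.min (d x z) (d z y)) (Num.min (e / 2) (i0 / 3)).
have r0 : 0 < r by rewrite !lt_min; lra.
have rx : r <= d x z by rewrite !ge_min lexx.
have ry : r <= d z y by rewrite !ge_min lexx orbT.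
have re : r <= e / 2 by rewrite !ge_min lexx !orbT.
have ri : r <= i0 / 3 by rewrite !ge_min lexx !orbT.
have [u [Tu xu uz]] := @tree_point _ _ _ Tt x z (d x z - r) Tx Tz ltac:(lra).
have [v [Tv zv vy]] := @tree_point _ _ _ Tt z y r Tz Ty ltac:(lra).
exists u, v.
move: zb; rewrite /btw => zb.
have uv : d u v = r + r.
  have := dtri z u v; have := dtri u x y; have := dtri v u y; lra.
split; [split; [rewrite /btw; lra|move=> E; move: uz; rewrite E dxx; lra|
  move=> E; move: zv; rewrite E dxx; lra]|lra|lra|lra].
Qed.

Lemma S_seg z e : S z -> 0 < e -> exists u v,
  [/\ seg u v z, d u z < e, d z v < e & d u v < i0].
Proof.
move=> [x [y [Bxy]]]; apply: oseg_short => //; first exact: (lt_tree H).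
- exact: open_ballX.
- exact: B_center.
Qed.

Lemma oseg_S T u v : is_tree T -> open T -> T u -> T v -> oseg T u v `<=` S.
Proof.
move=> Tt To Tu Tv z /(oseg_short Tt To Tu Tv)/(_ ltr01)[a [b [zab _ _ ab]]].
exact: seg_S zab.
Qed.

(** Since the space is connected and has two points, no point is isolated. *)
Lemma S_near x e : 0 < e -> exists2 z, S z & d x z < e.
Proof.
move=> e0; pose r := Num.min e i0.
have r0 : 0 < r by rewrite lt_min e0 i0_gt0.
have [y xy yr] : exists2 y, x <> y & d x y < r.
  apply: contrapT => iso; have isoE : ball x r = [set x].
    apply/seteqP; split => [y /in_ball xy|_ ->]; last first.
      by apply/in_ball; rewrite dxx.
    by apply: contrapT => /nesym ne; apply: iso; exists y.
  have xT : [set x] = [set: X].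
    apply: (lt_conn H); first by exists x.
      by exists [set x]; rewrite ?setTI// -isoE; exact: open_ballX.
    exists [set x]; rewrite ?setTI//.
    apply/accessible_closed_set1; apply: hausdorff_accessible.
    exact: metric_hausdorff.
  have [a [b]] := lt_two H; apply.
  have : [set: X] a by [].
  by rewrite -xT => ->; have : [set: X] b by []; rewrite -xT.
have ye : d x y < e by apply: lt_le_trans yr _; rewrite ge_min lexx.
have yi : d x y < i0 by apply: lt_le_trans yr _; rewrite ge_min lexx orbT.
have xy0 := d_gt0 xy.
have [z [z1 z2]] := @seg_point x y (d x y / 2) yi ltac:(lra).
exists z; last lra.
apply: (seg_S yi); split; [by rewrite /btw; lra|..] => E.
  by move: z1; rewrite E dxx; lra.
by move: z2; rewrite E dxx; lra.
Qed.

Lemma V_near z e : 0 < e -> exists2 a, V a & d z a < e.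
Proof.
move=> e0; have e2 : 0 < e / 2 by lra.
have [y Sy zy] := S_near z e2.
have := lt_dense H Sy (nbhsx_ballx y _ e2) => -[a [Va /in_ball ya]].
by exists a => //; have := dtri y z a; lra.
Qed.

Lemma V_enum : exists a : nat -> X, (forall n, V (a n)) /\
  (forall v, V v -> exists n, a n = v).
Proof.
have [v0 Vv0 _] := @V_near (@point X) 1 ltr01.
have /countable_injP[f finj] := lt_count H.
exists (fun n => xget v0 [set v | V v /\ f v = n]); split.
  by move=> n; case: xgetP => [y -> []|].
move=> v Vv; exists (f v); case: xgetP => [y _ [Vy fy]|].
  by apply: finj; rewrite ?inE.
by move=> /(_ v); case.
Qed.

Lemma V_dense_seq : exists a : nat -> X, (forall n, V (a n)) /\
  (forall x e, 0 < e -> exists n, d (a n) x < e).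
Proof.
have [a [Va aV]] := V_enum; exists a; split=> // x e e0.
by have [b Vb xb] := V_near x e0; have [n nb] := aV _ Vb; exists n; rewrite nb dC.
Qed.

Lemma M_gen a b : V a -> V b -> d a b < i0 -> M (seg a b).
Proof.
move=> Va Vb ab; apply: sub_sigma_algebra; exists a, b; split => //.
  by have := lt_iota H a; lra.
by rewrite oseg_segB.
Qed.

Lemma seg_len u v : S u -> S v -> d u v < i0 -> nu (seg u v) = (d u v)%:E.
Proof.
move=> Su Sv uv; rewrite -oseg_segB//; apply: (proj1 (lt_length H)) => //.
by have := lt_iota H u; lra.
Qed.

(** A segment is approximated from inside by segments with end points in V;
these may branch off, but only close to the end points. *)
Lemma seg_approx u v e : d u v < i0 -> 0 < e -> 4 * e < d u v ->
  exists E : set X, [/\ M E, (nu E <= (d u v)%:E)%E,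
    forall z, seg u v z -> 2 * e < d u z -> 2 * e < d z v -> E z &
    forall z, E z -> d u z + d z v <= d u v + 4 * e /\ z <> u /\ z <> v].
Proof.
move=> uv e0 euv.
have [a [a1 a2]] := @seg_point u v e uv ltac:(lra).
have [b [b1 b2]] := @seg_point u v (d u v - e) uv ltac:(lra).
have e2 : 0 < e / 2 by lra.
have [x Vx ax] := V_near a e2; have [y Vy by_] := V_near b e2.
have ab : d a b = d u v - 2 * e.
  have [] : btw u a b \/ btw b a v by apply: side => //; rewrite /btw; lra.
    by rewrite /btw; lra.
  by rewrite /btw; have := dtri a b v; rewrite (dC b a); have := d_ge0 a b; lra.
have xyL : d x y < i0.
  by have := dtri a x y; have := dtri b a y; rewrite (dC x a); lra.
have ux : d u x < i0 by have := dtri a u x; lra.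
have uy : d u y < i0 by have := dtri b u y; lra.
have au : d a u < i0 by rewrite dC; lra.
exists (seg x y); split; first exact: M_gen.
- rewrite seg_len ?lee_fin//; [|exact: (lt_sub H)..].
  by have := dtri a x y; have := dtri b a y; have := dC x a; lra.
- move=> z [zb zu zv] uz zv'.
  have bz : btw x z v.
    case: (side uv ux zb) => //; rewrite /btw => h.
    by have := dtri a u x; have := d_ge0 z x; lra.
  split.
  + have xv : d x v < i0 by have := dtri a x v; rewrite (dC x a); lra.
    case: (side xv xyL bz) => //; rewrite /btw => h.
    have := dtri b y v; rewrite (dC y b); have := d_ge0 y z; lra.
  + by move=> E; move: uz; rewrite E; have := dtri a u x; lra.
  + by move=> E; move: zv'; rewrite E; have := dtri b y v; rewrite (dC y b); lra.
- move=> z [zb zx zy]; move: zb; rewrite /btw => zb; split.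
    have := dtri x u z; have := dtri y z v; have := dtri a u x.
    have := dtri b y v; rewrite (dC y b); have := dtri a x y; rewrite (dC x a).
    by have := dtri b a y; lra.
  split=> E; subst z.
  + have := dtri y u b; have := dtri x a u; have := dtri a x y.
    have := dtri b a y; have := dC y b; have := dC x a; have := dC a u.
    lra.
  + have := dtri x a v; have := dtri y b v; have := dtri a x y.
    have := dtri b a y; have := dC y v; have := dC x a.
    lra.
Qed.

End skeleton.

(** * Measurability and length of segments *)

Section almost_everywhere.
Context {dd} {T : measurableType dd} {R : realType}.
Variable mu : {measure set T -> \bar R}.

Lemma aeS (P Q : T -> Prop) : (forall x, P x -> Q x) ->
  (\forall x \ae mu, P x) -> \forall x \ae mu, Q x.
Proof. by move=> PQ; apply: filterS. Qed.

Lemma aeS2 (P P' Q : T -> Prop) : (forall x, P x -> P' x -> Q x) ->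
  (\forall x \ae mu, P x) -> (\forall x \ae mu, P' x) -> \forall x \ae mu, Q x.
Proof. by move=> PQ; apply: filterS2. Qed.

Lemma null_sub2 (A B C : set T) : measurable A -> measurable B ->
  measurable C -> mu A = 0%E -> mu B = 0%E -> C `<=` A `|` B -> mu C = 0%E.
Proof.
move=> mA mB mC A0 B0 CAB; apply/(negligibleP mu mC).
by apply: negligibleS CAB _; apply: negligibleU; exact/negligibleP.
Qed.

End almost_everywhere.

Section skeleton_measure.
Context {R : realType} {X : pointedMetricType R} (iota : X -> R) (V : set X).
Variables (nu : {measure set (skel_type iota V) -> \bar R}) (i0 : R).
Local Notation d := (@mdist R X).
Local Notation S := (skeleton iota).
Local Notation B x := (ball x (iota x)).
Implicit Types (u v w x y z c : X).
Hypothesis H : length_tree nu i0.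
Local Notation M A := (measurable (A : set (skel_type iota V))).

(** Up to their end parts, segments with end points in V near u and v agree with
]u, v[, which is their limit inferior. *)
Lemma measurable_seg u v : d u v < i0 -> M (seg u v).
Proof.
move=> uv; have [->|/eqP ne] := eqVneq u v; first by rewrite seg0; exact: measurable0.
have l0 := d_gt0 ne.
pose e n : R := d u v / 8 * n.+1%:R^-1.
have inv0 n : 0 < n.+1%:R^-1 :> R by rewrite invr_gt0 ltr0n.
have e0 n : 0 < e n by apply: mulr_gt0; [lra|exact: inv0].
have e1 n : 4 * e n < d u v.
  have : n.+1%:R^-1 <= 1 :> R by rewrite invf_le1 ?ltr0n// ler1n.
  by have := inv0 n; rewrite /e/=; set q := _^-1; nra.
have e_small t : 0 < t -> exists N, forall n, (N <= n)%N -> 4 * e n < t.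
  move=> t0; have t1 : 0 < 2 * t / d u v by apply: divr_gt0 => //; lra.
  have [N _ NP] := near_infty_natSinv_lt (PosNum t1).
  exists N => n /NP /=; rewrite ltr_pdivlMr// /e; set q := _^-1; nra.
have /choice[E EP] n := seg_approx H uv (e0 n) (e1 n).
have -> : seg u v = \bigcup_N \bigcap_(n in [set n | (N <= n)%N]) E n.
  apply/seteqP; split => z.
    move=> [zb zu zv].
    have uz0 := d_gt0 (nesym zu); have zv0 := d_gt0 zv.
    have t0 : 0 < Num.min (d u z) (d z v) by rewrite lt_min uz0.
    have [N NP] := e_small _ t0.
    exists N => // n /= /NP; rewrite lt_min => /andP[n1 n2].
    have [_ _ + _] := EP n; have := e0 n => ?; apply => //; lra.
  move=> [N _ Ez].
  have [_ _ _ /(_ z)/(_ (Ez N _))[|_ [zu zv]]] := EP N; first by rewrite /=.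
  split => //; apply/eqP; rewrite eq_le dtri andbT.
  apply/ler_addgt0Pl => t /e_small [N' N'P].
  have := N'P (maxn N N') (leq_maxr _ _).
  have [_ _ _ /(_ z)/(_ (Ez _ _))[|+ _]] := EP (maxn N N').
    by rewrite /= leq_maxl.
  by lra.
apply: bigcup_measurable => N _; apply: bigcap_measurable.
  by exists N => /=.
by move=> n _; have [] := EP n.
Qed.

Lemma measurable_pt z : S z -> M [set z].
Proof.
move=> /(S_seg H)/(_ ltr01)[u [v [zuv _ _ uv]]]; have [zb zu zv] := zuv.
have := zb; rewrite /btw => zbE; have uz0 := d_ge0 u z; have zv0 := d_ge0 z v.
have -> : [set z] = seg u v `\` (seg u z `|` seg z v).
  apply/seteqP; split => [_ ->|w [[wb wu wv] Nw]].
    by split => //; case=> -[].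
  apply: contrapT => wz; apply: Nw.
  have [?|?] := @side _ _ _ _ _ _ H _ _ _ z uv ltac:(lra) wb; [left|right].
    by split.
  by split.
apply: measurableD; first exact: measurable_seg.
by apply: measurableU; apply: measurable_seg; lra.
Qed.

Lemma seg_split u v z : d u v < i0 -> seg u v z ->
  seg u v = seg u z `|` [set z] `|` seg z v.
Proof.
move=> uv [zb zu zv].
have := zb; rewrite /btw => zbE; have uz0 := d_gt0 (nesym zu).
have zv0 := d_gt0 zv.
apply/seteqP; split => w.
  move=> [wb wu wv]; have [->|/eqP wz] := eqVneq w z; first by left; right.
  have [?|?] := @side _ _ _ _ _ _ H _ _ _ z uv ltac:(lra) wb.
    by left; left.
  by right.
move=> [[[wb wu wz]|->]|[wb wz wv]] //.
- move: wb; rewrite /btw => wb; split=> //.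
    by apply/eqP; rewrite eq_le dtri andbT; have := dtri z w v; lra.
  by move=> E; move: wb; rewrite E; have := d_ge0 v z; lra.
- move: wb; rewrite /btw => wb; split=> //.
    by apply/eqP; rewrite eq_le dtri andbT; have := dtri z u w; lra.
  by move=> E; move: wb; rewrite E dC; have := d_ge0 u v; have := dC u z; lra.
Qed.

Lemma measure_seg_split u v z : d u v < i0 -> seg u v z ->
  nu (seg u v) = (nu (seg u z) + nu [set z] + nu (seg z v))%E.
Proof.
move=> uv zuv; have Sz := seg_S H uv zuv.
have [+ zu zv] := zuv; rewrite /btw => zb.
have uz0 := d_gt0 (nesym zu); have zv0 := d_gt0 zv.
have m1 : M (seg u z) by apply: measurable_seg; lra.
have m2 : M (seg z v) by apply: measurable_seg; lra.
have m3 := measurable_pt Sz.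
rewrite (seg_split uv zuv) measureU//; last 2 first.
- exact: measurableU.
- apply/seteqP; split => // w [[[w1 w2 w3]|->] [w4 w5 w6]]//.
  move: w1 w4; rewrite /btw; have := dtri w u v.
  have := d_gt0 w3; rewrite (dC z w); lra.
congr (_ + _)%E; rewrite measureU//.
by apply/seteqP; split => // w [[_ _ wz] /= wE]; apply: wz.
Qed.

(** Take z inside a longer segment: the lengths of the two halves add up to the
length of the segment, which leaves nothing for z. *)
Lemma nu_pt z : S z -> nu [set z] = 0%E.
Proof.
move=> Sz; have [u [v [zuv _ _ uv]]] := S_seg H Sz ltr01.
have [+ zu zv] := zuv; rewrite /btw => zb.
have uz0 := d_gt0 (nesym zu); have zv0 := d_gt0 zv.
have [a [a1 a2]] := @seg_point _ _ _ _ _ _ H u z (d u z / 2) ltac:(lra)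
  ltac:(lra).
have [b [b1 b2]] := @seg_point _ _ _ _ _ _ H z v (d z v / 2) ltac:(lra)
  ltac:(lra).
have Sa : S a.
  apply: (@seg_S _ _ _ _ _ _ H u z); first lra.
  by split; [rewrite /btw; lra|..] => E; subst a; [move: a1|move: a2];
    rewrite dxx; lra.
have Sb : S b.
  apply: (@seg_S _ _ _ _ _ _ H z v); first lra.
  by split; [rewrite /btw; lra|..] => E; subst b; [move: b1|move: b2];
    rewrite dxx; lra.
have ab : d a b = d a z + d z b.
  apply/eqP; rewrite eq_le dtri/=.
  by have := dtri a u v; have := dtri b a v; lra.
have abi : d a b < i0 by lra.
have zab : seg a b z.
  by split; [rewrite /btw; lra|..] => E; subst z; [move: a2|move: b1];
    rewrite dxx; lra.
have := measure_seg_split abi zab.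
rewrite !(seg_len H)//; [|lra|lra].
have : (0 <= nu [set z])%E by [].
case: (nu [set z]) => [r|//|//] r0 /=.
by rewrite -!EFinD => -[] E; congr (_%:E); lra.
Qed.

Lemma seg_sub u v a b : d u v < i0 -> btw u a v -> btw u b v ->
  d u a <= d u b -> d a b = d u b - d u a /\ seg a b `<=` seg u v.
Proof.
rewrite /btw => uv ua ub ab; have a0 := d_ge0 u a; have b0 := d_ge0 b v.
have E : d a b = d u b - d u a.
  have ubi : d u b < i0 by lra.
  have uai : d u a < i0 by lra.
  have [] := side H uv ubi ua; first by rewrite /btw; lra.
  by rewrite /btw; have := dC a b; have := d_ge0 b a; lra.
split=> // z [+ za zb]; rewrite /btw => zab.
have ? := dtri a u z; have ? := dtri b z v; have ? := dtri z u v.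
split; first by rewrite /btw; lra.
  by move=> zu; apply: za; apply: d_eq0; move: zab; subst z;
    have := dC a u; lra.
by move=> zv; apply: zb; apply: d_eq0; move: zab; subst z;
  have := dC b v; lra.
Qed.

Lemma seg_subE u v a b z : d u v < i0 -> btw u a v -> btw u b v ->
  d u a <= d u b -> seg a b z <-> [/\ seg u v z, d u a < d u z & d u z < d u b].
Proof.
move=> uv ua ub ab; have [abE sub] := seg_sub uv ua ub ab; split.
- move=> zab; have zuv := sub _ zab; have [+ zu zv] := zuv => zb.
  have [+ za zb'] := zab; rewrite /btw => zabE.
  have a0 := d_gt0 (nesym za); have b0 := d_gt0 zb'.
  split => //.
  + have [//|za'] := ltP (d u a) (d u z).
    have [E _] := seg_sub uv zb ua za'.
    have [|E' _] := seg_sub uv zb ub; first lra.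
    by have := dC a z; lra.
  + have [//|za'] := ltP (d u z) (d u b).
    have [E _] := seg_sub uv ub zb za'.
    have [|E' _] := seg_sub uv ua zb; first lra.
    by have := dC b z; lra.
- move=> [[zb zu zv] z1 z2].
  have [E1 _] := seg_sub uv ua zb (ltW z1).
  have [E2 _] := seg_sub uv zb ub (ltW z2).
  split; [by rewrite /btw; lra|..] => E; subst z; move: z1 z2; lra.
Qed.

Lemma nu_seg u v : d u v < i0 -> nu (seg u v) = (d u v)%:E.
Proof.
move=> uv; have [->|/eqP ne] := eqVneq u v.
  by rewrite seg0 measure0 dxx.
have l0 := d_gt0 ne.
have sub e : 0 < e -> 4 * e < d u v -> exists a b, [/\ S a /\ S b,
    btw u a v, btw u b v, d u a = e & d u b = d u v - e].
  move=> e0 e1; have [a [a1 a2]] := @seg_point _ _ _ _ _ _ H u v e uv ltac:(lra).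
  have [b [b1 b2]] := @seg_point _ _ _ _ _ _ H u v (d u v - e) uv ltac:(lra).
  exists a, b; split; [|rewrite /btw; lra|rewrite /btw; lra|lra|lra].
  by split; apply: (seg_S H uv); apply: seg_mk; rewrite /btw; lra.
have mS := measurable_seg uv.
apply/eqP; rewrite eq_le; apply/andP; split.
- pose e n : R := d u v / 8 * n.+1%:R^-1.
  have inv0 n : 0 < n.+1%:R^-1 :> R by rewrite invr_gt0 ltr0n.
  have e0 n : 0 < e n by apply: mulr_gt0; [lra|exact: inv0].
  have e1 n : 4 * e n < d u v.
    have : n.+1%:R^-1 <= 1 :> R by rewrite invf_le1 ?ltr0n// ler1n.
    by have := inv0 n; rewrite /e/=; set q := _^-1; nra.
  pose F n := [set z | [/\ seg u v z, e n < d u z & d u z < d u v - e n]].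
  have FE n : M (F n) /\ (nu (F n) <= (d u v)%:E)%E.
    have [a [b [[Sa Sb] ua ub a1 b1]]] := sub _ (e0 n) (e1 n).
    have ab : d u a <= d u b by have := e1 n; have := e0 n; lra.
    have [abE _] := seg_sub uv ua ub ab.
    have -> : F n = seg a b.
      by apply/seteqP; split=> z; rewrite (seg_subE z uv ua ub ab) a1 b1.
    have en := e0 n; have abi : d a b < i0 by lra.
    split; first exact: measurable_seg.
    by rewrite (seg_len H)// lee_fin; lra.
  have FU : \bigcup_n F n = seg u v.
    apply/seteqP; split => z; first by move=> [n _ []].
    move=> zuv; have [zb zu zv] := zuv.
    have uz0 := d_gt0 (nesym zu); have zv0 := d_gt0 zv.
    have t1 : 0 < Num.min (d u z) (d z v) / d u v.
      by apply: divr_gt0 => //; rewrite lt_min uz0.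
    have [N _ /(_ N (leqnn _))/=] := near_infty_natSinv_lt (PosNum t1).
    rewrite ltr_pdivlMr// lt_min => /andP[N1 N2].
    exists N => //; move: zb; rewrite /btw => zb; have := inv0 N.
    by rewrite /F/= /e; move: N1 N2; set q := _^-1; split => //; nra.
  have ndF : nondecreasing_seq F.
    move=> n k nk; apply/subsetPset => z [z1 z2 z3].
    have ekn : e k <= e n.
      by rewrite ler_pM2l ?lef_pV2 ?posrE ?ltr0n ?ler_nat//; lra.
    by split => //; lra.
  have := nondecreasing_cvg_mu (fun n => proj1 (FE n)) _ ndF (mu := nu).
  rewrite FU => /(_ mS) cF.
  rewrite -(cvg_lim _ cF)//; apply: lime_le; first by apply/cvg_ex; eexists; exact: cF.
  by apply: nearW => n; have [] := FE n.
- apply/lee_addgt0Pr => e e0.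
  pose r := Num.min (e / 2) (d u v / 8).
  have r0 : 0 < r by rewrite lt_min; apply/andP; split; lra.
  have re : r <= e / 2 by rewrite ge_min lexx.
  have r8 : r <= d u v / 8 by rewrite ge_min lexx orbT.
  have [a [b [[Sa Sb] ua ub a1 b1]]] := sub r r0 ltac:(lra).
  have [|ab sab] := seg_sub uv ua ub; first lra.
  have abi : d a b < i0 by lra.
  apply: (@le_trans _ _ (nu (seg a b) + e%:E)%E).
    by rewrite (seg_len H)// -EFinD lee_fin; lra.
  apply: leeD => //; apply: le_measure => //; rewrite inE//.
  exact: measurable_seg.
Qed.

(** Countability of V reduces measurability and almost everywhere statements to
single segments, which the sigma-field contains by definition. *)
Lemma S_cover (O : set X) : open O -> exists J : nat -> nat -> set X,
  S `&` O = \bigcup_n \bigcup_k J n k /\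
  forall n k, J n k = set0 \/ exists a b, [/\ V a, V b, d a b < i0,
    J n k = seg a b & forall z, btw a z b -> O z].
Proof.
move=> Oo; have [a [Va aV]] := V_enum H.
pose good n k := d (a n) (a k) < i0 /\ forall z, btw (a n) z (a k) -> O z.
exists (fun n k => [set z | good n k /\ seg (a n) (a k) z]).
split; last first.
  move=> n k; have [g|g] := pselect (good n k).
    right; exists (a n), (a k); split => //; [by case: g| |by case: g].
    by apply/seteqP; split => // z [].
  by left; apply/seteqP; split => // z [].
apply/seteqP; split => [z [Sz Oz]|z [n _ [k _ [[g1 g2] gz]]]]; last first.
  by split; [exact: (seg_S H g1)|apply: g2; case: gz].
have : nbhs z O by exact: open_nbhs_nbhs.
move=> /nbhs_ballP[e/= e0 eO].
have I0 := i0_gt0 H.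
have r0 : 0 < Num.min e (i0 / 2) by rewrite lt_min e0; lra.
have [u [v [[zb zu zv] uz' zv' uv]]] := S_seg H Sz r0.
move: uz' zv'; rewrite !lt_min => /andP[uz1 uz2] /andP[zv1 zv2].
have uz0 := d_gt0 (nesym zu); have zv0 := d_gt0 zv.
pose s := Num.min (Num.min (d u z) (d z v))
           (Num.min (e - d u z) (e - d z v)).
have s0 : 0 < s by rewrite !lt_min uz0 zv0 !subr_gt0 uz1 zv1.
have s1 : s <= d u z by rewrite !ge_min lexx.
have s2 : s <= d z v by rewrite !ge_min lexx orbT.
have s3 : s <= e - d u z by rewrite !ge_min lexx !orbT.
have s4 : s <= e - d z v by rewrite !ge_min lexx !orbT.
pose s' := Num.min s ((i0 - d u v) / 2).
have s'0 : 0 < s' by rewrite lt_min s0/=; lra.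
have s's : s' <= s by rewrite ge_min lexx.
have s'i : s' <= (i0 - d u v) / 2 by rewrite ge_min lexx orbT.
have [x Vx ux] := V_near H u s'0; have [y Vy vy] := V_near H v s'0.
have [n nx] := aV _ Vx; have [k ky] := aV _ Vy.
have xy : d x y < i0.
  by have := dtri u x y; have := dtri v u y; have := dC u x; lra.
have xv : d x v < i0 by have := dtri u x v; have := dC u x; lra.
have zb1 : btw x z v.
  have uxi : d u x < i0 by lra.
  have [|//] := side H uv uxi zb.
  by rewrite /btw => ?; have := d_ge0 z x; lra.
have zb2 : btw x z y.
  have [//|] := side H xv xy zb1.
  by rewrite /btw => ?; have := d_ge0 y z; have := dC y v; lra.
have xz : d x z < e by have := dtri u x z; have := dC u x; lra.
have zy : d z y < e by have := dtri v z y; lra.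
exists n => //; exists k => //; rewrite /good nx ky; split.
  split=> // w wb; apply: eO; apply/in_ball.
  have xzE := zb2; rewrite /btw in xzE.
  have xzi : d x z < i0 by have := d_ge0 z y; lra.
  have [] := side H xy xzi wb.
  - by rewrite /btw => ?; have := d_ge0 x w; have := dC z w; lra.
  - by rewrite /btw => ?; have := d_ge0 w y; lra.
split => //.
  by move=> E; move: ux; rewrite -E; lra.
by move=> E; move: vy; rewrite -E dC; lra.
Qed.

Lemma measurable_SI (O : set X) : open O -> M (S `&` O).
Proof.
move=> /S_cover[J [-> JP]].
apply: bigcup_measurable => n _; apply: bigcup_measurable => k _.
have [->|[a [b [_ _ ab -> _]]]] := JP n k; first exact: measurable0.
exact: measurable_seg.
Qed.

Lemma measurable_S : M S.
Proof. by rewrite -(setIT S); apply: measurable_SI; exact: openT. Qed.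

Lemma ae_SI (O : set X) (P : X -> Prop) : open O ->
  (forall a b, V a -> V b -> d a b < i0 -> (forall z, btw a z b -> O z) ->
    \forall z \ae nu, seg a b z -> P z) ->
  \forall z \ae nu, (S `&` O) z -> P z.
Proof.
move=> /S_cover[J [JE JP]] aeP.
have : \forall z \ae nu, forall n k, J n k z -> P z.
  apply/ae_foralln => n; apply/ae_foralln => k.
  have [->|[a [b [Va Vb ab -> abO]]]] := JP n k; first exact: aeW.
  exact: aeP.
by apply: aeS => z Pz; rewrite JE => -[n _ [k _ Jz]]; exact: Pz Jz.
Qed.

Lemma continuous_measurable_S (O : set X) (f : X -> R) : open O ->
  {in O, continuous f} ->
  measurable_fun (S `&` O : set (skel_type iota V)) f.
Proof.
move=> Oo fc mD; apply: (measurability _ (RGenOpens.measurableE R)) => //.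
move=> _ [_ [a [b ->]] <-].
have -> : S `&` O `&` f @^-1` `]a, b[ =
    S `&` (O `&` f @^-1` `]a, b[) by rewrite setIA.
apply: measurable_SI; rewrite openE => z [Oz fz].
apply: filterI; first exact: open_nbhs_nbhs.
by apply: (fc z (mem_set Oz)); exact: open_nbhs_nbhs.
Qed.

End skeleton_measure.

(** * Weak gradients *)

Section gradients.
Context {R : realType} {X : pointedMetricType R} (iota : X -> R) (V : set X).
Variables (nu : {measure set (skel_type iota V) -> \bar R}) (i0 : R).
Local Notation d := (@mdist R X).
Local Notation S := (skeleton iota).
Local Notation B x := (ball x (iota x)).
Implicit Types (u v w x y z c : X) (f g k : X -> R) (T : set X).
Hypothesis H : length_tree nu i0.
Local Notation M A := (measurable (A : set (skel_type iota V))).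

Lemma oseg_cut T u v z : is_tree T -> open T -> T u -> T v ->
  oseg T u v z -> oseg T u v = oseg T u z `|` [set z] `|` oseg T z v /\
   (oseg T u z `|` [set z]) `&` oseg T z v = set0 /\ oseg T u z `&` [set z] = set0.
Proof.
move=> Tt To Tu Tv /(osegP Tt To z Tu Tv)[Tz zb zu zv].
have uvP := osegP Tt To _ Tu Tv; have uzP := osegP Tt To _ Tu Tz.
have zvP := osegP Tt To _ Tz Tv.
have := zb; rewrite /btw => zbE; have uz0 := d_gt0 (nesym zu).
have zv0 := d_gt0 zv.
split; last split.
- apply/seteqP; split => w.
    move=> /uvP[Tw wb wu wv]; have [->|/eqP wz] := eqVneq w z.
      by left; right.
    have [?|?] := tree_side Tt To Tu Tv Tw Tz wb.
      by left; left; apply/uzP.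
    by right; apply/zvP.
  move=> [[/uzP[Tw wb wu wz]|->]|/zvP[Tw wb wz wv]]; apply/uvP => //.
  + move: wb; rewrite /btw => wb; split=> //.
      by apply/eqP; rewrite eq_le dtri andbT; have := dtri z w v; lra.
    by move=> E; move: wb; rewrite E; have := d_ge0 v z; lra.
  + move: wb; rewrite /btw => wb; split=> //.
      by apply/eqP; rewrite eq_le dtri andbT; have := dtri z u w; lra.
    by move=> E; move: wb; rewrite E; have := d_ge0 u v; have := dC u z; lra.
- apply/seteqP; split => // w [[/uzP[_ + _ wz]|->] /zvP[_ + wz' _]] //.
  rewrite /btw => w1 w4; have := dtri w u v.
  by have := d_gt0 wz; have := dC z w; lra.
- by apply/seteqP; split => // w [/uzP[_ _ _ wz] /= E]; apply: wz.
Qed.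

Lemma oseg_eq0 T u : is_tree T -> open T -> T u -> oseg T u u = set0.
Proof.
move=> Tt To Tu; apply/seteqP; split => // z /(osegP Tt To z Tu Tu)[_ zb zu _].
by rewrite -(seg0 u); split.
Qed.

Lemma oseg_measure T u v : is_tree T -> open T -> T u -> T v ->
  M (oseg T u v) /\ nu (oseg T u v) = (d u v)%:E.
Proof.
move=> Tt To; have I0 := i0_gt0 H.
have base w z : T w -> T z -> d w z < i0 ->
    M (oseg T w z) /\ nu (oseg T w z) = (d w z)%:E.
  move=> Tw Tz wz; rewrite (oseg_seg H)//.
  by split; [exact: (measurable_seg H wz)|exact: (nu_seg H wz)].
have [n] : exists n, d u v < n%:R * (i0 / 2).
  exists (Num.truncn (d u v / (i0 / 2))).+1; rewrite -ltr_pdivrMr; last lra.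
  by rewrite truncnS_gt.
elim: n u v => [|n IHn] u v; first by rewrite mul0r ltNge d_ge0.
rewrite -natr1 mulrDl mul1r => uvn Tu Tv.
have [uv|uv] := ltP (d u v) i0; first exact: base.
have [z [Tz z1 z2]] := @tree_point _ _ _ Tt u v (i0 / 2) Tu Tv ltac:(lra).
have zuv : oseg T u v z.
  apply/osegP => //.
  by have [] : seg u v z by apply: seg_mk; rewrite /btw; lra.
have [-> [D1 D2]] := oseg_cut Tt To Tu Tv zuv.
have [M1 N1] := base u z Tu Tz ltac:(lra).
have [M2 N2] := IHn z v ltac:(lra) Tz Tv.
have Sz := oseg_S H Tt To Tu Tv zuv; have Mz := measurable_pt H Sz.
have Mu : M (oseg T u z `|` [set z]) by exact: measurableU.
split; first exact: measurableU.
have -> : nu (oseg T u z `|` [set z] `|` oseg T z v) =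
    (nu (oseg T u z) + nu [set z] + nu (oseg T z v))%E.
  by rewrite measureU//; congr (_ + _)%E; rewrite measureU.
by rewrite (nu_pt H Sz) N1 N2 adde0 -EFinD; congr (_%:E); lra.
Qed.

Lemma open_B x : open (B x). Proof. exact: open_ballX. Qed.
Hint Resolve open_B : core.
Let tB x : is_tree (B x). Proof. exact: lt_tree H x. Qed.
Hint Resolve tB : core.
Let cB x : B x x. Proof. exact: B_center H x. Qed.
Hint Resolve cB : core.

Lemma Rintegral_oseg_cut T u v z g : is_tree T -> open T -> T u -> T v ->
  nu.-integrable (oseg T u v) (EFin \o g) -> oseg T u v z ->
  \int[nu]_(w in oseg T u v) g w =
  \int[nu]_(w in oseg T u z) g w + \int[nu]_(w in oseg T z v) g w.
Proof.
move=> Tt To Tu Tv + zuv.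
have [Tz _ _ _] : [/\ T z, btw u z v, z <> u & z <> v] by apply/osegP.
have Sz := oseg_S H Tt To Tu Tv zuv; have Mz := measurable_pt H Sz.
have [-> [D1 D2]] := oseg_cut Tt To Tu Tv zuv.
have [M1 _] := oseg_measure Tt To Tu Tz.
have [M2 _] := oseg_measure Tt To Tz Tv.
have Mu : M (oseg T u z `|` [set z]) by exact: measurableU.
move=> gi; rewrite Rintegral_setU//; last exact/disj_set2P.
congr (_ + _); rewrite Rintegral_setU//; last first.
- exact/disj_set2P.
- by apply: (integrableS _ _ _ gi) => //; exact: measurableU.
rewrite -[RHS]addr0; congr (_ + _).
rewrite /Rintegral null_set_integral//; last exact: (nu_pt H Sz).
apply: (measurable_int nu); apply: (integrableS _ _ _ gi) => //.
  exact: measurableU.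
by move=> ? ?; left; right.
Qed.

Lemma gradient_radial f x g b u : is_gradient_at nu f x g ->
  B x b -> B x u -> btw x b u ->
  f u - f b = \int[nu]_(w in oseg (B x) b u) g w.
Proof.
move=> [gm gi gE] Bb Bu xbu.
have [->|/eqP bu] := eqVneq b u.
  by rewrite oseg_eq0// Rintegral_set0 subrr.
have [<-|/eqP xb] := eqVneq x b; first exact: gE.
have bxu : oseg (B x) x u b by apply/osegP => //; split => //; exact: nesym.
have := gE _ Bu; rewrite (Rintegral_oseg_cut _ _ _ _ (gi _ _ (cB x) Bu) bxu)//.
rewrite -(gE _ Bb); lra.
Qed.

(** k is the derivative of f along [u, v], oriented from u to v. *)
Definition seg_density f u v k :=
  nu.-integrable (seg u v) (EFin \o k) /\
  forall a b, btw u a v -> btw u b v -> d u a <= d u b ->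
    f b - f a = \int[nu]_(z in seg a b) k z.

Lemma measurable_sign u r (D : set (skel_type iota V)) : M D -> D `<=` S ->
  measurable_fun D (fun z => if d u z < r then -1 else 1 : R).
Proof.
move=> mD DS; have := @eq_measurable_fun _ _ (skel_type iota V) R D
    (fun z => 1 - 2 * \1_((S `&` ball u r) : set (skel_type iota V)) z).
apply.
  move=> z; rewrite inE => Dz; rewrite indicE.
  have Sz := DS _ Dz.
  case: ifPn => uz.
    rewrite mem_set; last by split => //; apply/in_ball.
    by rewrite mulr1 opprD addrA subrr sub0r.
  by rewrite memNset; [rewrite mulr0 subr0|move=> [_ /in_ball]; apply/negP].
apply: measurable_funB => //; apply: measurable_funM => //.
apply: measurable_funTS; apply: measurable_indic.
by apply: (measurable_SI H); exact: open_ballX.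
Qed.

(** Seen from the base point x, the segment [u, v] is descended up to the
projection w of x and ascended from there on; this explains the sign. *)
Lemma gradient_density f x g u v : is_gradient_at nu f x g ->
  B x u -> B x v -> d u v < i0 ->
  exists2 k, seg_density f u v k & forall z, `|k z| = `|g z|.
Proof.
move=> gg Bu Bv uv; have [gm gi gE] := gg.
have [w [Bw uwv uwx vwx]] := tree_median (tB x) Bu Bv (cB x).
have conv z : btw u z v -> B x z by exact: (small_convex H).
have oE a b : btw u a v -> btw u b v -> d u a <= d u b ->
    oseg (B x) a b = seg a b /\ oseg (B x) b a = seg a b.
  move=> ua ub ab; have [abE _] := seg_sub H uv ua ub ab.
  have abi : d a b < i0.
    by move: ub; rewrite /btw; have := d_ge0 b v; have := d_ge0 u a; lra.
  split; first exact: (oseg_seg H _ _ (conv _ ua) (conv _ ub)).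
  rewrite seg_sym; apply: (oseg_seg H _ _ (conv _ ub) (conv _ ua)) => //.
  by rewrite dC.
pose k z := (if d u z < d u w then -1 else 1) * g z.
have kg z : `|k z| = `|g z|.
  by rewrite normrM; case: ifP => _; rewrite ?normrN normr1 mul1r.
have uS : seg u v `<=` S by move=> z; exact: (seg_S H uv).
have mJ := measurable_seg H uv.
have [JE _] := oE u v (btwl u v) (btwr u v) ltac:(by rewrite dxx d_ge0).
have gJ : nu.-integrable (seg u v) (EFin \o g) by rewrite -JE; exact: gi.
have kJ : nu.-integrable (seg u v) (EFin \o k).
  apply: (le_integrable _ _ _ gJ) => //.
    apply/measurable_EFinP; apply: measurable_funM.
      exact: measurable_sign.
    by apply/measurable_EFinP; exact: (measurable_int nu).
  by move=> z _ /=; rewrite lee_fin kg.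
exists k => //; split => //.
(* beyond the projection the base point sees [a, b] in the right order *)
have up a b : btw u a v -> btw u b v -> d u w <= d u a -> d u a <= d u b ->
    f b - f a = \int[nu]_(z in seg a b) k z.
  move=> ua ub wa ab.
  have [abE sab] := seg_sub H uv ua ub ab.
  have [waE _] := seg_sub H uv uwv ua wa.
  have [wbE _] := seg_sub H uv uwv ub (le_trans wa ab).
  have xab : btw x a b.
    move: ua ub uwv vwx; rewrite /btw => ua ub uwv vwx.
    have := dtri w x a; have := dtri b x v; have := dtri a x b.
    by have := dC v w; have := dC x w; have := dC x v; lra.
  rewrite (gradient_radial gg (conv _ ua) (conv _ ub) xab).
  have [-> _] := oE _ _ ua ub ab; apply: eq_Rintegral => z; rewrite inE => zab.
  have /(seg_subE H z uv ua ub ab)[_ z1 _] := zab.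
  by rewrite /k ifN ?mul1r// -leNgt; lra.
have down a b : btw u a v -> btw u b v -> d u b <= d u w -> d u a <= d u b ->
    f b - f a = \int[nu]_(z in seg a b) k z.
  move=> ua ub wa ab.
  have [abE sab] := seg_sub H uv ua ub ab.
  have [bwE _] := seg_sub H uv ub uwv wa.
  have [awE _] := seg_sub H uv ua uwv (le_trans ab wa).
  have xba : btw x b a.
    move: ua ub uwv uwx; rewrite /btw => ua ub uwv uwx.
    have := dtri w x b; have := dtri a x u; have := dtri b x a.
    have := dC b w; have := dC x w; have := dC x u; have := dC a u.
    by have := dC a b; lra.
  have := gradient_radial gg (conv _ ub) (conv _ ua) xba.
  have [_ ->] := oE _ _ ua ub ab => E.
  have abi : d a b < i0.
    by move: ub; rewrite /btw; have := d_ge0 b v; have := d_ge0 u a; lra.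
  transitivity (- \int[nu]_(z in seg a b) g z); first by rewrite -E opprB.
  rewrite -mulN1r -RintegralZl//; last 2 first.
  - exact: (measurable_seg H abi).
  - by apply: (integrableS _ _ _ gJ) => //; exact: (measurable_seg H abi).
  apply: eq_Rintegral => z; rewrite inE => zab.
  have /(seg_subE H z uv ua ub ab)[_ _ z1] := zab.
  by rewrite /k ifT//; lra.
move=> a b ua ub ab.
have [wa|wa] := leP (d u w) (d u a); first exact: up.
have [bw|bw] := leP (d u b) (d u w); first exact: down.
have [aw sab] := seg_sub H uv ua ub ab.
have wab : seg a b w.
  by apply/(seg_subE H w uv ua ub ab); split => //; apply: seg_mk => //;
    move: ua ub uwv; rewrite /btw; have := d_ge0 u a; have := d_ge0 b v; lra.
have [abE _] := oE _ _ ua ub ab; have [waE _] := oE _ _ ua uwv (ltW wa).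
have [wbE _] := oE _ _ uwv ub (ltW bw).
have abi : d a b < i0.
  by move: ub; rewrite /btw; have := d_ge0 b v; have := d_ge0 u a; lra.
have ki : nu.-integrable (oseg (B x) a b) (EFin \o k).
  by rewrite abE; apply: (integrableS _ _ _ kJ) => //; exact: (measurable_seg H abi).
have wab' : oseg (B x) a b w by rewrite abE.
have := Rintegral_oseg_cut (tB x) (@open_B x) (conv _ ua) (conv _ ub) ki wab'.
rewrite abE waE wbE => ->.
rewrite -(down _ _ ua uwv (lexx _) (ltW wa)).
by rewrite -(up _ _ uwv ub (lexx _) (ltW bw)); lra.
Qed.

(** A Dynkin argument on the sets whose trace on [u, v] is convex: up to null
sets these traces are segments. *)
Lemma seg_density_uniq f u v k k' : d u v < i0 ->
  seg_density f u v k -> seg_density f u v k' ->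
  \forall z \ae nu, seg u v z -> k z = k' z.
Proof.
move=> uv [ki kE] [ki' kE'].
have mJ := measurable_seg H uv.
pose h z := k z - k' z.
have hi : nu.-integrable (seg u v) (EFin \o h).
  exact: (integrableB mJ ki ki').
have JS : seg u v `<=` S by move=> z; exact: (seg_S H uv).
have sub_i (D : set X) : M D -> D `<=` seg u v -> nu.-integrable D (EFin \o h).
  by move=> mD DJ; apply: (integrableS _ _ _ hi).
have seg_h a b : btw u a v -> btw u b v -> d u a <= d u b ->
    (\int[nu]_(z in seg a b) (h z)%:E = 0)%E.
  move=> ua ub ab; have [abE sab] := seg_sub H uv ua ub ab.
  have abi : d a b < i0.
    by move: ub; rewrite /btw; have := d_ge0 b v; have := d_ge0 u a; lra.
  have mab := measurable_seg H abi.
  have ii (q : X -> R) : nu.-integrable (seg u v) (EFin \o q) ->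
      nu.-integrable (seg a b) (EFin \o q).
    by move=> qi; apply: (integrableS _ _ _ qi).
  rewrite -(@fineK _ (\int[nu]_(z in _) _)%E); last first.
    exact: (integrable_fin_num mab (ii _ hi)).
  rewrite -/(Rintegral nu (seg a b) h) RintegralB//; [|exact: ii..].
  by rewrite -(kE _ _ ua ub ab) -(kE' _ _ ua ub ab) subrr.
(* the sets with convex trace contain the segments and are stable under
intersection *)
pose conv (A : set X) := forall z w y, seg u v z -> seg u v w -> seg u v y ->
  A z -> A w -> d u z <= d u y -> d u y <= d u w -> A y.
pose G := [set A : set (skel_type iota V) | M A /\ conv A].
pose P (A : set (skel_type iota V)) :=
  (\int[nu]_(z in (A : set X) `&` seg u v) (h z)%:E = 0)%E.
have PT : P [set: _].
  rewrite /P setTI; apply: seg_h; [exact: btwl|exact: btwr|].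
  by rewrite dxx d_ge0.
have PM : forall A, measurable A -> P A.
  have GE : @measurable _ (skel_type iota V) = <<s G >>.
    apply/seteqP; split; last first.
      apply: smallest_sub; first exact: sigma_algebra_measurable.
      by move=> A [].
    apply: sub_smallest2r; first exact: smallest_sigma_algebra.
    move=> A gA; split; first exact: sub_sigma_algebra.
    case: gA => p [q [Vp Vq pq ->]] z w y [zb _ _] [wb _ _] [yb _ _].
    have Bq : B p q by apply/in_ball.
    have TP t := osegP (tB p) (@open_B p) t (cB p) Bq.
    move=> /TP[Bz zpq zp zq] /TP[Bw wpq wp wq] zy yw.
    have [zyE _] := seg_sub H uv zb yb zy.
    have [ywE _] := seg_sub H uv yb wb yw.
    have [zwE _] := seg_sub H uv zb wb (le_trans zy yw).
    have zyw : btw z y w by rewrite /btw; lra.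
    have zwi : d z w < i0.
      by move: wb; rewrite /btw; have := d_ge0 w v; have := d_ge0 u z; lra.
    have By := small_convex H (tB p) (@open_B p) Bz Bw zwi zyw.
    have [g gg] := tree_geo (tB p) (cB p) Bq.
    have zg := tree_btw_geo (tB p) (@open_B p) (cB p) Bq Bz gg zpq.
    have wg := tree_btw_geo (tB p) (@open_B p) (cB p) Bq Bw gg wpq.
    have gi := geo_isom gg.
    move: zpq wpq zyw; rewrite /btw => zpq wpq zyw.
    have zw_pos : d z w = d p w - d p z \/ d z w = d p z - d p w.
      have [le|/ltW le] := leP (d p z) (d p w); [left|right].
        rewrite {1}zg {1}wg gi //; first exact: d_ge0.
        by have := d_ge0 w q; lra.
      rewrite {1}zg {1}wg dC gi //; first exact: d_ge0.
      by have := d_ge0 z q; lra.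
    have yB : btw p y q /\ 0 < d p y /\ 0 < d y q.
      have := d_gt0 (nesym zp); have := d_gt0 (nesym wp).
      have := d_gt0 zq; have := d_gt0 wq.
      have := dtri z p y; have := dtri w p y; have := dtri z y q.
      have := dtri w y q; have := dtri y p q; have := dtri y p z.
      have := dtri y p w; have := dtri y z q; have := dtri y w q.
      have := dC y z; have := dC y w.
      by case: zw_pos => ? *; (split; [|split]); rewrite ?/btw; lra.
    have [yB1 [yB2 yB3]] := yB.
    by apply/TP; have [] : seg p q y by exact: seg_mk.
  rewrite GE; apply: (@dynkin_induction _ (skel_type iota V) G P) => //.
  - move=> A A' [mA cA] [mA' cA']; split; first exact: measurableI.
    by move=> z w y Jz Jw Jy [? ?] [? ?] zy yw; split;
      [exact: (cA z w)|exact: (cA' z w)].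
  - move=> A [mA cA].
    have mAJ : M ((A : set X) `&` seg u v) by exact: measurableI.
    rewrite /P; have [->|/set0P[z0 [Az0 Jz0]]] := eqVneq ((A : set X) `&` seg u v) set0.
      by rewrite integral_set0.
    pose I := [set d u z | z in (A : set X) `&` seg u v].
    have I0 : I (d u z0) by exists z0.
    have Iub : ubound I (d u v).
      move=> _ [z [_ [zb _ _]] <-].
      by move: zb; rewrite /btw; have := d_ge0 z v; lra.
    have Ilb : lbound I 0 by move=> _ [z _ <-]; exact: d_ge0.
    have sI : has_sup I by split; [exists (d u z0)|exists (d u v)].
    have iI : has_inf I by split; [exists (d u z0)|exists 0].
    have s1 : inf I <= d u z0 by exact: (ge_inf (proj2 iI)).
    have s2 : d u z0 <= sup I by exact: (ub_le_sup (proj2 sI)).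
    have s3 : 0 <= inf I by apply: lb_le_inf => //; exists (d u z0).
    have s4 : sup I <= d u v by apply: ge_sup => //; exists (d u z0).
    have [a [a1 a2]] := @seg_point _ _ _ _ _ _ H u v (inf I) uv ltac:(lra).
    have [b [b1 b2]] := @seg_point _ _ _ _ _ _ H u v (sup I) uv ltac:(lra).
    have ua : btw u a v by rewrite /btw; lra.
    have ub : btw u b v by rewrite /btw; lra.
    have ab : d u a <= d u b by lra.
    have abi : d a b < i0.
      by have [-> _] := seg_sub H uv ua ub ab; lra.
    have mab := measurable_seg H abi.
    have sabA : seg a b `<=` (A : set X) `&` seg u v.
      move=> z /(seg_subE H z uv ua ub ab)[Jz].
      rewrite a1 b1 => z1 z2; split => //.
      have [_ [w [Aw Jw] <-] wz] := inf_lt (proj1 iI) z1.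
      have [_ [y [Ay Jy] <-] zy] := sup_gt (proj1 sI) z2.
      by apply: (cA w y z) => //; exact: ltW.
    set D := (A : set X) `&` seg u v in mAJ sabA *.
    have -> : D = seg a b `|` (D `\` seg a b) by rewrite setDUK.
    have mD' : M (D `\` seg a b) by exact: measurableD.
    have D'null : nu (D `\` seg a b) = 0%E.
      have D'ab : D `\` seg a b `<=` [set a] `|` [set b].
        move=> z [[Az Jz] Nz]; have [zb zu zv] := Jz.
        have z1 : inf I <= d u z by apply: (ge_inf (proj2 iI)); exists z.
        have z2 : d u z <= sup I by apply: (ub_le_sup (proj2 sI)); exists z.
        have [E|ne1] := eqVneq (d u z) (d u a).
          by left; exact: (uniq_pt H uv zb ua E).
        have [E|ne2] := eqVneq (d u z) (d u b).
          by right; exact: (uniq_pt H uv zb ub E).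
        exfalso; apply: Nz; apply/(seg_subE H z uv ua ub ab); split => //.
          by rewrite lt_neqAle eq_sym ne1 a1.
        by rewrite lt_neqAle ne2 b1.
      have pt c : M (D `&` [set c]) /\ nu (D `&` [set c]) = 0%E.
        have [[Ac Jc]|Dc] := pselect (D c).
          have -> : D `&` [set c] = [set c].
            by apply/seteqP; split => [z []//|z ->].
          by split; [exact: (measurable_pt H (JS _ Jc))|exact: (nu_pt H (JS _ Jc))].
        have -> : D `&` [set c] = set0.
          by apply/seteqP; split => // z [+ zc]; rewrite zc.
        by rewrite measure0; split => //; exact: measurable0.
      have [Ma Na] := pt a; have [Mb Nb] := pt b.
      apply: (null_sub2 Ma Mb mD' Na Nb) => z Dz.
      by have [|] := D'ab z Dz; [left|right]; split => //; case: Dz.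
    rewrite integral_setU//; last 2 first.
    + by rewrite setDUK//; apply: (measurable_int nu (sub_i D mAJ _)) => z [].
    + by apply/disj_set2P; rewrite setDIK.
    rewrite (seg_h a b)// add0e null_set_integral//.
    by apply: (measurable_int nu (sub_i _ mD' _)) => z [[]].
  - move=> A mA PA; rewrite /P.
    have := PT; rewrite {1}/P setTI.
    have -> : seg u v = ((A : set X) `&` seg u v) `|` ((~` A : set X) `&` seg u v).
      by rewrite -setIUl setUv setTI.
    have m1 : M ((A : set X) `&` seg u v) by exact: measurableI.
    have m2 : M ((~` A : set X) `&` seg u v).
      by apply: measurableI => //; exact: measurableC.
    rewrite integral_setU//; last 2 first.
    + by rewrite -setIUl setUv setTI; exact: (measurable_int nu hi).
    + by apply/disj_set2P; rewrite setIACA setICr set0I.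
    by rewrite PA add0e -setIUl setUv setTI.
  - move=> F mF tF PF; rewrite /P setI_bigcupl integral_bigcup//.
    + by rewrite eseries0// => n _ _; exact: PF.
    + exact: trivIset_setIr.
    + by move=> n; exact: measurableI.
    + apply: sub_i; first by apply: bigcupT_measurable => n; exact: measurableI.
      by move=> z [n _ []].
have := integral_ae_eq mJ ki (measurable_int nu ki').
move=> ae1.
have : ae_eq nu (seg u v) (EFin \o k) (EFin \o k').
  apply: ae1 => E EJ mE.
  have EE : E = (E : set X) `&` seg u v by rewrite setIidl.
  have ii (q : X -> R) : nu.-integrable (seg u v) (EFin \o q) ->
      nu.-integrable E (EFin \o q).
    by move=> qi; apply: (integrableS _ _ _ qi).
  have := PM _ mE; rewrite /P -EE.
  have -> : (\int[nu]_(z in E) (h z)%:E =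
     \int[nu]_(z in E) (k z)%:E - \int[nu]_(z in E) (k' z)%:E)%E.
    rewrite -(integralB mE (ii _ ki) (ii _ ki')); apply: eq_integral => z _ /=.
    by rewrite EFinB.
  move: (integrable_fin_num mE (ii _ ki)) (integrable_fin_num mE (ii _ ki')).
  move=> /fineK <- /fineK <-; rewrite -EFinB => -[] /subr0_eq kk'.
  by congr (_%:E).
by apply: aeS => z kz Jz; have := kz Jz => -[].
Qed.

(** On a common segment both gradients are densities of f up to sign, and such
densities are unique. *)
Lemma gradient_abs_uniq f x y g g' : is_gradient_at nu f x g ->
  is_gradient_at nu f y g' ->
  \forall z \ae nu, (S `&` (B x `&` B y)) z -> `|g z| = `|g' z|.
Proof.
move=> gx gy; apply: (ae_SI H); first exact: openI.
move=> a b Va Vb ab abO.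
have [Bxa Bya] := abO _ (btwl a b); have [Bxb Byb] := abO _ (btwr a b).
have [k kd kg] := gradient_density gx Bxa Bxb ab.
have [k' kd' kg'] := gradient_density gy Bya Byb ab.
have := seg_density_uniq ab kd kd'.
by apply: aeS => z kz zab; rewrite -kg -kg' kz.
Qed.

(** Gradients at the points of a countable dense set are patched together along
the disjointed balls around these points. *)
Lemma AC_abs_gradient f : Defs.AC nu f -> is_abs_gradient nu f (abs_gradient nu f).
Proof.
move=> [fc fg].
suff [h hh] : exists h, is_abs_gradient nu f h.
  by rewrite /abs_gradient; case: xgetP => // /(_ h).
have [a [Va aV]] := V_enum H.
have /choice[g gP] n := fg (a n).
pose D n := S `&` (B (a n) `\` \bigcup_(m in [set m | (m < n)%N]) B (a m)).
have Dm n : M (D n).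
  rewrite /D setDE setIA -setDE.
  have -> : S `&` B (a n) `\` \bigcup_(m in [set m | (m < n)%N]) B (a m) =
      (S `&` B (a n)) `\` (S `&` \bigcup_(m in [set m | (m < n)%N]) B (a m)).
    by apply/seteqP; split => z [[Sz Bz] N]; split=> // N'; apply: N => //;
      case: N'.
  apply: measurableD; apply: (measurable_SI H) => //.
  by apply: bigcup_open => m _.
have DS : \bigcup_n D n = S.
  apply/seteqP; split => [z [n _ []]//|z Sz].
  have [b Vb zb] := V_near H z (i0_gt0 H).
  have [n nb] := aV _ Vb.
  have exn : exists n, `[< B (a n) z >].
    exists n; apply/asboolP/in_ball; rewrite nb dC.
    by have := lt_iota H b; lra.
  case: (ex_minnP exn) => k /asboolP Bk kmin.
  exists k => //; split => //; split => // -[m /= mk Bm].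
  by have /kmin : `[< B (a m) z >] by [apply/asboolP]; rewrite leqNgt mk.
have Duniq (n k : nat) z : D n z -> D k z -> n = k.
  move=> [_ [Bn Nn]] [_ [Bk Nk]]; apply/eqP; rewrite eqn_leq.
  by apply/andP; split; rewrite leqNgt; apply/negP => lt;
    [apply: Nn; exists k|apply: Nk; exists n].
pose h z := `|g (xget 0 [set n | D n z]) z|.
have hE n z : D n z -> h z = `|g n z|.
  move=> Dz; rewrite /h; case: xgetP => [k _ Dk|/(_ n)//].
  by rewrite (Duniq _ _ _ Dk Dz).
exists h; split.
  rewrite -[X in measurable_fun X]DS; apply/measurable_fun_bigcup => // n.
  apply: (@eq_measurable_fun _ _ _ _ _ (fun z : skel_type iota V => `|g n z|)).
    by move=> z; rewrite inE => /hE.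
  apply: measurableT_comp => //.
  have [gm _ _] := gP n; apply: measurable_funS gm => //.
    exact: (measurable_SI H (@open_B _)).
  by move=> z [Sz [Bz _]].
move=> x g' g'P.
have : \forall z \ae nu, forall n, (S `&` (B x `&` B (a n))) z ->
    `|g' z| = `|g n z|.
  by apply/ae_foralln => n; exact: (gradient_abs_uniq g'P (gP n)).
apply: aeS => z gz [Sz Bz].
have : (\bigcup_n D n) z by rewrite DS.
by move=> [n _ Dz]; rewrite (hE _ _ Dz); apply: gz; case: Dz => _ [].
Qed.

(** The fundamental theorem of calculus bounds oscillations. *)
Lemma AC_osc f x y : Defs.AC nu f -> d x y < i0 ->
  (`|f y - f x|%:E <= \int[nu]_(z in seg x y) `|abs_gradient nu f z|%:E)%E.
Proof.
move=> fAC xy; have [hm hP] := AC_abs_gradient fAC.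
set h := abs_gradient nu f in hm hP *.
have [_ fg] := fAC; have [g gP] := fg x; have hg := hP _ _ gP.
have Bxy : B x y by apply/in_ball; have := lt_iota H x; lra.
have [gm gi gE] := gP.
have mJ := measurable_seg H xy.
have JE : oseg (B x) x y = seg x y by exact: (oseg_segB H).
have gJ : nu.-integrable (seg x y) (EFin \o g) by rewrite -JE; exact: gi.
have JB : seg x y `<=` S `&` B x.
  move=> z zxy; split; first exact: (seg_S H xy).
  by apply: (small_convex H (tB x)) (xy) _ => //; case: zxy.
rewrite gE// JE EFin_normr_Rintegral//.
apply: (le_trans (le_abse_integral _ mJ (measurable_int nu gJ))).
rewrite le_eqVlt; apply/orP; left; apply/eqP.
apply: ge0_ae_eq_integral => //.
- apply: measurableT_comp => //; exact: (measurable_int nu gJ).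
- apply/measurable_EFinP; apply: measurableT_comp => //.
  apply: measurable_funS hm => //; first exact: measurable_S H.
  by move=> z /JB[].
- by apply: aeS hg => z hz zJ /=; rewrite -(hz (JB _ zJ)) normr_id.
Qed.

End gradients.

(** * Integral inequalities *)

Section integral_inequalities.
Import HBNNSimple.
Context {dd} {T : measurableType dd} {R : realType}.
Variable mu : {measure set T -> \bar R}.
Implicit Types (D A J : set T) (p a : R).

(** The integral of a nonnegative function is a supremum over simple functions,
hence monotone even where the functions are not measurable. *)
Lemma le_integral_nonmeas D (f g : T -> \bar R) :
  (forall x, D x -> 0 <= f x)%E -> (forall x, D x -> f x <= g x)%E ->
  (\int[mu]_(x in D) f x <= \int[mu]_(x in D) g x)%E.
Proof.
move=> f0 fg; rewrite !ge0_integralE//; last first.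
  by move=> x Dx; apply: le_trans (fg _ Dx); exact: f0.
apply: le_ereal_sup => _ [h hf <-]; exists h => // x.
apply: (le_trans (hf x)); rewrite /patch; case: ifP => //.
by rewrite inE => /fg.
Qed.

(** Multiplication by k and by its inverse preserve the simple functions below
the integrand. *)
Lemma integral_scale_nonmeas (f : T -> \bar R) (k : R) : 0 < k ->
  (forall x, 0 <= f x)%E ->
  (\int[mu]_x (k%:E * f x) = k%:E * \int[mu]_x f x)%E.
Proof.
suff key (f' : T -> \bar R) (k' : R) : 0 < k' -> (forall x, 0 <= f' x)%E ->
    (k'%:E * \int[mu]_x f' x <= \int[mu]_x (k'%:E * f' x))%E.
  move=> k0 f0; apply/eqP; rewrite eq_le; apply/andP; split; last exact: key.
  have k'0 : 0 < k^-1 by rewrite invr_gt0.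
  have := key (fun x => k%:E * f x)%E _ k'0 (fun x => mule_ge0 _ (f0 x)).
  rewrite lee_fin (ltW k0) => /(_ isT).
  under [in X in (_ <= X)%E]eq_integral do
    rewrite muleA -EFinM mulVf ?gt_eqF// mul1e.
  move=> h; have := lee_wpmul2l (ltW k0 : (0 <= k%:E)%E) h.
  by rewrite muleA -EFinM divff ?gt_eqF// mul1e.
move=> k0 f0.
rewrite -lee_pdivlMl// ge0_integralTE//.
apply: ge_ereal_sup => _ [h hf <-]; rewrite lee_pdivlMl// -sintegralrM.
rewrite -[X in sintegral _ X]/(scale_nnsfun h (ltW k0) : T -> R)%R.
rewrite -integralT_nnsfun; apply: le_integral_nonmeas => x _ /=.
  by rewrite lee_fin mulr_ge0 ?fun_ge0// ltW.
by rewrite EFinM lee_pmul2l// lte_fin.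
Qed.

(** Young's inequality: the graph of the p-th power lies above its tangents. *)
Lemma powR_tangent p a (t : R) : 1 <= p -> 0 < a -> 0 <= t ->
  p * a `^ (p - 1) * t <= t `^ p + (p - 1) * a `^ p.
Proof.
move=> p1 a0 t0; have [->|/eqP pn1] := eqVneq p 1.
  by rewrite subrr powRr0 powRr1// !mul1r mul0r addr0.
have p1' : 1 < p by rewrite lt_neqAle p1 andbT eq_sym; exact/eqP.
have q0 : 0 < p / (p - 1) by apply: divr_gt0; lra.
have := @conjugate_powR _ t (a `^ (p - 1)) p (p / (p - 1)) t0 (powR_ge0 _ _)
  ltac:(lra) q0 ltac:(field; lra).
rewrite -powRrM (_ : (p - 1) * (p / (p - 1)) = p); last by field; lra.
move=> h; have p0 : 0 < p by lra.
have := ler_wpM2l (ltW p0) h; rewrite mulrDr.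
rewrite (_ : p * (t `^ p / p) = t `^ p); last by field; lra.
rewrite (_ : p * (a `^ p / (p / (p - 1))) = (p - 1) * a `^ p); last by field; lra.
by rewrite [t * _]mulrC mulrA.
Qed.

Lemma powR_add_le p a (b : R) : 0 <= p -> 0 <= a -> 0 <= b ->
  (a + b) `^ p <= 2 `^ p * (a `^ p + b `^ p).
Proof.
move=> p0; wlog ab : a b / a <= b.
  move=> W a0 b0; have [/W->//|/ltW ba] := leP a b.
  by rewrite addrC [a `^ p + _]addrC; exact: W.
move=> a0 b0; apply: (@le_trans _ _ ((2 * b) `^ p)).
  by apply: ge0_ler_powR; rewrite ?nnegrE//; lra.
rewrite powRM//; apply: ler_wpM2l; first exact: powR_ge0.
by rewrite lerDr powR_ge0.
Qed.

Lemma le_poweR (x y : \bar R) (r : R) : 0 <= r -> (0 <= x)%E -> (x <= y)%E ->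
  (x `^ r <= y `^ r)%E.
Proof.
move=> r0 x0 xy; apply: gt0_ler_poweR => //; rewrite in_itv/= leey andbT//.
exact: le_trans xy.
Qed.

(** Jensen's inequality, by integrating the tangent inequality at the mean. *)
Lemma jensen J (h : T -> R) p M : 1 <= p -> measurable J -> 0 < M ->
  mu J = M%:E -> measurable_fun J h -> (forall x, J x -> 0 <= h x) ->
  ((\int[mu]_(x in J) (h x)%:E) `^ p <=
   (M `^ (p - 1))%:E * \int[mu]_(x in J) (h x `^ p)%:E)%E.
Proof.
move=> p1 mJ M0 JM mh h0.
have mhp : measurable_fun J (fun x => (h x `^ p)%:E).
  by apply/measurable_EFinP; exact: (measurableT_comp (measurable_powR p) mh).
have hp0 x : J x -> (0 <= (h x `^ p)%:E)%E by rewrite lee_fin powR_ge0.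
have Q0 : (0 <= \int[mu]_(x in J) (h x `^ p)%:E)%E by exact: integral_ge0.
have A0 : (0 <= \int[mu]_(x in J) (h x)%:E)%E.
  by apply: integral_ge0 => x Jx; rewrite lee_fin h0.
have tan a : 0 < a ->
    ((p * a `^ (p - 1))%:E * \int[mu]_(x in J) (h x)%:E <=
     \int[mu]_(x in J) (h x `^ p)%:E + ((p - 1) * a `^ p * M)%:E)%E.
  move=> a0.
  have c0 : 0 <= p * a `^ (p - 1) by rewrite mulr_ge0 ?powR_ge0//; lra.
  have c1 x : J x -> (0 <= ((p - 1) * a `^ p)%:E)%E.
    by rewrite lee_fin mulr_ge0 ?powR_ge0//; lra.
  have h0E x : J x -> (0 <= (h x)%:E)%E by rewrite lee_fin; exact: h0.
  have mhE : measurable_fun J (EFin \o h) by exact/measurable_EFinP.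
  have -> : (((p - 1) * a `^ p * M)%:E =
      \int[mu]_(x in J) ((p - 1) * a `^ p)%:E)%E.
    by rewrite integral_cst// JM EFinM.
  rewrite -ge0_integralZl_EFin// -ge0_integralD//.
  apply: le_integral_nonmeas => x Jx.
    by rewrite lee_fin !mulr_ge0 ?powR_ge0 ?h0//; lra.
  by rewrite -EFinM -?EFinD lee_fin powR_tangent// h0.
have M1 : 0 < M `^ (p - 1) by exact: powR_gt0.
move: Q0 tan; case: (\int[mu]_(x in J) (h x `^ p)%:E)%E => [Q|_ _|//].
  2: by rewrite gt0_muley ?lte_fin// leey.
rewrite lee_fin => Q0 tan.
move: A0 tan; case: (\int[mu]_(x in J) (h x)%:E)%E => [A|_ tan|//].
  2: by have := tan 1 ltr01; rewrite powR1 mulr1 gt0_muley ?lte_fin//; lra.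
rewrite lee_fin => A0 tan; rewrite poweR_EFin -EFinM lee_fin.
have [->|/eqP An0] := eqVneq A 0.
  by rewrite powR0 ?mulr_ge0 ?powR_ge0//; lra.
have A1 : 0 < A by rewrite lt_neqAle A0 eq_sym andbT; exact/eqP.
have := tan (A / M) ltac:(exact: divr_gt0).
rewrite -EFinM -EFinD lee_fin.
have MM : M `^ (p - 1) * M = M `^ p by rewrite mulrC mulr_powRB1//; lra.
have AM : (A / M) `^ (p - 1) * (A / M) = (A / M) `^ p.
  by rewrite mulrC mulr_powRB1//; [apply: divr_ge0; lra|lra].
have AE : A `^ p = (A / M) `^ p * M `^ p.
  by rewrite -powRM ?divfK ?gt_eqF//; [apply: divr_ge0; lra|lra].
have AE' : (A / M) `^ (p - 1) * A = (A / M) `^ p * M.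
  by rewrite -AM -[in RHS]mulrA divfK ?gt_eqF.
rewrite -[p * _ * A]mulrA AE' AE -MM => h1.
set q := (A / M) `^ p in h1 *; set w := M `^ (p - 1) in M1 *.
have : q * M <= Q by lra.
by move=> h2; rewrite mulrCA ler_wpM2l// ltW.
Qed.

(** Jensen's inequality for the distance of f to a. *)
Lemma mean_osc B (f : T -> R) p M a : 1 <= p -> measurable B -> 0 < M ->
  mu B = M%:E -> mu.-integrable B (EFin \o f) ->
  ((`|a - M^-1 * \int[mu]_(x in B) f x| `^ p)%:E <=
   M^-1%:E * \int[mu]_(x in B) (`|f x - a| `^ p)%:E)%E.
Proof.
move=> p1 mB M0 BM fi.
have mf : measurable_fun B f by apply/measurable_EFinP; exact: measurable_int fi.
have ai : mu.-integrable B (EFin \o cst a).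
  apply/integrableP; split; first by apply/measurable_EFinP; exact: measurable_cst.
  by rewrite /= integral_cst// BM -EFinM ltry.
have fai : mu.-integrable B (EFin \o (fun x => f x - a)).
  by apply: eq_integrable (integrableB mB fi ai).
have E : a - M^-1 * \int[mu]_(x in B) f x =
    - (M^-1 * \int[mu]_(x in B) (f x - a)).
  rewrite RintegralB// Rintegral_cst// BM /= mulrBr [a * M]mulrC mulrA.
  by rewrite mulVf ?gt_eqF// mul1r opprB.
have absle : `|\int[mu]_(x in B) (f x - a)| <= \int[mu]_(x in B) `|f x - a|.
  exact: le_normr_Rintegral.
have absi : mu.-integrable B (EFin \o (fun x => `|f x - a|)).
  exact: integrable_norm.
have J := @jensen B (fun x => `|f x - a|) p M p1 mB M0 BM.
have {}J := J ltac:(by apply: measurableT_comp => //; apply: measurable_funB)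
  ltac:(by move=> x _; exact: normr_ge0).
have fineE : (\int[mu]_(x in B) (`|f x - a|)%:E)%E =
    (\int[mu]_(x in B) `|f x - a|)%:E.
  by rewrite /Rintegral fineK//; exact: integrable_fin_num.
move: J; rewrite fineE poweR_EFin => J.
have I0 : 0 <= \int[mu]_(x in B) `|f x - a| by exact: Rintegral_ge0.
have Mi : 0 <= M^-1 by rewrite invr_ge0 ltW.
rewrite E normrN normrM gtr0_norm ?invr_gt0//.
apply: (@le_trans _ _ ((M^-1 * \int[mu]_(x in B) `|f x - a|) `^ p)%:E).
  rewrite lee_fin; apply: ge0_ler_powR; rewrite ?nnegrE; first lra.
  - exact: mulr_ge0.
  - exact: mulr_ge0.
  - exact: ler_wpM2l.
rewrite powRM// EFinM.
have -> : (M^-1%:E = (M^-1 `^ p)%:E * (M `^ (p - 1))%:E)%E.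
  rewrite -EFinM; congr (_%:E).
  rewrite -(powR_inv1 (ltW M0)) -powRrM mulN1r -powRD ?(gt_eqF M0) ?implybT//.
  by congr (_ `^ _); lra.
rewrite -muleA; apply: lee_wpmul2l => //.
by rewrite lee_fin powR_ge0.
Qed.

(** The indicators of the sets A i add up to at most N. *)
Lemma overlap_sum (A : nat -> set T) D (phi : T -> \bar R) (N : R) :
  0 <= N -> measurable D -> (forall i, measurable (A i)) ->
  (forall i, A i `<=` D) -> measurable_fun D phi ->
  (forall x, D x -> 0 <= phi x)%E ->
  (forall x n, (count (fun i => `[< A i x >]) (iota 0 n))%:R <= N) ->
  (\sum_(i <oo) \int[mu]_(x in A i) phi x <= N%:E * \int[mu]_(x in D) phi x)%E.
Proof.
move=> N0 mD mA AD mphi phi0 cnt.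
have phi0' i x : A i x -> (0 <= phi x)%E by move=> /AD; exact: phi0.
have t0 i : (0 <= \int[mu]_(x in A i) phi x)%E.
  by apply: integral_ge0 => x; exact: phi0'.
apply: lime_le; first by apply: is_cvg_nneseries => i _ _.
apply: nearW => n.
have pE i : (\int[mu]_(x in A i) phi x = \int[mu]_(x in D) (phi \_ (A i)) x)%E.
  by rewrite -integral_mkcondr; congr integral; apply/seteqP; split=> x;
    [move=> Ax; split => //; exact: AD Ax|case].
have mp i : measurable_fun D (phi \_ (A i)).
  apply/(measurable_restrict _ (mA i) mD).
  by apply: measurable_funS mphi => // x [].
rewrite (eq_bigr (fun i => \int[mu]_(x in D) (phi \_ (A i)) x)%E) => [|i _]; last exact: pE.
have p0 i x : D x -> (0 <= (phi \_ (A i)) x)%E.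
  by move=> Dx; rewrite /patch; case: ifP => // _; exact: phi0.
rewrite -ge0_integral_sum//.
rewrite -ge0_integralZl_EFin//.
apply: le_integral_nonmeas => x Dx.
  by apply: sume_ge0 => i _; exact: p0.
have -> : (\sum_(0 <= i < n) (phi \_ (A i)) x =
    (count (fun i => `[< A i x >]) (iota 0 n))%:R%:E * phi x)%E.
  rewrite -[RHS]/((_)%:R%:E * phi x)%E /index_iota subn0.
  elim: (iota 0 n) => [|j s IH]; first by rewrite big_nil/= mul0e.
  rewrite big_cons IH/= natrD EFinD ge0_muleDl ?lee_fin//; congr (_ + _)%E.
  rewrite /patch; case: ifPn; rewrite ?inE => Aj.
    by rewrite asboolT// mul1e.
  by rewrite asboolF ?mul0e// => /mem_set; apply/negP.
by apply: lee_wpmul2r; [exact: phi0|rewrite lee_fin].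
Qed.

Lemma nneseries_ge_term (u : nat -> \bar R) i :
  (forall k, 0 <= u k)%E -> (u i <= \sum_(k <oo) u k)%E.
Proof.
move=> u0; apply: le_trans (nneseries_lim_ge i.+1 (P := xpredT) _) => //.
by rewrite big_nat_recr//= leeDr// sume_ge0.
Qed.

(** The integrand of the Korevaar-Schoen energy is compared with functions that
are only given locally; F stands for it in this lemma and in the next one, and
its integral is a supremum over the simple functions below it. *)
Lemma integral_le_patches (b : nat -> set T) (F : T -> \bar R)
    (g : nat -> T -> \bar R) :
  (forall x, 0 <= F x)%E -> (forall i, measurable (b i)) ->
  (forall i, measurable_fun (b i) (g i)) ->
  (forall i x, b i x -> 0 <= g i x)%E ->
  (forall x, exists2 i, b i x & (F x <= g i x)%E) ->
  (\int[mu]_x F x <= \sum_(i <oo) \int[mu]_(x in b i) g i x)%E.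
Proof.
move=> F0 mb mg g0 Fg.
have gb0 i x : (0 <= (g i \_ (b i)) x)%E.
  by rewrite /patch; case: ifP => //; rewrite inE => /g0.
under eq_eseriesr do rewrite integral_mkcond.
rewrite -integral_nneseries//; last first.
  by move=> i; apply/(measurable_restrictT _ (mb i)).
apply: le_integral_nonmeas => // x _.
have [i bx Fx] := Fg x; apply: (le_trans Fx).
have -> : g i x = (g i \_ (b i)) x by rewrite /patch mem_set.
exact: (@nneseries_ge_term (fun i => (g i \_ (b i)) x)).
Qed.

Lemma patches_le_integral (b : nat -> set T) (F : T -> \bar R) (q : nat -> R) :
  (forall i, measurable (b i)) -> trivIset setT b -> (forall i, 0 <= q i) ->
  (forall x, 0 <= F x)%E -> (forall i x, b i x -> (q i)%:E <= F x)%E ->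
  (\sum_(i <oo) (q i)%:E * mu (b i) <= \int[mu]_x F x)%E.
Proof.
move=> mb tb q0 F0 qF.
pose g i : T -> \bar R := cst (q i)%:E \_ (b i).
have g0 i x : (0 <= g i x)%E.
  by rewrite /g /patch; case: ifP => //; rewrite lee_fin.
have -> : (\sum_(i <oo) (q i)%:E * mu (b i) = \sum_(i <oo) \int[mu]_x g i x)%E.
  by apply: eq_eseriesr => i _; rewrite -integral_cst// integral_mkcond.
rewrite -integral_nneseries//; last first.
  by move=> i; apply/(measurable_restrictT _ (mb i)); exact: measurable_cst.
apply: le_integral_nonmeas => x _.
  by apply: nneseries_ge0 => i _ _; exact: g0.
apply: lime_le; first by apply: is_cvg_nneseries => i _ _; exact: g0.
apply: nearW => n.
have [[i bi]|no] := pselect (exists i, b i x); last first.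
  rewrite big1//; move=> i _; rewrite /g /patch ifF//; apply/negP.
  by rewrite inE => bi; apply: no; exists i.
have gE k : g k x = if k == i then (q i)%:E else 0%E.
  have [->|ki] := eqVneq k i; first by rewrite /g /patch mem_set.
  rewrite /g /patch ifF//; apply/negP; rewrite inE => bk.
  move/trivIsetP : tb => /(_ k i I I ki) /seteqP[/(_ x)] + _.
  by move=> /(_ (conj bk bi)).
apply: le_trans (qF _ _ bi).
rewrite (eq_bigr _ (fun k _ => gE k)) -big_mkcond big_mkord.
have [ni|ni] := ltnP i n.
  by rewrite (big_pred1 (Ordinal ni)).
rewrite big_pred0 ?lee_fin// => k; apply/negbTE; rewrite neq_ltn.
by rewrite (leq_trans (ltn_ord k) ni).
Qed.

End integral_inequalities.

(** * Separated nets *)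

Section nets.
Context {R : realType} {X : pointedMetricType R}.
Local Notation d := (@mdist R X).
Variable a : nat -> X.

(** Indices of the points selected greedily among the first n ones so that they
are delta-separated. *)
Fixpoint net_list (delta : R) n : seq nat :=
  if n is n'.+1 then
    let s := net_list delta n' in
    if all (fun k => delta <= d (a k) (a n')) s then n' :: s else s
  else [::].

Definition net (delta : R) n := n \in net_list delta n.+1.

Lemma net_listP delta n k :
  (k \in net_list delta n) = (k < n)%N && net delta k.
Proof.
have lt j i : i \in net_list delta j -> (i < j)%N.
  elim: j => //= j IH; case: ifP => _; rewrite ?inE; last by move=> /IH/leqW.
  by move=> /orP[/eqP ->//|/IH/leqW].
elim: n => [|n IH] //=; rewrite ltnS leq_eqVlt.
have [->|kn] := eqVneq k n; first by rewrite orTb.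
rewrite orFb -IH; case: ifP => _ //.
by rewrite inE (negbTE kn).
Qed.

Lemma net_sep delta i j : net delta i -> net delta j -> i != j ->
  delta <= d (a i) (a j).
Proof.
wlog ij : i j / (i < j)%N.
  move=> W Ki Kj ne; case: (ltngtP i j) => [lt|lt|E].
  - exact: W.
  - by rewrite dC; apply: W; rewrite // eq_sym.
  - by rewrite E eqxx in ne.
move=> Ki; rewrite /net /=; case: ifP => [/allP al _ _|_].
  by apply: al; rewrite net_listP ij.
by rewrite net_listP ltnn.
Qed.

Hypothesis a_dense : forall x e, 0 < e -> exists n, d (a n) x < e.

Lemma net_cover delta x : 0 < delta ->
  exists2 i, net delta i & d (a i) x < 2 * delta.
Proof.
move=> d0; have [n nx] := a_dense x d0.
have [Kn|] := boolP (net delta n); first by exists n => //; lra.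
rewrite /net /=; case: ifP => [_|/negbT]; first by rewrite mem_head.
move=> /allPn[k]; rewrite net_listP => /andP[_ Kk]; rewrite -ltNge => kn _.
by exists k => //; have := dtri (a n) (a k) x; lra.
Qed.

Variable m : {measure set (borel X) -> \bar R}.
Variables (dh r0 c C : R).
Hypotheses (c_gt0 : 0 < c) (C_gt0 : 0 < C).
Hypothesis volume : forall (x : X) (r : R), 0 < r < r0 ->
  ((c * r `^ dh)%:E <= m (ball x r) <= (C * r `^ dh)%:E)%E.

Lemma measurable_ball x (r : R) : measurable (ball x r : set (borel X)).
Proof.
apply: sub_sigma_algebra; rewrite openE => y /= /in_ball xy; apply/nbhs_ballP.
exists (r - d x y) => /=; first by rewrite subr_gt0.
by move=> z /in_ball yz; apply/in_ball; have := dtri y x z; lra.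
Qed.

(** A ratio of volumes, which bounds how many disjoint balls of radius delta / 2
fit into a ball of radius k * delta + delta / 2. *)
Definition overlap (k : R) : R := C / c * (2 * k + 1) `^ dh.

Lemma overlap_ge0 k : 0 <= overlap k.
Proof. by rewrite /overlap mulr_ge0 ?powR_ge0// divr_ge0// ltW. Qed.

(** The balls of radius delta / 2 around the net points are disjoint. *)
Lemma net_count delta (k : R) z n : 0 < delta -> 0 < k ->
  k * delta + delta / 2 < r0 ->
  (count (fun i => net delta i && (d (a i) z < k * delta)) (iota 0 n))%:R
    <= overlap k.
Proof.
move=> d0 k0 kr; set P := fun i => _.
have kd0 : 0 < k * delta by exact: mulr_gt0.
pose A i : set (borel X) := if P i then ball (a i) (delta / 2) else set0.
have mA i : measurable (A i).
  by rewrite /A; case: ifP => _; [exact: measurable_ball|exact: measurable0].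
have tA : trivIset setT A.
  apply/trivIsetP => i j _ _ ij; apply/seteqP; split => // x; rewrite /A.
  case: ifP => [/andP[Ki _]|_ []//]; case: ifP => [/andP[Kj _]|_ []//].
  move=> [/in_ball xi /in_ball xj]; have := net_sep Ki Kj ij.
  by have := dtri x (a i) (a j); rewrite (dC x (a j)) leNgt => ? /negP; apply; lra.
have AU : \bigcup_i A i `<=` ball z (k * delta + delta / 2).
  move=> x [i _]; rewrite /A; case: ifP => // /andP[_ iz] /in_ball xi.
  by apply/in_ball; have := dtri (a i) z x; have := dC z (a i); lra.
have vol_le : (m (\bigcup_i A i) <= (C * (k * delta + delta / 2) `^ dh)%:E)%E.
  have /andP[_ v2] := @volume z (k * delta + delta / 2) ltac:(lra).
  apply: le_trans v2; apply: le_measure => //; rewrite inE.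
    exact: bigcupT_measurable.
  exact: measurable_ball.
have part : ((count P (iota 0 n))%:R%:E * (c * (delta / 2) `^ dh)%:E <=
    \sum_(0 <= i < n) m (A i))%E.
  rewrite /index_iota subn0; elim: (iota 0 n) => [|i s IH].
    by rewrite big_nil /= mul0e.
  rewrite big_cons /= natrD EFinD ge0_muleDl ?lee_fin//; apply: leeD => //.
  rewrite /A; case: ifP => Pi; last by rewrite mul0e measure0.
  rewrite mul1e; have /andP[v1 _] := @volume (a i) (delta / 2) ltac:(lra).
  exact: v1.
have : ((count P (iota 0 n))%:R%:E * (c * (delta / 2) `^ dh)%:E <=
    (C * (k * delta + delta / 2) `^ dh)%:E)%E.
  apply: (le_trans part); apply: le_trans vol_le.
  rewrite big_mkord -measure_bigsetU//; apply: le_measure; rewrite ?inE.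
  - exact: bigsetU_measurable.
  - exact: bigcupT_measurable.
  - by rewrite -bigcup_mkord; exact: bigcup_subset.
rewrite -EFinM lee_fin.
have -> : (k * delta + delta / 2) `^ dh = (delta / 2) `^ dh * (2 * k + 1) `^ dh.
  by rewrite -powRM; [congr (_ `^ _)| |]; lra.
have D0 : 0 < (delta / 2) `^ dh by apply: powR_gt0; lra.
rewrite /overlap; set q := (2 * k + 1) `^ dh; set w := _ `^ dh in D0 * => h.
rewrite -(ler_pM2r (mulr_gt0 c_gt0 D0)).
have -> // : C / c * q * (c * w) = C * (w * q) by field; rewrite gt_eqF.
Qed.

Lemma net_finite delta (k : R) z : 0 < delta -> 0 < k ->
  k * delta + delta / 2 < r0 ->
  exists n, forall i, net delta i -> d (a i) z < k * delta -> (i < n)%N.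
Proof.
move=> d0 k0 kr; apply: contrapT => no.
pose P i := net delta i && (d (a i) z < k * delta).
have many j : exists n, (j <= count P (iota 0 n))%N.
  elim: j => [|j [n IH]]; first by exists 0%N.
  have [i [Pi ni]] : exists i, P i /\ (n <= i)%N.
    apply: contrapT => H; apply: no; exists n => i Ki iz.
    by rewrite ltnNge; apply/negP => ni; apply: H; exists i; rewrite /P Ki iz.
  exists i.+1; have -> : iota 0 i.+1 = iota 0 n ++ iota n (i.+1 - n).
    by rewrite -iotaD subnKC// ltnW// ltnS.
  rewrite count_cat -addn1; apply: leq_add => //.
  by rewrite -has_count; apply/hasP; exists i => //; rewrite mem_iota ni subnKC//= leqW.
have [n] := many (Num.truncn (overlap k)).+1.
have := net_count z n d0 k0 kr; rewrite -/P => h1 h2.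
have : (Num.truncn (overlap k)).+1%:R <= overlap k.
  by apply: le_trans h1; rewrite ler_nat.
by rewrite leNgt truncnS_gt.
Qed.

End nets.

(** * Energy of a sum *)

Section energy_upper_bound.
Context {R : realType} {X : pointedMetricType R} (iota : X -> R) (V : set X).
Variables (nu : {measure set (skel_type iota V) -> \bar R}) (i0 : R).
Variable m : {measure set (borel X) -> \bar R}.
Variables (dh p r0 c C : R).
Local Notation d := (@mdist R X).
Local Notation S := (skeleton iota).
Local Notation B x := (ball x (iota x)).
Local Notation M A := (measurable (A : set (skel_type iota V))).
Hypothesis H : length_tree nu i0.
Hypotheses (c_gt0 : 0 < c) (C_gt0 : 0 < C).
Hypothesis volume : forall (x : X) (r : R), 0 < r < r0 ->
  ((c * r `^ dh)%:E <= m (ball x r) <= (C * r `^ dh)%:E)%E.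
Hypothesis p_ge1 : 1 <= p.
Let p_gt0 : 0 < p. Proof. by move: p_ge1; lra. Qed.
Let p_ge0 : 0 <= p. Proof. exact: ltW. Qed.
Let p1_ge0 : 0 <= p - 1. Proof. by move: p_ge1; lra. Qed.
Let p_neq0 : p != 0. Proof. by rewrite gt_eqF. Qed.

(** The bound of the oscillation by the integral of |df| along the segment,
and Jensen's inequality on the segment. *)
Lemma AC_osc_powR f (x y : X) r (D : set X) : Defs.AC nu f -> d x y < i0 -> d x y <= r ->
  M D -> D `<=` S -> seg x y `<=` D ->
  ((`|f y - f x| `^ p)%:E <=
   (r `^ (p - 1))%:E * \int[nu]_(z in D) (`|abs_gradient nu f z| `^ p)%:E)%E.
Proof.
move=> fAC xyi xyr mD DS xyD; have [hm _] := AC_abs_gradient H fAC.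
set h := abs_gradient nu f in hm *.
have hmD : measurable_fun (D : set (skel_type iota V)) (fun z => (`|h z| `^ p)%:E).
  apply/measurable_EFinP; apply: (measurableT_comp (measurable_powR p)).
  apply: measurableT_comp => //.
  by apply: measurable_funS hm => //; exact: measurable_S H.
have I0 : (0 <= \int[nu]_(z in D) (`|h z| `^ p)%:E)%E.
  by apply: integral_ge0 => z _; rewrite lee_fin powR_ge0.
have [<-|/eqP xy] := eqVneq x y.
  rewrite subrr normr0 powR0//.
  by apply: mule_ge0 => //; rewrite lee_fin powR_ge0.
have xy0 := d_gt0 xy.
have mJ := measurable_seg H xyi.
have osc := AC_osc H fAC xyi.
have J := @jensen _ _ R nu (seg x y) (fun z => `|h z|) p (d x y) p_ge1 mJ xy0
  (nu_seg H xyi).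
have {}J := J ltac:(by apply: measurableT_comp => //;
  apply: measurable_funS hm => //; [exact: measurable_S H|
    apply: subset_trans DS]) ltac:(by move=> z _; exact: normr_ge0).
apply: (@le_trans _ _ ((\int[nu]_(z in seg x y) (`|h z|)%:E) `^ p)%E).
  by rewrite -poweR_EFin; apply: (le_poweR p_ge0); rewrite ?lee_fin.
apply: (le_trans J); apply: lee_pmul.
- by rewrite lee_fin powR_ge0.
- by apply: integral_ge0 => z _; rewrite lee_fin powR_ge0.
- by rewrite lee_fin; apply: (ge0_ler_powR p1_ge0); rewrite ?nnegrE// ltW//;
    exact: lt_le_trans xyr.
- by apply: ge0_subset_integral => // z _; rewrite lee_fin powR_ge0.
Qed.

Lemma ball_convex z (x y : X) r : 2 * r < i0 -> d z x < r -> d z y < r ->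
  seg x y `<=` ball z r.
Proof.
move=> ri zx zy w [wb _ _]; apply/in_ball.
have xy : d x y < i0 by have := dtri z x y; have := dC x z; lra.
have xz : d x z < i0 by have := dC x z; have := d_ge0 z x; lra.
have [] := side H xy xz wb; rewrite /btw => E.
  by have := d_ge0 x w; have := dC w z; have := dC x z; lra.
by have := d_ge0 w y; lra.
Qed.

Lemma three_powR : exists2 c2 : R, 0 < c2 & forall s t w : R,
  `|s + t + w| `^ p <= c2 * (`|s| `^ p + `|t| `^ p + `|w| `^ p).
Proof.
exists (2 `^ p * 2 `^ p); first by rewrite mulr_gt0 ?powR_gt0.
move=> s t w.
have q1 : 1 <= 2 `^ p :> R.
  have one2 : 1 <= 2 :> R by lra.
  by have := ler_powR one2 p_ge0; rewrite powRr0.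
apply: (@le_trans _ _ ((`|s| + `|t| + `|w|) `^ p)).
  apply: ge0_ler_powR; rewrite ?nnegrE ?addr_ge0//.
  by apply: (le_trans (ler_normD _ _)); rewrite lerD2r ler_normD.
have st0 : 0 <= `|s| + `|t| by rewrite addr_ge0.
apply: (le_trans (powR_add_le p_ge0 st0 (normr_ge0 w))).
have := powR_add_le p_ge0 (normr_ge0 s) (normr_ge0 t).
have := powR_ge0 `|w| p.
have := powR_ge0 `|s| p; have := powR_ge0 `|t| p.
have := powR_ge0 (`|s| + `|t|) p.
set q := 2 `^ p in q1 *; set a := `|s| `^ p; set b := `|t| `^ p.
set e := `|w| `^ p; set k := (_ + _) `^ p.
move=> *; rewrite -mulrA; apply: ler_wpM2l; first lra.
by rewrite mulrDr; apply: lerD => //; nra.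
Qed.

(** On the ball of radius r around a net point, f0 contributes its norm and the
oscillation of f1 is at most r^(p-1) times the integral of |df1|^p over the
ball of twice the radius; summation over the net costs the overlap number of
the larger balls, and the volume of the ball contributes r^dh. *)
Lemma KS_energy_le : exists2 C0 : R, 0 < C0 &
  forall (f f0 f1 : X -> R) (r : R), measurable_fun setT (f0 : borel X -> R) ->
  measurable_fun setT (f1 : borel X -> R) -> Defs.AC nu f1 ->
  (forall x, f x = f0 x + f1 x) -> 0 < r -> 8 * r < r0 -> 8 * r < i0 ->
  (KS_energy m p 0 f r <= C0%:E * (\int[m]_x (`|f0 x| `^ p)%:E +
     (r `^ (p + dh - 1))%:E *
       \int[nu]_(z in S) (`|abs_gradient nu f1 z| `^ p)%:E))%E.
Proof.
have N0 : 0 < overlap dh c C 4.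
  by rewrite /overlap mulr_gt0 ?divr_gt0 ?powR_gt0//; lra.
set N := overlap dh c C 4 in N0.
have [c2 c20 three] := three_powR.
have Cc : 0 < C / c by exact: divr_gt0.
have K0 : 0 < C / c + 1 + C by have := C_gt0; lra.
exists (c2 * N * (C / c + 1 + C)); first exact: (mulr_gt0 (mulr_gt0 c20 N0) K0).
move=> f f0 f1 r mf0 mf1 f1AC fE rp rr0 ri0.
have [hm _] := AC_abs_gradient H f1AC.
set h := abs_gradient nu f1 in hm *.
have [a [Va a_dense]] := V_dense_seq H.
have delta0 : 0 < r / 2 by lra.
pose K := net a (r / 2).
pose A i : set X := if K i then ball (a i) (2 * r) else set0.
pose b i : set X := if K i then ball (a i) r else set0.
have mA i : measurable (A i : set (borel X)).
  by rewrite /A; case: ifP => _; [exact: measurable_ball|exact: measurable0].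
have mb i : measurable (b i : set (borel X)).
  by rewrite /b; case: ifP => _; [exact: measurable_ball|exact: measurable0].
have cntA x n : (count (fun i => `[< A i x >]) (seq.iota 0 n))%:R <= N.
  apply: le_trans (net_count a c_gt0 volume x n delta0 (k := 4) _ _); [|lra|lra].
  rewrite ler_nat; apply: sub_count => i /asboolP; rewrite /A -/(K i).
  by case: ifP => // _ /in_ball ix; lra.
have phi_m : measurable_fun setT (fun x : borel X => (`|f0 x| `^ p)%:E).
  apply/measurable_EFinP; apply: (measurableT_comp (measurable_powR p)).
  exact: measurableT_comp.
have phi_0 x : (0 <= (`|f0 x| `^ p)%:E)%E by rewrite lee_fin powR_ge0.
have h_m : measurable_fun (S : set (skel_type iota V)) (fun z => (`|h z| `^ p)%:E).
  apply/measurable_EFinP; apply: (measurableT_comp (measurable_powR p)).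
  exact: measurableT_comp.
have h_0 z : (0 <= (`|h z| `^ p)%:E)%E by rewrite lee_fin powR_ge0.
pose Af i := (\int[m]_(x in A i) (`|f0 x| `^ p)%:E)%E.
pose Hh i := (\int[nu]_(z in S `&` A i) (`|h z| `^ p)%:E)%E.
have Af0 i : (0 <= Af i)%E by apply: integral_ge0.
have Hh0 i : (0 <= Hh i)%E by apply: integral_ge0.
have mSA i : M (S `&` A i).
  rewrite /A; case: ifP => _; last by rewrite setI0; exact: measurable0.
  by apply: (measurable_SI H); exact: open_ballX.
have sumA : (\sum_(i <oo) Af i <= N%:E * \int[m]_x (`|f0 x| `^ p)%:E)%E.
  by apply: overlap_sum => //; exact: ltW.
have sumH : (\sum_(i <oo) Hh i <= N%:E * \int[nu]_(z in S) (`|h z| `^ p)%:E)%E.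
  apply: (@overlap_sum _ _ R nu (fun i => S `&` A i)) => //.
  - exact: ltW.
  - exact: measurable_S H.
  - move=> z n; apply: le_trans (cntA z n); rewrite ler_nat.
    by apply: sub_count => i /asboolP[_ Aiz]; apply/asboolP.
pose cr := c * r `^ dh.
have rdh : 0 < r `^ dh by exact: powR_gt0.
have cr0 : 0 < cr by exact: mulr_gt0.
(* the bound of the integrand on the ball around the i-th net point *)
pose g i (x : X) : \bar R := (c2%:E * (cr^-1%:E * Af i +
  ((`|f0 x| `^ p)%:E + (r `^ (p - 1))%:E * Hh i)))%E.
have rp1 : 0 <= r `^ (p - 1) by exact: powR_ge0.
have k0 i x : (0 <= (`|f0 x| `^ p)%:E + (r `^ (p - 1))%:E * Hh i)%E.
  by apply: adde_ge0 => //; apply: mule_ge0.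
have inner x i : b i x ->
   ((m (ball (x : X) r))^-1 * \int[m]_(y in ball (x : X) r)
        (`|f y - f x| `^ p / r `^ (p * 0))%:E <= g i x)%E.
  rewrite /b; case: ifP => // Ki /in_ball ix.
  have AE : A i = ball (a i) (2 * r) by rewrite /A Ki.
  have xA : ball x r `<=` A i.
    by rewrite AE => y /in_ball xy; apply/in_ball; have := dtri x (a i) y; lra.
  have mB := measurable_ball x r.
  have /andP[v1 v2] := @volume x r ltac:(lra).
  have vfin : m (ball x r) \is a fin_num.
    by apply/fin_numP; split; apply/eqP => E; move: v1 v2; rewrite E.
  move: v1 v2; rewrite -(fineK vfin); set v := fine _; rewrite !lee_fin => v1 v2.
  have v0 : 0 < v by exact: lt_le_trans v1.
  have vE : m (ball x r) = v%:E by rewrite -(fineK vfin).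
  rewrite inver gt_eqF// lee_pdivrMl//.
  have step : (\int[m]_(y in ball (x : X) r) (`|f y - f x| `^ p / r `^ (p * 0))%:E <=
     c2%:E * (Af i + ((`|f0 x| `^ p)%:E + (r `^ (p - 1))%:E * Hh i) * v%:E))%E.
    apply: (@le_trans _ _ (\int[m]_(y in ball (x : X) r) (c2%:E * ((`|f0 y| `^ p)%:E +
       ((`|f0 x| `^ p)%:E + (r `^ (p - 1))%:E * Hh i)))))%E.
      apply: le_integral_nonmeas => y /in_ball xy.
        by rewrite mulr0 powRr0 divr1 lee_fin powR_ge0.
      rewrite mulr0 powRr0 divr1.
      have osc : ((`|f1 y - f1 x| `^ p)%:E <= (r `^ (p - 1))%:E * Hh i)%E.
        have xyi : d x y < i0 by lra.
        apply: (AC_osc_powR f1AC xyi (ltW xy) (mSA i)); first exact: subIsetl.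
        move=> z zxy; split; first exact: (seg_S H xyi zxy).
        rewrite AE; apply: (ball_convex _ _ _ zxy); [lra|lra|].
        by have := dtri x (a i) y; lra.
      apply: (@le_trans _ _ (c2%:E * ((`|f0 y| `^ p)%:E + ((`|f0 x| `^ p)%:E +
          (`|f1 y - f1 x| `^ p)%:E)))%E).
        rewrite -!EFinD -EFinM lee_fin !fE.
        have -> : f0 y + f1 y - (f0 x + f1 x) = f0 y + (- f0 x) + (f1 y - f1 x).
          by lra.
        by rewrite [X in c2 * X]addrA -(normrN (f0 x)); exact: three.
      by apply: lee_wpmul2l; [rewrite lee_fin ltW|rewrite !leeD2l].
    rewrite ge0_integralZl_EFin//; [|by move=> y _; apply: adde_ge0| |exact: ltW];
      last first.
      by apply: emeasurable_funD; [exact: measurable_funTS|exact: measurable_cst].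
    apply: lee_wpmul2l; first by rewrite lee_fin ltW.
    rewrite ge0_integralD//; last exact: measurable_funTS.
    apply: leeD.
      by apply: ge0_subset_integral => //; exact: measurable_funTS.
    by rewrite (integral_cst m mB) vE.
  apply: (le_trans step); rewrite /g muleCA.
  apply: lee_wpmul2l; first by rewrite lee_fin ltW.
  have cA : (0 <= cr^-1%:E * Af i)%E.
    by apply: mule_ge0 => //; rewrite lee_fin invr_ge0 ltW.
  rewrite (@ge0_muleDr _ v%:E _ _ cA (k0 i x)).
  rewrite [(_ * v%:E)%E]muleC; apply: leeD => //.
  rewrite muleA -EFinM -[leLHS]mul1e; apply: lee_wpmul2r => //.
  by rewrite lee_fin ler_pdivlMr// mul1r.
have mg i : measurable_fun (b i : set (borel X)) (g i).
  apply: measurable_funeM; apply: emeasurable_funD; first exact: measurable_cst.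
  by apply: emeasurable_funD; [exact: measurable_funTS|exact: measurable_cst].
have g0 i x : (0 <= g i x)%E.
  apply: mule_ge0; first by rewrite lee_fin ltW.
  by apply: adde_ge0 => //; apply: mule_ge0 => //; rewrite lee_fin invr_ge0 ltW.
have F0 x : (0 <= (m (ball (x : X) r))^-1 * \int[m]_(y in ball (x : X) r)
        (`|f y - f x| `^ p / r `^ (p * 0))%:E)%E.
  apply: mule_ge0; first by rewrite inve_ge0.
  by apply: integral_ge0 => y _; rewrite mulr0 powRr0 divr1 lee_fin powR_ge0.
apply: (le_trans (integral_le_patches m F0 mb mg (fun i x _ => g0 i x) _)).
  move=> x; have [i Ki ix] := net_cover a_dense x delta0.
  have bi : b i x by rewrite /b /K Ki; apply/in_ball; lra.
  by exists i => //; exact: inner.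
have term i : (\int[m]_(x in b i) g i x <=
    (c2 * (C / c + 1))%:E * Af i + (c2 * C * r `^ (p + dh - 1))%:E * Hh i)%E.
  have [Ki|Ki] := boolP (K i); last first.
    rewrite /b (negbTE Ki) integral_set0; apply: adde_ge0; apply: mule_ge0 => //.
      by rewrite lee_fin mulr_ge0// ?addr_ge0// ltW.
    by rewrite lee_fin !mulr_ge0 ?powR_ge0// ltW.
  have bE : b i = ball (a i) r by rewrite /b Ki.
  have bA : b i `<=` A i.
    rewrite bE /A Ki => y /in_ball iy; apply/in_ball.
    by have := d_ge0 (a i) y; lra.
  have /andP[_ v2] := @volume (a i) r ltac:(lra).
  rewrite /g ge0_integralZl_EFin//; last 3 first.
  - by move=> x _; apply: adde_ge0 => //; apply: mule_ge0 => //; rewrite lee_fin invr_ge0 ltW.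
  - apply: emeasurable_funD; first exact: measurable_cst.
    by apply: emeasurable_funD; [exact: measurable_funTS|exact: measurable_cst].
  - exact: ltW.
  have c0 : (0 <= cr^-1%:E)%E by rewrite lee_fin invr_ge0 ltW.
  have cA : (0 <= cr^-1%:E * Af i)%E by exact: mule_ge0.
  have cH : (0 <= (r `^ (p - 1))%:E * Hh i)%E by exact: mule_ge0.
  rewrite ge0_integralD//; last first.
    by apply: emeasurable_funD; [exact: measurable_funTS|exact: measurable_cst].
  rewrite ge0_integralD//; last exact: measurable_funTS.
  rewrite !(integral_cst m (mb i)).
  have mb_le : (m (b i) <= (C * r `^ dh)%:E)%E by rewrite bE.
  have t1 : (cr^-1%:E * Af i * m (b i) <= (C / c)%:E * Af i)%E.
    apply: (@le_trans _ _ (cr^-1%:E * Af i * (C * r `^ dh)%:E)%E).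
      exact: lee_wpmul2l.
    rewrite muleC muleA -EFinM.
    have -> // : C * r `^ dh / cr = C / c.
    by rewrite /cr; field; rewrite !gt_eqF.
  have t2 : (\int[m]_(x in b i) (`|f0 x| `^ p)%:E <= Af i)%E.
    by apply: ge0_subset_integral => //; exact: measurable_funTS.
  have t3 : ((r `^ (p - 1))%:E * Hh i * m (b i) <=
      (C * r `^ (p + dh - 1))%:E * Hh i)%E.
    apply: (@le_trans _ _ ((r `^ (p - 1))%:E * Hh i * (C * r `^ dh)%:E)%E).
      exact: lee_wpmul2l.
    rewrite muleC muleA -EFinM -[C * _ * _]mulrA -powRD ?(gt_eqF rp) ?implybT//.
    by have -> : dh + (p - 1) = p + dh - 1 by lra.
  apply: (@le_trans _ _ (c2%:E * ((C / c)%:E * Af i + (Af i +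
     (C * r `^ (p + dh - 1))%:E * Hh i)))%E).
    by apply: lee_wpmul2l; [rewrite lee_fin ltW|apply: leeD => //; exact: leeD].
  have e1 : (0 <= (C / c)%:E * Af i)%E by apply: mule_ge0 => //; rewrite lee_fin ltW.
  have e2 : (0 <= (C * r `^ (p + dh - 1))%:E * Hh i)%E.
    by apply: mule_ge0 => //; rewrite lee_fin mulr_ge0 ?powR_ge0// ltW.
  rewrite addeA (@ge0_muleDr _ c2%:E _ _ (adde_ge0 e1 (Af0 i)) e2).
  rewrite [(c2 * (_ + _))%:E]EFinM [(C / c + 1)%:E]EFinD.
  rewrite -[(c2%:E * _ * Af i)%E]muleA.
  have Cc0 : (0 <= (C / c)%:E)%E by rewrite lee_fin ltW.
  rewrite (@ge0_muleDl _ (Af i) (C / c)%:E 1 Cc0 lee01) mul1e.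
  by rewrite [(c2%:E * (_ * Hh i))%E]muleA -EFinM [c2 * (C * _)]mulrA.
apply: (@le_trans _ _ (\sum_(i <oo) ((c2 * (C / c + 1))%:E * Af i +
    (c2 * C * r `^ (p + dh - 1))%:E * Hh i))%E).
  apply: lee_nneseries => [i _ _|i _]; last exact: term.
  by apply: integral_ge0 => x _; exact: g0.
have k1 : 0 <= c2 * (C / c + 1) by rewrite mulr_ge0 ?addr_ge0// ltW.
have k2 : 0 <= c2 * C * r `^ (p + dh - 1).
  by rewrite !mulr_ge0 ?powR_ge0// ltW.
rewrite nneseriesD; last 2 first.
- by move=> i _ _; apply: mule_ge0.
- by move=> i _ _; apply: mule_ge0.
rewrite !nneseriesZl//.
set IA := (\int[m]_x _)%E in sumA *; set IH := (\int[nu]_(z in S) _)%E in sumH *.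
have IA0 : (0 <= IA)%E by exact: integral_ge0.
have IH0 : (0 <= IH)%E by exact: integral_ge0.
apply: (@le_trans _ _ ((c2 * (C / c + 1))%:E * (N%:E * IA) +
   (c2 * C * r `^ (p + dh - 1))%:E * (N%:E * IH))%E).
  by apply: leeD; apply: lee_wpmul2l.
have rq0 : 0 <= r `^ (p + dh - 1) by exact: powR_ge0.
have rIH : (0 <= (r `^ (p + dh - 1))%:E * IH)%E by exact: mule_ge0.
rewrite (ge0_muleDr _ IA0 rIH).
apply: leeD; rewrite muleA -EFinM.
  apply: lee_wpmul2r => //.
  rewrite lee_fin [c2 * _ * N]mulrAC; apply: ler_wpM2l.
    exact: mulr_ge0 (ltW c20) (ltW N0).
  by have := C_gt0; lra.
rewrite [leRHS]muleA -EFinM; apply: lee_wpmul2r => //.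
rewrite lee_fin [leLHS]mulrAC; apply: ler_wpM2r => //.
rewrite [c2 * C * N]mulrAC; apply: ler_wpM2l.
  exact: mulr_ge0 (ltW c20) (ltW N0).
by move: Cc; lra.
Qed.

End energy_upper_bound.

(** * Weak gradients of piecewise affine functions *)

(** The supremum of the t such that good 0 t is reached because of the behaviour
to the left of it, and is l because of the behaviour to the right of it. *)
Lemma real_induction {R : realType} (l : R) (good : R -> R -> Prop) : 0 <= l ->
  (forall t, 0 <= t <= l -> good t t) ->
  (forall a b c, 0 <= a -> a <= b -> b <= c -> c <= l ->
    good a b -> good b c -> good a c) ->
  (forall t, 0 < t -> t <= l -> exists2 e, 0 < e &
    forall s, 0 <= s -> t - e < s -> s <= t -> good s t) ->
  (forall t, 0 <= t -> t < l -> exists2 e, 0 < e &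
    forall s, s <= l -> t <= s -> s < t + e -> good t s) ->
  good 0 l.
Proof.
move=> l0 refl trans left right.
pose A := [set t | 0 <= t <= l /\ good 0 t].
have A0 : A 0 by split; [rewrite lexx|apply: refl; rewrite lexx].
have Aub : ubound A l by move=> t [/andP[]].
have As : has_sup A by split; [exists 0|exists l].
have s0 : 0 <= sup A by exact: ub_le_sup (proj2 As) _ A0.
have sl : sup A <= l by apply: ge_sup => //; exists 0.
have gs : good 0 (sup A).
  have [E|sn0] := eqVneq (sup A) 0; first by rewrite E; apply: refl; rewrite lexx.
  have sp : 0 < sup A by rewrite lt_neqAle eq_sym sn0.
  have [e e0 le] := left _ sp sl.
  have [t [tI gt] te] := sup_adherent e0 As.
  have ts : t <= sup A by exact: ub_le_sup (proj2 As) _ _.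
  have t0 : 0 <= t by case/andP: tI.
  by apply: (trans 0 t) => //; exact: le.
have [<-//|sl'] := eqVneq (sup A) l.
have sl2 : sup A < l by rewrite lt_neqAle sl' sl.
have [e e0 re] := right _ s0 sl2.
pose t := Num.min l (sup A + e / 2).
have tl : t <= l by rewrite ge_min lexx.
have st : sup A < t by rewrite lt_min sl2/= ltrDl; lra.
have te : t <= sup A + e / 2 by rewrite ge_min lexx orbT.
have gt : good (sup A) t by apply: re => //; [exact: ltW|lra].
have : t <= sup A.
  apply: ub_le_sup (proj2 As) _ _; split; first by apply/andP; split => //; lra.
  by apply: (trans 0 (sup A)) => //; exact: ltW.
by rewrite leNgt st.
Qed.

Section slopes.
Context {R : realType} {X : pointedMetricType R} (iota : X -> R) (V : set X).
Variables (nu : {measure set (skel_type iota V) -> \bar R}) (i0 : R).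
Local Notation d := (@mdist R X).
Local Notation S := (skeleton iota).
Local Notation B x := (ball x (iota x)).
Local Notation M A := (measurable (A : set (skel_type iota V))).
Hypothesis H : length_tree nu i0.
Implicit Types (u v w x y z : X).

(** The one-sided derivative of a piecewise affine function. Exact affinity,
instead of a limit of difference quotients, is stable under finite minima. *)
Definition germ (f : X -> R) z w (s : R) :=
  exists2 e, 0 < e & forall y, btw z y w -> d z y < e -> f y = f z + s * d z y.

Lemma germ_uniq f z w s s' : z <> w -> d z w < i0 ->
  germ f z w s -> germ f z w s' -> s = s'.
Proof.
move=> zw zwi [e e0 ge] [e' e'0 ge'].
have zw0 := d_gt0 zw.
pose t := Num.min (d z w) (Num.min e e' / 2).
have m0 : 0 < Num.min e e' by rewrite lt_min e0.
have me : Num.min e e' <= e by rewrite ge_min lexx.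
have me' : Num.min e e' <= e' by rewrite ge_min lexx orbT.
have t0 : 0 < t by rewrite lt_min zw0/=; lra.
have tw : t <= d z w by rewrite ge_min lexx.
have te : t <= Num.min e e' / 2 by rewrite ge_min lexx orbT.
have [y [y1 y2]] := @seg_point _ _ _ _ _ _ H z w t zwi ltac:(lra).
have yb : btw z y w by rewrite /btw; lra.
have := ge y yb ltac:(lra); rewrite (ge' y yb ltac:(lra)) y1.
by move=> /addrI/(mulIf (lt0r_neq0 t0))/esym.
Qed.

Variables (f : X -> R) (L rho : R).
Hypotheses (L0 : 0 <= L) (rho0 : 0 < rho).
Hypothesis f_lip : forall y y', d y y' < rho -> `|f y - f y'| <= L * d y y'.
Hypothesis f_germ : forall z w, z <> w -> d z w < i0 -> exists s, germ f z w s.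

Lemma lip_continuous : continuous f.
Proof.
move=> z; apply/cvgrPdist_lt => e e0.
have e1 : 0 < e / (L + 1) by apply: divr_gt0 => //; have := L0; lra.
near=> y.
have zy : d z y < rho.
  by apply/in_ball; near: y; exact: (nbhsx_ballx z _ rho0).
apply: (le_lt_trans (f_lip zy)).
have : d z y < e / (L + 1).
  by apply/in_ball; near: y; exact: (nbhsx_ballx z _ e1).
rewrite ltr_pdivlMr; last by have := L0; lra.
by have := L0; have := d_ge0 z y; nra.
Unshelve. all: by end_near. Qed.

Section at_point.
Variable x : X.
Let T := B x.
Let Tt : is_tree T. Proof. exact: lt_tree H x. Qed.
Let To : open T. Proof. exact: open_ballX. Qed.
Let Tx : T x. Proof. exact: B_center H x. Qed.

(** Retractions towards x: they express the slope towards x as a limit of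
difference quotients of continuous functions, which makes it measurable. *)
Lemma retract_exists (s : R) : 0 < s -> exists pr : X -> X, forall z, T z ->
  [/\ T (pr z), btw x (pr z) z & d (pr z) z = Num.min s (d x z)].
Proof.
move=> s0.
suff /choice[pr prP] : forall z, exists y, T z ->
    [/\ T y, btw x y z & d y z = Num.min s (d x z)] by exists pr.
move=> z; have [Tz|nTz] := pselect (T z); last by exists z.
have m1 : Num.min s (d x z) <= d x z by rewrite ge_min lexx orbT.
have m0 : 0 <= Num.min s (d x z) by rewrite le_min ltW//= d_ge0.
have [y [Ty y1 y2]] := @tree_point _ _ _ Tt x z (d x z - Num.min s (d x z)) Tx Tz
  ltac:(lra).
by exists y => _; split => //; [rewrite /btw; lra|lra].
Qed.

Lemma retract_lip (s : R) (pr : X -> X) : 0 < s -> (forall z, T z ->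
  [/\ T (pr z), btw x (pr z) z & d (pr z) z = Num.min s (d x z)]) ->
  forall z z', T z -> T z' -> d (pr z) (pr z') <= 4 * d z z'.
Proof.
move=> s0 prP.
have minL z z' : Num.min s (d x z) <= Num.min s (d x z') + d z z'.
  have zz0 := d_ge0 z z'; have := dtri z' x z; have := dC z z'.
  by rewrite minEle [Num.min s (d x z')]minEle; case: (leP s (d x z)) => ?;
    case: (leP s (d x z')) => ?; lra.
have side z z' c : T z -> T z' -> T c -> btw x c z -> btw x c z' -> btw z c z' ->
    d x c < d x (pr z) -> d (pr z) (pr z') <= 4 * d z z'.
  move=> Tz Tz' Tc xcz xcz' zcz' lt.
  have [Ta xaz az] := prP z Tz; have [Ta' xaz' az'] := prP z' Tz'.
  have := tree_sub Tt To Tx Tz Tc Ta xcz xaz (ltW lt) => ca.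
  have zz : d (pr z) z <= d z z'.
    move: xcz xaz zcz'; rewrite /btw => xcz xaz zcz'.
    by have := d_ge0 c z'; have := dC z c; lra.
  have := minL z' z; rewrite -az -az' => h.
  have := dtri z (pr z) (pr z'); have := dtri z' z (pr z').
  by have := dC (pr z') z'; have := dC z z'; lra.
move=> z z' Tz Tz'.
have [c [Tc xcz xcz' zcz']] := tree_median Tt Tx Tz Tz'.
have [le|lt] := leP (d x (pr z)) (d x c); last exact: (side z z' c).
have [le'|lt'] := leP (d x (pr z')) (d x c); last first.
  by rewrite dC (dC z); apply: (side z' z c) => //; exact: btwC.
have [Ta xaz az] := prP z Tz; have [Ta' xaz' az'] := prP z' Tz'.
have onxc a : T a -> btw x a z -> d x a <= d x c -> btw x a c.
  move=> Ta1 xa1 le1; have := tree_sub Tt To Tx Tz Ta1 Tc xa1 xcz le1.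
  by rewrite /btw; lra.
have onxc' a : T a -> btw x a z' -> d x a <= d x c -> btw x a c.
  move=> Ta1 xa1 le1; have := tree_sub Tt To Tx Tz' Ta1 Tc xa1 xcz' le1.
  by rewrite /btw; lra.
have h1 := minL z z'; have h2 := minL z' z; rewrite -az -az' in h1 h2.
have zz0 := d_ge0 z z'; have zzC := dC z z'.
have t1 := dtri z' x z; have t2 := dtri z x z'.
move: xaz xaz' (onxc _ Ta xaz le) (onxc' _ Ta' xaz' le') => xaz xaz' ac ac'.
have [ll|/ltW ll] := leP (d x (pr z)) (d x (pr z')).
  have := tree_sub Tt To Tx Tc Ta Ta' ac ac' ll.
  by move: xaz xaz'; rewrite /btw; lra.
have := tree_sub Tt To Tx Tc Ta' Ta ac' ac ll.
by rewrite dC; move: xaz xaz'; rewrite /btw; lra.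
Qed.

(** The slope of f along the geodesics issued from x, as a limit of difference
quotients; by piecewise affinity these are eventually constant. *)
Lemma radial_slope : exists g : X -> R,
  [/\ measurable_fun (S `&` T : set (skel_type iota V)) g,
      forall z e s, T z -> z <> x -> 0 < e ->
        (forall y, T y -> btw x y z -> d y z < e -> f y = f z - s * d y z) ->
        g z = s &
      forall z, T z -> z <> x -> exists w,
        [/\ z <> w, d z w < i0 & germ f z w (- g z)]].
Proof.
have inv0 n : 0 < n.+1%:R^-1 :> R by rewrite invr_gt0 ltr0n.
have /choice[pr prP] n := retract_exists (inv0 n).
pose q n z := (f z - f (pr n z)) * n.+1%:R.
pose g z := limn (q ^~ z).
have slopeP z e s : T z -> z <> x -> 0 < e ->
    (forall y, T y -> btw x y z -> d y z < e -> f y = f z - s * d y z) ->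
    q ^~ z @ \oo --> s.
  move=> Tz zx e0 aff; have xz0 := d_gt0 (nesym zx).
  have m0 : 0 < Num.min e (d x z) by rewrite lt_min e0.
  have [N _ NP] := near_infty_natSinv_lt (PosNum m0).
  apply: cvg_near_cst; exists N => // n /NP /=; rewrite lt_min => /andP[n1 n2].
  have [Ty yb yd] := prP n z Tz.
  have yE : d (pr n z) z = n.+1%:R^-1 by rewrite yd; apply/min_idPl; exact: ltW.
  rewrite /q (aff _ Ty yb) ?yE// opprB addrC subrK -mulrA mulVf ?mulr1//.
have below z w s : T z -> T w -> btw x w z -> z <> w -> d z w < i0 ->
    germ f z w s -> exists2 e, 0 < e &
    forall y, T y -> btw x y z -> d y z < e -> f y = f z - (- s) * d y z.
  move=> Tz Tw xwz zw zwi [e e0 ge].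
  exists (Num.min e (d z w)); first by rewrite lt_min e0 d_gt0.
  move=> y Ty xyz; rewrite lt_min => /andP[y1 y2].
  have xwE := xwz; have xyE := xyz; rewrite /btw in xwE xyE.
  have := tree_sub Tt To Tx Tz Tw Ty xwz xyz.
  have := dC z w; have := dC z y; have := dC y w => c1 c2 c3 h.
  rewrite mulNr opprK (dC y z); apply: ge; [rewrite /btw|rewrite dC//].
  by have := h ltac:(lra); lra.
have conv z : T z -> z <> x -> exists w s, [/\ z <> w, d z w < i0,
    germ f z w s & q ^~ z @ \oo --> - s].
  move=> Tz zx; have xz0 := d_gt0 (nesym zx).
  have I0 := i0_gt0 H.
  pose t := Num.min (i0 / 2) (d x z).
  have t0 : 0 < t by rewrite lt_min xz0 andbT; lra.
  have ti : t <= i0 / 2 by rewrite ge_min lexx.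
  have tx : t <= d x z by rewrite ge_min lexx orbT.
  have [w [Tw w1 w2]] := @tree_point _ _ _ Tt x z (d x z - t) Tx Tz ltac:(lra).
  have zw : z <> w by move=> E; move: w2; rewrite E dxx -E; lra.
  have zwi : d z w < i0 by rewrite dC; lra.
  have [s gs] := f_germ zw zwi.
  have xwz : btw x w z by rewrite /btw; lra.
  have [e e0 ae] := below z w s Tz Tw xwz zw zwi gs.
  by exists w, s; split => //; exact: slopeP ae.
exists g; split.
- apply: (@measurable_fun_cvg _ (skel_type iota V) R (S `&` T) q).
    move=> n; apply: measurable_funM; last exact: measurable_cst.
    apply: measurable_funB; apply: (continuous_measurable_S H To).
      by move=> z _; exact: lip_continuous.
    move=> z; rewrite inE => Tz.
    apply: (@continuous_comp _ _ _ (pr n) f); last exact: lip_continuous.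
    apply/cvg_ballP => e e0.
    have e4 : 0 < e / 4 by lra.
    near=> y; apply/in_ball.
    have zy : d z y < e / 4.
      by apply/in_ball; near: y; exact: (nbhsx_ballx z _ e4).
    have Ty : T y by near: y; apply: open_nbhs_nbhs.
    by have := retract_lip (inv0 n) (prP n) Tz Ty; lra.
  move=> z [_ Tz]; have [->|/eqP zx] := eqVneq z x.
    have qx n : q n x = 0.
      have [_ _ pd] := prP n x Tx; rewrite dxx in pd.
      have E : pr n x = x.
        by apply: d_eq0; rewrite pd; apply/min_idPr; exact: ltW.
      by rewrite /q E subrr mul0r.
    apply/cvg_ex; exists 0; apply: cvg_near_cst; apply: nearW => n.
    by rewrite qx.
  by have [w [s [_ _ _ cq]]] := conv z Tz zx; apply/cvg_ex; exists (- s).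
- move=> z e s Tz zx e0 aff; apply/cvg_lim => //; exact: slopeP aff.
- move=> z Tz zx; have [w [s [zw zwi gs cq]]] := conv z Tz zx.
  exists w; split => //; rewrite /g.
  by rewrite (cvg_lim _ cq)// opprK.
Unshelve. all: by end_near. Qed.

(** Where f is affine along a geodesic from x, the integral of the slope is the
increment of f; real induction along the geodesic glues these pieces. *)
Lemma gradient_of_slopes : exists2 g, is_gradient_at nu f x g &
  forall z, T z -> z <> x -> exists w,
    [/\ z <> w, d z w < i0 & germ f z w (- g z)].
Proof.
have [g [gm g_aff g_germ]] := radial_slope; exists g => //.
have gL z : T z -> z <> x -> `|g z| <= L.
  move=> Tz zx; have [w [zw zwi [e e0 ge]]] := g_germ z Tz zx.
  have zw0 := d_gt0 zw.
  pose t := Num.min (d z w) (Num.min e rho / 2).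
  have m0 : 0 < Num.min e rho by rewrite lt_min e0 rho0.
  have me : Num.min e rho <= e by rewrite ge_min lexx.
  have mr : Num.min e rho <= rho by rewrite ge_min lexx orbT.
  have t0 : 0 < t by rewrite lt_min zw0/=; lra.
  have tw : t <= d z w by rewrite ge_min lexx.
  have te : t <= Num.min e rho / 2 by rewrite ge_min lexx orbT.
  have [y [y1 y2]] := @seg_point _ _ _ _ _ _ H z w t zwi ltac:(lra).
  have yb : btw z y w by rewrite /btw; lra.
  have := @f_lip y z; rewrite (ge y yb ltac:(lra)) dC y1 => /(_ ltac:(lra)).
  rewrite addrAC subrr add0r normrM normrN (gtr0_norm t0).
  by rewrite ler_pM2r.
have oT u v : T u -> T v -> oseg T u v `<=` S `&` T.
  move=> Tu Tv z zuv; split; first exact: (oseg_S H Tt To Tu Tv zuv).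
  by case/(osegP Tt To z Tu Tv): zuv.
have gi u v : T u -> T v -> nu.-integrable (oseg T u v) (EFin \o g).
  move=> Tu Tv; have [mo no] := oseg_measure H Tt To Tu Tv.
  have mST : M (S `&` T) by exact: (measurable_SI H To).
  apply: measurable_bounded_integrable => //.
  - by rewrite [ltLHS]no ltry.
  - by apply: measurable_funS gm => //; exact: oT.
  - exists (Num.max L `|g x|); split; first exact: num_real.
    move=> b; rewrite gt_max => /andP[b1 b2] z zo /=.
    have [->|/eqP zx] := eqVneq z x; first exact: ltW.
    by apply: le_trans (ltW b1); apply: gL => //; case: (oT _ _ Tu Tv _ zo).
split => //= u Tu.
have [phi pg] := tree_geo Tt Tx Tu.
have [pT _ p0 p1] := pg; have pi := geo_isom pg.
set l := d x u in p1 pi.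
have l0 : 0 <= l by exact: d_ge0.
have pT' t : 0 <= t -> t <= l -> T (phi t) by move=> ? ?; apply: pT; rewrite in_itv/=; apply/andP.
have pd t : 0 <= t -> t <= l -> d x (phi t) = t.
  by move=> ? ?; apply: (geo_dl pg); apply/andP.
have pb t t' : 0 <= t -> t <= t' -> t' <= l -> btw x (phi t) (phi t').
  by move=> h1 h2 h3; rewrite /btw !pd ?pi//; lra.
(* the identity to be proved, between two parameters of the geodesic *)
pose good s t := f (phi t) - f (phi s) = \int[nu]_(z in oseg T (phi s) (phi t)) g z.
suff : good 0 l by rewrite /good p0 p1.
have aff_good a b k : 0 <= a -> a <= b -> b <= l ->
    (forall t, a <= t -> t <= b -> f (phi t) = f (phi a) + k * (t - a)) -> good a b.
  move=> a0 ab bl aff.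
  have Ta : T (phi a) by apply: pT'; lra.
  have Tb : T (phi b) by apply: pT'; lra.
  have [mo no] := oseg_measure H Tt To Ta Tb.
  rewrite /good (aff b ab (lexx _)).
  transitivity (\int[nu]_(z in oseg T (phi a) (phi b)) (cst k z)).
    rewrite Rintegral_cst// /= [X in fine X]no /= pi//; lra.
  apply: eq_Rintegral => z; rewrite inE => zo; apply/esym.
  have [Tz zb za zb'] : [/\ T z, btw (phi a) z (phi b), z <> phi a & z <> phi b].
    exact/osegP.
  have az0 := d_gt0 (nesym za); have zb0 := d_gt0 zb'.
  have zbE := zb; rewrite /btw pi// in zbE.
  have xzb : btw x z (phi b).
    rewrite /btw; apply/eqP; rewrite eq_le dtri andbT.
    have := dtri (phi a) x z; rewrite !pd//; lra.
  have xz : d x z = a + d (phi a) z.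
    by move: xzb; rewrite /btw pd//; lra.
  have xzu : btw x z u.
    rewrite /btw; apply/eqP; rewrite eq_le dtri andbT.
    have := dtri (phi b) z u; rewrite (geo_dr pg) -/l; lra.
  have zE : z = phi (d x z) by exact: (tree_btw_geo Tt To Tx Tu Tz pg xzu).
  apply: (g_aff z (d (phi a) z)) => //.
    by move=> E; move: xz az0; rewrite E dxx; lra.
  move=> y Ty xyz yz; have xyzE := xyz; rewrite /btw in xyzE.
  have xyu : btw x y u.
    rewrite /btw; apply/eqP; rewrite eq_le dtri andbT.
    by have := dtri z y u; move: xzu; rewrite /btw; lra.
  have yE : y = phi (d x y) by exact: (tree_btw_geo Tt To Tx Tu Ty pg xyu).
  have y0 := d_ge0 y z.
  rewrite {1}yE {1}zE (aff (d x y)); [|lra|lra].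
  rewrite /= (aff (d x z)); [|lra|lra].
  by have -> : d x y = d x z - d y z by [lra]; ring.
apply: real_induction => //.
- move=> t tI; rewrite /good subrr oseg_eq0 ?Rintegral_set0//.
  by apply: pT'; lra.
- move=> a b c a0 ab bc cl; rewrite /good => g1 g2.
  have [E|/eqP ab'] := eqVneq a b; first by rewrite E.
  have [E|/eqP bc'] := eqVneq b c; first by rewrite -E.
  have Ta : T (phi a) by apply: pT'; lra.
  have Tb : T (phi b) by apply: pT'; lra.
  have Tc : T (phi c) by apply: pT'; lra.
  have abc : oseg T (phi a) (phi c) (phi b).
    apply/osegP => //; split => //.
    + by rewrite /btw !pi//; lra.
    + move=> E; have pa : d x (phi a) = a by apply: pd; lra.
      by apply: ab'; rewrite -pa -E pd; lra.
    + move=> E; have pc : d x (phi c) = c by apply: pd; lra.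
      by apply: bc'; rewrite -pc -E pd; lra.
  rewrite (Rintegral_oseg_cut H Tt To Ta Tc (gi _ _ Ta Tc) abc) -g1 -g2; lra.
- move=> t t0 tl; have I0 := i0_gt0 H.
  pose t' := Num.max 0 (t - i0 / 2).
  have t'0 : 0 <= t' by rewrite le_max lexx.
  have t't : t' < t by rewrite gt_max t0/=; lra.
  have t'i : t - i0 / 2 <= t' by rewrite le_max lexx orbT.
  have zwE : d (phi t) (phi t') = t - t' by rewrite dC pi//; lra.
  have zw : phi t <> phi t' by move=> E; move: zwE; rewrite E dxx; lra.
  have [s [e e0 ge]] := f_germ zw ltac:(rewrite zwE; lra).
  exists (Num.min e (t - t')); first by rewrite lt_min e0/=; lra.
  move=> a a0; rewrite ltrBlDl -ltrBlDr lt_min => /andP[a1 a2] at_.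
  have fE tau : a <= tau -> tau <= t -> f (phi tau) = f (phi t) + s * (t - tau).
    move=> a3 a4; have ztE : d (phi t) (phi tau) = t - tau by rewrite dC pi//; lra.
    rewrite -ztE; apply: ge; last by rewrite ztE; lra.
    by rewrite /btw zwE ztE dC pi//; lra.
  apply: (aff_good _ _ (- s)) => // tau h1 h2.
  by rewrite (fE _ h1 h2) (fE a (lexx _) at_); lra.
- move=> t t0 tl; have I0 := i0_gt0 H.
  pose t' := Num.min l (t + i0 / 2).
  have t'l : t' <= l by rewrite ge_min lexx.
  have t't : t < t' by rewrite lt_min tl/=; lra.
  have t'i : t' <= t + i0 / 2 by rewrite ge_min lexx orbT.
  have zwE : d (phi t) (phi t') = t' - t by rewrite pi//; lra.
  have zw : phi t <> phi t' by move=> E; move: zwE; rewrite E dxx; lra.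
  have [s [e e0 ge]] := f_germ zw ltac:(rewrite zwE; lra).
  exists (Num.min e (t' - t)); first by rewrite lt_min e0/=; lra.
  move=> a al ta; rewrite -ltrBlDl lt_min => /andP[a1 a2].
  apply: (aff_good _ _ s) => // tau h1 h2.
  have ztE : d (phi t) (phi tau) = tau - t by rewrite pi//; lra.
  rewrite -ztE; apply: ge; last by rewrite ztE; lra.
  by rewrite /btw zwE ztE pi//; lra.
Qed.

End at_point.
End slopes.

(** * Slopes of finite minima *)

Section finite_minima.
Context {R : realType}.
Implicit Types (I : seq nat) (s : nat -> R).

Lemma seq_argmin I s : I != [::] ->
  exists2 k, k \in I & forall j, j \in I -> s k <= s j.
Proof.
elim: I => // i I IH _; have [->|/IH[k kI kmin]] := eqVneq I [::].
  by exists i; rewrite ?mem_head// => j; rewrite inE => /eqP ->.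
have [le|/ltW le] := leP (s i) (s k).
  exists i; first exact: mem_head.
  by move=> j; rewrite inE => /orP[/eqP->//|/kmin]; exact: le_trans.
exists k; first by rewrite inE kI orbT.
by move=> j; rewrite inE => /orP[/eqP->//|/kmin].
Qed.

Lemma seq_uniform_eps I (P : nat -> R -> Prop) :
  (forall j, j \in I -> exists2 e, 0 < e & forall e', 0 < e' -> e' <= e -> P j e') ->
  exists2 e, 0 < e & forall j, j \in I -> P j e.
Proof.
elim: I => [|i I IH] h; first by exists 1.
have [e e0 eP] := h i (mem_head _ _).
have [e' e'0 e'P] : exists2 e, 0 < e &
    forall j, j \in I -> forall e', 0 < e' -> e' <= e -> P j e'.
  have {IH}h' j : j \in I -> exists2 e, 0 < e & forall e', 0 < e' -> e' <= e -> P j e'.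
    by move=> jI; apply: h; rewrite inE jI orbT.
  elim: I h' {h} => [|j I IH] h; first by exists 1.
  have [f f0 fP] := h j (mem_head _ _).
  have [k kI|g g0 gP] := IH; first by apply: h; rewrite inE kI orbT.
  exists (Num.min f g); first by rewrite lt_min f0.
  move=> k; rewrite inE => /orP[/eqP->|kI] e' e'0; rewrite le_min => /andP[h1 h2].
    exact: fP.
  exact: gP.
exists (Num.min e e'); first by rewrite lt_min e0.
have m0 : 0 < Num.min e e' by rewrite lt_min e0.
move=> j; rewrite inE => /orP[/eqP->|jI].
  by apply: eP => //; rewrite ge_min lexx.
by apply: e'P => //; rewrite ge_min lexx orbT.
Qed.

Lemma inf_min (A : set R) b : A b -> lbound A b -> inf A = b.
Proof.
move=> Ab lb; apply/eqP; rewrite eq_le; apply/andP; split.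
  by apply: ge_inf => //; exists b.
by apply: lb_le_inf => //; exists b.
Qed.

End finite_minima.

Section germs.
Context {R : realType} {X : pointedMetricType R} (iota : X -> R) (V : set X).
Variables (nu : {measure set (skel_type iota V) -> \bar R}) (i0 : R).
Local Notation d := (@mdist R X).
Hypothesis H : length_tree nu i0.
Implicit Types (u v w x y z : X).

(** Among the functions that realise the minimum at z, the one with the
smallest slope realises it along a short segment. *)
Lemma germ_min z w rho (I : seq nat) (u : nat -> X -> R) (s : nat -> R) (F : X -> R) :
  0 < rho ->
  (forall y, d z y < rho -> (forall k, k \in I -> F y <= u k y) /\
     exists2 k, k \in I & F y = u k y) ->
  (forall k, k \in I -> germ (u k) z w (s k)) ->
  exists2 k, k \in I & germ F z w (s k).
Proof.
move=> rho0 Fmin ug.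
have [|Fz [k0 k0I Fk0]] := Fmin z; first by rewrite dxx.
pose A := [seq k <- I | u k z == F z].
have A0 : A != [::].
  have kA : k0 \in A by rewrite mem_filter k0I Fk0 eqxx.
  by apply/eqP => A0; rewrite A0 in kA.
have [k] := seq_argmin s A0; rewrite mem_filter => /andP[/eqP kz kI] kmin.
exists k => //.
(* close to z each function either realises the minimum at z or stays above the
branch that k follows *)
pose P j (e : R) := forall y, btw z y w -> d z y < e ->
  u j y = u j z + s j * d z y /\ (u j z = F z \/ F z + s k * d z y < u j y).
have [j jI|e e0 eP] := @seq_uniform_eps _ I P.
  have [e e0 ge] := ug j jI.
  have [E|ne] := eqVneq (u j z) (F z).
    exists e => // e' e'0 e'e y yb ye; split; last by left.
    by apply: ge => //; exact: lt_le_trans ye e'e.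
  have gap : F z < u j z by rewrite lt_neqAle eq_sym ne Fz.
  pose e1 := (u j z - F z) / (`|s k - s j| + 1).
  have n1 : 0 < `|s k - s j| + 1 by have := normr_ge0 (s k - s j); lra.
  have e10 : 0 < e1 by apply: divr_gt0 => //; rewrite subr_gt0.
  exists (Num.min e e1); first by rewrite lt_min e0.
  move=> e' e'0; rewrite le_min => /andP[e'e e'e1] y yb ye.
  have uE : u j y = u j z + s j * d z y by apply: ge => //; exact: lt_le_trans ye e'e.
  split=> //; right; rewrite uE.
  have : d z y < e1 by exact: lt_le_trans ye e'e1.
  rewrite ltr_pdivlMr// => h; have := ler_norm (s k - s j); have := d_ge0 z y.
  by nra.
exists (Num.min e rho); first by rewrite lt_min e0.
move=> y yb; rewrite lt_min => /andP[ye yr].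
have [uk _] := eP k kI y yb ye.
have [Fy [j jI Fj]] := Fmin y yr.
have [uj [jz|jgt]] := eP j jI y yb ye.
  have jA : j \in A by rewrite mem_filter jz eqxx.
  have := kmin j jA; have := Fy k kI; rewrite Fj uj uk jz kz.
  by have := d_ge0 z y; move=> *; apply/eqP; rewrite eq_le; nra.
by have := Fy k kI; rewrite Fj uk kz; lra.
Qed.

(** Near z the geodesic to w follows the geodesic to a, or leaves it at z. *)
Lemma germ_dist a z w : z <> w -> d z w < i0 -> d z a < i0 ->
  germ (d a) z w 1 \/ germ (d a) z w (- 1).
Proof.
move=> zw zwi zai; have [c [zcw zca wca]] := median H zwi zai.
have zw0 := d_gt0 zw.
have [E|/eqP zc] := eqVneq z c; [left|right].
  exists 1 => // y yb _; rewrite -E in wca; move: yb wca; rewrite /btw => yb wca.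
  have := dtri z a y; have := dtri y w a.
  by have := dC w z; have := dC a y; have := dC y w; have := dC z a; lra.
exists (d z c); first exact: d_gt0.
move=> y yb yc.
have := seg_sub H zwi yb zcw (ltW yc) => -[ycE _].
move: zca; rewrite /btw => zca.
by have := dtri c a y; have := dtri y a z; have := dC a c; have := dC c y;
  have := dC y z; have := dC z a; lra.
Qed.

(** Close to z, moving towards w approaches a and recedes from b, so that the
way from b to a passes through z. *)
Lemma germ_opp_btw a b z w : z <> w -> d z w < i0 -> 4 * d z a < i0 -> 4 * d z b < i0 ->
  germ (d a) z w (- 1) -> germ (d b) z w 1 -> btw a z b.
Proof.
move=> zw zwi zai zbi [e e0 ge] [e' e'0 ge'].
have zw0 := d_gt0 zw; have I0 := i0_gt0 H.
pose t := Num.min (Num.min (d z w) (i0 / 4)) (Num.min e e' / 2).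
have m0 : 0 < Num.min e e' by rewrite lt_min e0.
have me : Num.min e e' <= e by rewrite ge_min lexx.
have me' : Num.min e e' <= e' by rewrite ge_min lexx orbT.
have t0 : 0 < t by rewrite !lt_min zw0/=; apply/andP; split; lra.
have tw : t <= d z w by rewrite !ge_min lexx.
have ti : t <= i0 / 4 by rewrite !ge_min lexx orbT.
have te : t <= Num.min e e' / 2 by rewrite !ge_min lexx !orbT.
have [y [y1 y2]] := @seg_point _ _ _ _ _ _ H z w t zwi ltac:(lra).
have yb : btw z y w by rewrite /btw; lra.
have ya := ge y yb ltac:(lra); have yb' := ge' y yb ltac:(lra).
have zC := dC z y; have aC := dC a y; have bC := dC b y.
have azC := dC a z; have bzC := dC b z.
have bz : btw y z b by rewrite /btw; lra.
have yb0 : d y b < i0 by lra.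
have ya0 : d y a < i0 by lra.
case: (side H yb0 ya0 bz) => //; rewrite /btw => h.
by lra.
Qed.

End germs.

(** * Interpolation of values on a net *)

Section interpolant.
Context {R : realType} {X : pointedMetricType R} (iota : X -> R) (V : set X).
Variables (nu : {measure set (skel_type iota V) -> \bar R}) (i0 : R).
Local Notation d := (@mdist R X).
Hypothesis H : length_tree nu i0.
Implicit Types (u v w x y z : X) (i j k : nat).

Variables (a : nat -> X) (K : pred nat) (delta : R).
Hypotheses (delta_gt0 : 0 < delta) (delta_small : 20 * delta < i0).
Hypothesis cover : forall x, exists2 k, K k & d (a k) x < 2 * delta.
Hypothesis finite : forall x, exists n, forall k, K k -> d (a k) x < 5 * delta ->
  (k < n)%N.
Variables (val Lam : nat -> R) (Lmax : R).
Hypothesis Lam_ge0 : forall k, 0 <= Lam k.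
Hypothesis Lam_le : forall k, K k -> Lam k <= Lmax.
Hypothesis val_Lam : forall k j, K k -> K j -> d (a j) (a k) < 7 * delta ->
  val j - val k <= delta * Lam k.

Lemma close_list z (rho : R) : rho <= 5 * delta ->
  exists I : seq nat, forall k, (k \in I) = K k && (d (a k) z < rho).
Proof.
move=> r5; have [n nP] := finite z.
exists [seq k <- seq.iota 0 n | K k && (d (a k) z < rho)] => k.
rewrite mem_filter mem_iota add0n /= andbC.
case: (boolP (K k && _)) => [/andP[Kk kz]|]; last by rewrite andbF.
by rewrite andbT; apply: nP => //; exact: lt_le_trans r5.
Qed.

Definition net_dist y : R := inf [set d (a k) y | k in [set k | K k]].

Lemma net_dist_le k y : K k -> net_dist y <= d (a k) y.
Proof.
move=> Kk; apply: ge_inf; last by exists k.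
by exists 0 => _ [j _ <-]; exact: d_ge0.
Qed.

Lemma net_dist_attained y : exists2 k, K k & net_dist y = d (a k) y.
Proof.
have [I IP] := @close_list y (2 * delta) ltac:(have := delta_gt0; lra).
have [k0 Kk0 k0y] := cover y.
have k0I : k0 \in I by rewrite IP Kk0.
have [|k kI kmin] := @seq_argmin _ I (fun k => d (a k) y).
  by apply/eqP => E; rewrite E in k0I.
move: (kI); rewrite IP => /andP[Kk ky]; exists k => //.
apply: inf_min; first by exists k.
move=> _ [j Kj <-]; have [jI|] := boolP (j \in I); first exact: kmin.
by rewrite IP Kj /= -leNgt; apply: le_trans; exact: ltW.
Qed.

Lemma net_dist_lt y : net_dist y < 2 * delta.
Proof. by have [k Kk ky] := cover y; apply: le_lt_trans ky; exact: net_dist_le. Qed.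

Lemma net_dist_lip y y' : net_dist y' <= net_dist y + d y y'.
Proof.
have [k Kk ->] := net_dist_attained y.
by apply: (le_trans (net_dist_le _ Kk)); exact: dtri.
Qed.

(** The value at the k-th vertex with a penalty that vanishes where this vertex
is a nearest one. *)
Definition cone k y : R := val k + Lam k * (d (a k) y - net_dist y).

(** Near every point this is a minimum of finitely many cones. The vertices
within 2 delta are nearest candidates, those within 4 delta are the ones that
matter on a ball of radius delta, and 5 delta makes them all available there. *)
Definition interp y : R :=
  inf [set cone k y | k in [set k | K k /\ d (a k) y < 5 * delta]].

Lemma net_dist_min z (I : seq nat) : (forall k, (k \in I) = K k && (d (a k) z < 4 * delta)) ->
  forall y, d z y < delta -> (forall k, k \in I -> net_dist y <= d (a k) y) /\
    exists2 k, k \in I & net_dist y = d (a k) y.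
Proof.
move=> IP y zy; split; first by move=> k; rewrite IP => /andP[Kk _]; exact: net_dist_le.
have [k Kk E] := net_dist_attained y; exists k => //; rewrite IP Kk /=.
have := net_dist_lt y; have := dtri y (a k) z; have := dC y z.
by have := delta_gt0; lra.
Qed.

(** The cones with vertices far from z do not matter close to z: there they
exceed the value at the nearest net point. *)
Lemma interp_min z (I : seq nat) : (forall k, (k \in I) = K k && (d (a k) z < 4 * delta)) ->
  forall y, d z y < delta -> (forall k, k \in I -> interp y <= cone k y) /\
    exists2 k, k \in I & interp y = cone k y.
Proof.
move=> IP y zy; have [_ [j jI jE]] := net_dist_min IP zy.
have d0 := delta_gt0.
have [k kI kmin] : exists2 k, k \in I & forall i, i \in I -> cone k y <= cone i y.
  by apply: seq_argmin; apply/eqP => E; rewrite E in jI.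
suff E : interp y = cone k y by rewrite E; split=> //; exists k.
have near5 i : i \in I -> K i /\ d (a i) y < 5 * delta.
  by rewrite IP => /andP[Ki iz]; split=> //; have := dtri z (a i) y; lra.
apply: inf_min; first by exists k => //; exact: near5.
move=> _ [i [Ki iy] <-]; have [iI|] := boolP (i \in I); first exact: kmin.
rewrite IP Ki /= -leNgt => iz; apply: (le_trans (kmin j jI)).
have [Kj _] := near5 _ jI.
have ji : d (a j) (a i) < 7 * delta.
  by have := dtri y (a j) (a i); have := net_dist_lt y; have := dC y (a i); lra.
have := val_Lam Ki Kj ji; have := Lam_ge0 i.
have : delta <= d (a i) y - net_dist y.
  by have := net_dist_lt y; have := dtri y (a i) z; have := dC y z; lra.
have -> : cone j y = val j by rewrite /cone jE subrr mulr0 addr0.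
rewrite /cone => h1 h2 h3.
have : Lam i * delta <= Lam i * (d (a i) y - net_dist y) by rewrite ler_wpM2l.
by lra.
Qed.

Lemma interp_between y : exists k j, [/\ K k /\ d (a k) y < 4 * delta,
  K j /\ d (a j) y < 4 * delta, val k <= interp y & interp y <= val j].
Proof.
have [I IP] := @close_list y (4 * delta) ltac:(have := delta_gt0; lra).
have yy : d y y < delta by rewrite dxx.
have [_ [j jI jE]] := net_dist_min IP yy.
have [le [k kI kE]] := interp_min IP yy.
move: (kI) (jI); rewrite !IP => /andP[Kk ky] /andP[Kj jy].
exists k, j; split=> //.
  rewrite kE /cone lerDl mulr_ge0// subr_ge0; exact: net_dist_le.
by have := le j jI; rewrite /cone jE subrr mulr0 addr0.
Qed.

Lemma interp_lip y y' : d y y' < delta ->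
  `|interp y - interp y'| <= 2 * Lmax * d y y'.
Proof.
have one y1 y2 : d y1 y2 < delta -> interp y2 <= interp y1 + 2 * Lmax * d y1 y2.
  move=> yy; have d0 := delta_gt0.
  have [I IP] := @close_list y1 (4 * delta) ltac:(lra).
  have [_ [k kI ->]] := interp_min IP (y := y1) ltac:(rewrite dxx; lra).
  have [le _] := interp_min IP yy; apply: (le_trans (le k kI)).
  move: kI; rewrite IP => /andP[Kk _].
  have := Lam_le Kk; have := Lam_ge0 k; have := dtri y1 (a k) y2.
  have := net_dist_lip y2 y1; have := d_ge0 y1 y2; rewrite (dC y2 y1) /cone => h1 h2 h3 h4 h5.
  have : Lam k * (d (a k) y2 - net_dist y2) <=
      Lam k * ((d (a k) y1 - net_dist y1) + 2 * d y1 y2).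
    by apply: ler_wpM2l => //; lra.
  have : Lam k * d y1 y2 <= Lmax * d y1 y2 by apply: ler_wpM2r.
  rewrite mulrDr; lra.
move=> yy; have := one _ _ yy; have := one y' y; rewrite (dC y' y) => /(_ yy).
by rewrite ler_norml => *; apply/andP; split; lra.
Qed.

(** Distances to the vertices have slope 1 or -1. A cone therefore has slope
zero where its vertex and the nearest net point lie on the same side; if they
lie on opposite sides, z is between them. Hence the interpolant only varies on
the segments between close net points. *)
Lemma interp_germ z w : z <> w -> d z w < i0 ->
  exists s, germ interp z w s /\
    exists k j, [/\ K k /\ d (a k) z < 4 * delta, K j /\ d (a j) z < 4 * delta,
      `|s| <= 2 * Lam k & s != 0 -> btw (a k) z (a j)].
Proof.
move=> zw zwi; have d0 := delta_gt0; have ds := delta_small.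
have [I IP] := @close_list z (4 * delta) ltac:(lra).
have : forall k, exists s, k \in I -> germ (d (a k)) z w s /\ (s = 1 \/ s = - 1).
  move=> k; have [kI|] := boolP (k \in I); last by exists 0.
  move: kI; rewrite IP => /andP[Kk kz].
  have kzi : d z (a k) < i0 by rewrite dC; lra.
  have [h|h] := germ_dist H zw zwi kzi.
  - by exists 1 => _; split; [|left].
  - by exists (- 1) => _; split; [|right].
move=> /choice[sg sgP].
have [j jI Dj] : exists2 j, j \in I & germ net_dist z w (sg j).
  apply: (@germ_min _ _ z w delta I (fun k => d (a k)) sg) => //.
    by move=> y zy; exact: net_dist_min.
  by move=> k kI; have [] := sgP k kI.
have [k kI Fk] : exists2 k, k \in I & germ interp z w (Lam k * (sg k - sg j)).
  apply: (@germ_min _ _ z w delta I cone (fun k => Lam k * (sg k - sg j))) => //.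
    by move=> y zy; exact: interp_min.
  move=> k kI; have [[e e0 ge] _] := sgP k kI; case: Dj => e' e'0 ge'.
  exists (Num.min e e'); first by rewrite lt_min e0.
  move=> y yb; rewrite lt_min => /andP[ye ye'].
  by rewrite /cone (ge y yb ye) (ge' y yb ye'); ring.
exists (Lam k * (sg k - sg j)); split=> //; exists k, j.
have [gk sk] := sgP k kI; have [gj sj] := sgP j jI.
move: (kI) (jI); rewrite !IP => /andP[Kk kz] /andP[Kj jz].
have ki : 4 * d z (a k) < i0 by rewrite dC; lra.
have ji : 4 * d z (a j) < i0 by rewrite dC; lra.
split=> //.
  rewrite normrM (ger0_norm (Lam_ge0 k)) mulrC ler_wpM2r//.
  by case: sk => ->; case: sj => ->; rewrite ler_norml; apply/andP; split; lra.
case: sk gk => ->; case: sj gj => -> gj gk; rewrite ?subrr ?mulr0 ?eqxx// => _.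
  by apply: btwC; exact: (germ_opp_btw H zw zwi ji ki).
exact: (germ_opp_btw H zw zwi ki ji).
Qed.

Lemma Lmax_ge0 : 0 <= Lmax.
Proof.
have [k Kk _] := cover point.
by apply: le_trans (Lam_ge0 k) (Lam_le Kk).
Qed.

Lemma interp_AC : Defs.AC nu interp.
Proof.
have L0 : 0 <= 2 * Lmax by have := Lmax_ge0; lra.
split; first exact: (lip_continuous L0 delta_gt0 interp_lip).
move=> x; have germs z w : z <> w -> d z w < i0 -> exists s, germ interp z w s.
  by move=> zw zwi; have [s [gs _]] := interp_germ zw zwi; exists s.
by have [g gP _] := gradient_of_slopes H L0 delta_gt0 interp_lip germs x; exists g.
Qed.

Lemma interp_gradient : \forall z \ae nu, skeleton iota z ->
  exists k j, [/\ K k /\ d (a k) z < 4 * delta, K j /\ d (a j) z < 4 * delta,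
    `|abs_gradient nu interp z| <= 2 * Lam k &
    abs_gradient nu interp z != 0 -> btw (a k) z (a j)].
Proof.
have [e [Ve eV]] := V_enum H.
pose P z := exists k j, [/\ K k /\ d (a k) z < 4 * delta, K j /\ d (a j) z < 4 * delta,
    `|abs_gradient nu interp z| <= 2 * Lam k &
    abs_gradient nu interp z != 0 -> btw (a k) z (a j)].
have [hm hP] := AC_abs_gradient H interp_AC.
have L0 : 0 <= 2 * Lmax by have := Lmax_ge0; lra.
have germs z w : z <> w -> d z w < i0 -> exists s, germ interp z w s.
  by move=> zw zwi; have [s [gs _]] := interp_germ zw zwi; exists s.
have loc n : \forall z \ae nu, (skeleton iota `&` ball (e n) (iota (e n))) z -> P z.
  have [g gP gg] := gradient_of_slopes H L0 delta_gt0 interp_lip germs (e n).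
  have null : \forall z \ae nu, z <> e n.
    have Se : skeleton iota (e n) by apply: (lt_sub H).
    exists [set e n]; split; [exact: (measurable_pt H Se)|exact: (nu_pt H Se)|].
    by move=> z /= /contrapT.
  apply: aeS2 (hP _ _ gP) null => z zh ze /= [Sz Bz].
  have [w [zw zwi gz]] := gg z Bz ze.
  have [s [gs [k [j [h1 h2 h3 h4]]]]] := interp_germ zw zwi.
  have E := germ_uniq H zw zwi gz gs.
  have hE : abs_gradient nu interp z = `|s| by rewrite -E normrN (zh (conj Sz Bz)).
  exists k, j; split=> //; rewrite hE ?normr_id// normr_eq0; exact: h4.
have all_n : \forall z \ae nu, forall n, (skeleton iota `&` ball (e n) (iota (e n))) z -> P z by apply/ae_foralln.
apply: aeS all_n => z h Sz.
have [b Vb zb] := V_near H z (i0_gt0 H); have [n En] := eV b Vb.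
apply: (h n); split=> //; rewrite En; apply/in_ball.
by have := lt_iota H b; rewrite dC; lra.
Qed.

End interpolant.

(** * Means and oscillations on balls *)

Section mean_values.
Context {R : realType} {X : pointedMetricType R}.
Variable m : {measure set (borel X) -> \bar R}.
Variables (dh p r0 c C : R).
Local Notation d := (@mdist R X).
Hypotheses (c_gt0 : 0 < c) (C_gt0 : 0 < C).
Hypothesis volume : forall (x : X) (r : R), 0 < r < r0 ->
  ((c * r `^ dh)%:E <= m (ball x r) <= (C * r `^ dh)%:E)%E.
Hypothesis p_ge1 : 1 <= p.
Let p_gt0 : 0 < p. Proof. by move: p_ge1; lra. Qed.
Let p_ge0 : 0 <= p. Proof. exact: ltW. Qed.

Lemma ball_volume (x : X) r : 0 < r -> r < r0 -> exists2 M : R, 0 < M &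
  m (ball x r) = M%:E /\ c * r `^ dh <= M <= C * r `^ dh.
Proof.
move=> rp rr0; have /andP[v1 v2] := @volume x r ltac:(lra).
have E : m (ball x r) = (fine (m (ball x r)))%:E.
  by rewrite fineK// ge0_fin_numE//; apply: le_lt_trans v2 (ltry _).
exists (fine (m (ball x r))); last by split=> //; rewrite -!lee_fin -E v1.
rewrite -lte_fin -E; apply: lt_le_trans v1.
by rewrite lte_fin mulr_gt0// powR_gt0.
Qed.

Variable f : X -> R.
Hypothesis mf : measurable_fun setT (f : borel X -> R).
Hypothesis fp : (\int[m]_x (`|f x| `^ p)%:E < +oo)%E.

Definition mean s x : R := (fine (m (ball x s)))^-1 * \int[m]_(y in ball x s) f y.

Definition mean_oscillation r x : R := fine ((m (ball x r))^-1 *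
  \int[m]_(y in ball x r) (`|f y - f x| `^ p / r `^ (p * 0))%:E)%E.

Let mfp a : measurable_fun setT (fun y : borel X => (`|f y - a| `^ p)%:E).
Proof.
apply/measurable_EFinP/(measurableT_comp (measurable_powR p)).
by apply: measurableT_comp => //; exact: measurable_funB.
Qed.

Lemma diff_powR_ball_fin x r a : 0 < r -> r < r0 ->
  (\int[m]_(y in ball x r) (`|f y - a| `^ p)%:E < +oo)%E.
Proof.
move=> rp rr0; have [M M0 [ME _]] := ball_volume x rp rr0.
have mb := measurable_ball x r.
have c0 : 0 <= 2 `^ p :> R by exact: powR_ge0.
apply: (@le_lt_trans _ _ (\int[m]_(y in ball x r)
    ((2 `^ p)%:E * (`|f y| `^ p)%:E + (2 `^ p * `|a| `^ p)%:E))%E).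
  apply: le_integral_nonmeas => y _; first by rewrite lee_fin powR_ge0.
  rewrite -EFinM -EFinD lee_fin -mulrDr.
  apply: le_trans (powR_add_le p_ge0 (normr_ge0 _) (normr_ge0 _)).
  by apply: ge0_ler_powR; rewrite ?nnegrE ?addr_ge0// ler_normB.
have mfa : measurable_fun (ball x r : set (borel X)) (fun y => (`|f y| `^ p)%:E).
  by apply: measurable_funTS; have := mfp 0; under eq_fun do rewrite subr0.
have pw0 y : (0 <= (`|f y| `^ p)%:E)%E by rewrite lee_fin powR_ge0.
have cpw0 y : (0 <= (2 `^ p)%:E * (`|f y| `^ p)%:E)%E by exact: mule_ge0.
have ca0 : (0 <= (2 `^ p * `|a| `^ p)%:E)%E by rewrite lee_fin mulr_ge0// powR_ge0.
rewrite ge0_integralD//; last exact: measurable_funeM.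
rewrite ge0_integralZl//.
apply: lte_add_pinfty.
  apply: lte_mul_pinfty; rewrite ?lee_fin//; apply: le_lt_trans fp.
  apply: ge0_subset_integral => //.
  by have := mfp 0; under eq_fun do rewrite subr0.
by rewrite integral_cst// [X in (_ * X)%E]ME -EFinM ltry.
Qed.

Lemma mean_oscillationE r x : 0 < r -> r < r0 -> ((m (ball x r))^-1 *
  \int[m]_(y in ball x r) (`|f y - f x| `^ p / r `^ (p * 0))%:E)%E = (mean_oscillation r x)%:E.
Proof.
move=> rp rr0; have [M M0 [ME _]] := ball_volume x rp rr0.
rewrite /mean_oscillation fineK// ME inver gt_eqF//.
under eq_integral do rewrite mulr0 powRr0 divr1.
by rewrite fin_numM// ge0_fin_numE ?diff_powR_ball_fin// integral_ge0// => y _;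
  rewrite lee_fin powR_ge0.
Qed.

Lemma mean_oscillation_ge0 r x : 0 <= mean_oscillation r x.
Proof.
apply: fine_ge0; apply: mule_ge0; first by rewrite inve_ge0.
by apply: integral_ge0 => y _; rewrite lee_fin divr_ge0// powR_ge0.
Qed.

Lemma KS_energy_osc r : 0 < r -> r < r0 ->
  KS_energy m p 0 f r = (\int[m]_x (mean_oscillation r x)%:E)%E.
Proof. by move=> rp rr0; apply: eq_integral => x _; exact: mean_oscillationE. Qed.

Lemma ball_integrable x s : 0 < s -> s < r0 ->
  m.-integrable (ball x s) (EFin \o f).
Proof.
move=> sp sr0; have [M M0 [ME _]] := ball_volume x sp sr0.
have mb := measurable_ball x s.
apply/integrableP; split; first by apply/measurable_EFinP; exact: measurable_funTS.
have fin := diff_powR_ball_fin x 0 sp sr0.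
apply: (@le_lt_trans _ _ (\int[m]_(y in ball x s) ((`|f y - 0| `^ p)%:E + 1%:E))%E).
  apply: le_integral_nonmeas => y _ //=; rewrite subr0 -EFinD lee_fin.
  have [h|h] := leP `|f y| 1; first by have := powR_ge0 `|f y| p; lra.
  have := ler_powR (ltW h) p_ge1; rewrite powRr1//; lra.
have pw0 y : (0 <= (`|f y - 0| `^ p)%:E)%E by rewrite lee_fin powR_ge0.
rewrite ge0_integralD//; last exact: measurable_funTS (mfp 0).
apply: lte_add_pinfty => //.
by rewrite integral_cst// [X in (_ * X)%E]ME -EFinM ltry.
Qed.

(** The ball of radius s around y lies in the ball of radius 8 s around x, whose
volume is comparable. *)
Lemma mean_osc_le x y s : 0 < s -> 8 * s < r0 -> d y x + s <= 8 * s ->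
  `|f x - mean s y| `^ p <= C / c * 8 `^ dh * mean_oscillation (8 * s) x.
Proof.
move=> sp sr yx; have s8 : 0 < 8 * s by lra.
have [M M0 [ME /andP[M1 M2]]] := ball_volume y sp ltac:(lra).
have [M' M'0 [ME' /andP[M'1 M'2]]] := ball_volume x s8 sr.
have mb := measurable_ball y s; have mb' := measurable_ball x (8 * s).
have := @mean_osc _ _ _ m (ball y s) f p M (f x) p_ge1 mb M0 ME
  (ball_integrable y sp ltac:(lra)).
rewrite /mean ME /= => h; rewrite -lee_fin; apply: (le_trans h).
have sub : (\int[m]_(z in ball y s) (`|f z - f x| `^ p)%:E <=
    \int[m]_(z in ball x (8 * s)) (`|f z - f x| `^ p)%:E)%E.
  apply: ge0_subset_integral => //.
  - exact: measurable_funTS (mfp _).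
  - move=> z /in_ball yz; apply/in_ball; have := dtri y x z; have := dC x y.
    lra.
have Mi : (0 <= M^-1%:E)%E by rewrite lee_fin invr_ge0 ltW.
apply: (le_trans (lee_wpmul2l Mi sub)).
rewrite EFinM -mean_oscillationE// ME' inver gt_eqF// muleA.
under [X in (_ <= _ * X)%E]eq_integral do rewrite mulr0 powRr0 divr1.
apply: lee_wpmul2r; first by apply: integral_ge0 => z _; rewrite lee_fin powR_ge0.
rewrite -EFinM lee_fin ler_pdivlMr// mulrC ler_pdivrMr//.
apply: (le_trans M'2); rewrite powRM ?(ltW sp)//.
have -> : C / c * 8 `^ dh * M = (C * 8 `^ dh / c) * M by ring.
have -> : C * (8 `^ dh * s `^ dh) = (C * 8 `^ dh / c) * (c * s `^ dh).
  by field; rewrite gt_eqF.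
apply: ler_wpM2l => //.
by rewrite divr_ge0 ?mulr_ge0 ?powR_ge0// ltW.
Qed.

Lemma mean_bounded y s : 0 < s -> s < r0 ->
  `|mean s y| `^ p <= (c * s `^ dh)^-1 * fine (\int[m]_x (`|f x| `^ p)%:E).
Proof.
move=> sp sr.
have [M M0 [ME /andP[M1 M2]]] := ball_volume y sp sr.
have mb := measurable_ball y s.
have := @mean_osc _ _ _ m (ball y s) f p M 0 p_ge1 mb M0 ME
  (ball_integrable y sp sr).
rewrite /mean ME /= sub0r normrN => h; rewrite -lee_fin; apply: (le_trans h).
under eq_integral do rewrite subr0.
have I0 : (0 <= \int[m]_x (`|f x| `^ p)%:E)%E.
  by apply: integral_ge0 => z _; rewrite lee_fin powR_ge0.
rewrite EFinM fineK ?ge0_fin_numE//.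
have cs : 0 < c * s `^ dh by rewrite mulr_gt0 ?powR_gt0.
apply: lee_pmul.
- by rewrite lee_fin invr_ge0 ltW.
- by apply: integral_ge0 => z _; rewrite lee_fin powR_ge0.
- by rewrite lee_fin lef_pV2.
- apply: ge0_subset_integral => //.
  by have := mfp 0; under eq_fun do rewrite subr0.
Qed.

End mean_values.

(** * The interpolant of the means of a function *)

Section covering.
Context {dd} {T : measurableType dd} {R : realType}.
Variable mu : {measure set T -> \bar R}.
Implicit Types (D : set T) (A Y : nat -> set T).

Lemma integral_le_covering D Y (G : nat -> R) (h : T -> R) :
  measurable D -> (forall k, measurable (Y k)) -> (forall k, 0 <= G k) ->
  measurable_fun D h -> (forall z, 0 <= h z) ->
  (\forall z \ae mu, D z -> h z = 0 \/ exists2 k, Y k z & h z <= G k) ->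
  (\int[mu]_(z in D) (h z)%:E <= \sum_(k <oo) (G k)%:E * mu (Y k))%E.
Proof.
move=> mD mY G0 mh h0 hG.
have ind0 k z : (0 <= (G k)%:E * (\1_(Y k) z)%:E)%E.
  by rewrite mule_ge0 ?lee_fin// indicE.
have mind k : measurable_fun D (fun z => (\1_(Y k) z : R)%:E).
  by apply/measurable_EFinP; exact: measurable_funTS.
have mGind k : measurable_fun D (fun z => (G k)%:E * (\1_(Y k) z)%:E)%E.
  exact: measurable_funeM.
apply: (@le_trans _ _ (\int[mu]_(z in D) \sum_(k <oo) (G k)%:E * (\1_(Y k) z)%:E)%E).
  apply: ae_ge0_le_integral => //.
  - by move=> z _; rewrite lee_fin.
  - exact/measurable_EFinP.
  - by move=> z _; apply: nneseries_ge0.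
  - by apply: ge0_emeasurable_sum => //.
  - apply: aeS hG => z hz /hz[->|[k Ykz hk]]; first exact: nneseries_ge0.
    apply: le_trans (nneseries_ge_term k _) => //.
    by rewrite indicE mem_set// mule1 lee_fin.
rewrite integral_nneseries//; apply: lee_nneseries => k _.
  by move=> _; apply: integral_ge0.
rewrite ge0_integralZl//; last by rewrite lee_fin.
rewrite integral_indic//; apply: lee_wpmul2l; first by rewrite lee_fin.
by apply: le_measure; rewrite ?inE//; exact: measurableI.
Qed.

Lemma measure_bigcup_count A (P : pred nat) (N b : R) : 0 <= b ->
  (forall j, measurable (A j)) -> (forall j, ~~ P j -> A j = set0) ->
  (forall j, P j -> mu (A j) <= b%:E)%E ->
  (forall n, (count P (seq.iota 0 n))%:R <= N) ->
  (mu (\bigcup_j A j) <= (N * b)%:E)%E.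
Proof.
move=> b0 mA A0 Ab cnt.
apply: (le_trans (measure_sigma_subadditive mu mA (bigcupT_measurable A mA)
  (@subset_refl _ _))).
apply: lime_le; first exact: is_cvg_nneseries.
apply: nearW => n.
apply: (@le_trans _ _ ((count P (seq.iota 0 n))%:R * b)%:E); last first.
  by rewrite lee_fin ler_wpM2r.
rewrite /index_iota subn0; elim: (seq.iota 0 n) => [|j s IH].
  by rewrite big_nil /= mul0r.
rewrite big_cons /= natrD mulrDl EFinD; apply: leeD => //.
have [Pj|nPj] := boolP (P j); first by rewrite mul1r; exact: Ab.
by rewrite A0// measure0 mul0r.
Qed.

End covering.

Lemma le_powR_root {R : realType} (p t Q : R) : 0 < p -> 0 <= t ->
  t `^ p <= Q -> t <= Q `^ p^-1.
Proof.
move=> p0 t0 tQ; have Q0 : 0 <= Q by apply: le_trans tQ; exact: powR_ge0.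
have -> : t = (t `^ p) `^ p^-1 by rewrite -powRrM mulfV ?gt_eqF// powRr1.
by apply: ge0_ler_powR; rewrite ?nnegrE ?powR_ge0// invr_ge0 ltW.
Qed.

Section interpolant_of_means.
Context {R : realType} {X : pointedMetricType R} (iota : X -> R) (V : set X).
Variables (nu : {measure set (skel_type iota V) -> \bar R}) (i0 : R).
Variable m : {measure set (borel X) -> \bar R}.
Variables (dh p r0 c C : R).
Local Notation d := (@mdist R X).
Local Notation S := (skeleton iota).
Local Notation M A := (measurable (A : set (skel_type iota V))).
Hypothesis H : length_tree nu i0.
Hypotheses (c_gt0 : 0 < c) (C_gt0 : 0 < C).
Hypothesis volume : forall (x : X) (r : R), 0 < r < r0 ->
  ((c * r `^ dh)%:E <= m (ball x r) <= (C * r `^ dh)%:E)%E.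
Hypothesis p_ge1 : 1 <= p.
Let p_gt0 : 0 < p. Proof. by move: p_ge1; lra. Qed.
Let p_ge0 : 0 <= p. Proof. exact: ltW. Qed.
Let C1 : R := C / c * 8 `^ dh.
Let C1_gt0 : 0 < C1.
Proof. by apply: mulr_gt0; [exact: divr_gt0|exact: powR_gt0]. Qed.

Section one_function.
Variables (a : nat -> X) (f : X -> R) (delta : R).
Hypothesis Va : forall n, V (a n).
Hypothesis a_dense : forall x e, 0 < e -> exists n, d (a n) x < e.
Hypothesis mf : measurable_fun setT (f : borel X -> R).
Hypothesis fp : (\int[m]_x (`|f x| `^ p)%:E < +oo)%E.
Hypotheses (delta_gt0 : 0 < delta) (delta_r0 : 16 * delta < r0).
Hypothesis delta_i0 : 20 * delta < i0.

Let K := net a delta.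
Let osc := mean_oscillation m p f (16 * delta).
Let val k := mean m f (2 * delta) (a k).
Let steps k := [set `|val j - val k| | j in
  [set j | K j /\ d (a j) (a k) < 7 * delta]].
(** The slope of the k-th cone: the largest difference quotient of the means
that can be seen from the vertex. *)
Let Lam k := delta^-1 * sup (steps k).

Let val_osc k w : d (a k) w < 14 * delta -> `|f w - val k| <= (C1 * osc w) `^ p^-1.
Proof.
move=> kw; apply: le_powR_root => //.
have e : 16 * delta = 8 * (2 * delta) by ring.
rewrite /osc e; apply: (mean_osc_le c_gt0 C_gt0 volume) => //.
- exact: mulr_gt0.
- by rewrite -e.
- lra.
Qed.

Let steps_osc k w : d (a k) w < 7 * delta ->
  ubound (steps k) (2 * (C1 * osc w) `^ p^-1).
Proof.
move=> kw _ [j [Kj jk] <-]; have d0 := delta_gt0.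
have := @val_osc k w ltac:(lra).
have := @val_osc j w ltac:(have := dtri (a k) (a j) w; lra).
have := ler_distD (f w) (val j) (val k); rewrite (distrC (val j) (f w)); lra.
Qed.

Let cover x : exists2 k, K k & d (a k) x < 2 * delta.
Proof. exact: net_cover. Qed.

Let steps0 k : steps k !=set0.
Proof.
have [j Kj jk] := cover (a k); exists `|val j - val k|, j => //; split=> //.
by have := delta_gt0; lra.
Qed.

Let steps_sup k : has_sup (steps k).
Proof.
split=> //; exists (2 * (C1 * osc (a k)) `^ p^-1); apply: steps_osc.
by rewrite dxx mulr_gt0.
Qed.

Let Lam_ge0 k : 0 <= Lam k.
Proof.
apply: mulr_ge0; first by rewrite invr_ge0 ltW.
have [t kt] := steps0 k; apply: le_trans (ub_le_sup (proj2 (steps_sup k)) kt).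
by case: kt => j _ <-.
Qed.

Let val_Lam k j : K k -> K j -> d (a j) (a k) < 7 * delta ->
  val j - val k <= delta * Lam k.
Proof.
move=> Kk Kj jk; rewrite /Lam mulrA mulfV ?gt_eqF// mul1r.
apply: (le_trans (ler_norm _)); apply: ub_le_sup (proj2 (steps_sup k)) _ _.
by exists j.
Qed.

Let Lam_osc k w : d (a k) w < 7 * delta ->
  (delta / 2 * Lam k) `^ p <= C1 * osc w.
Proof.
move=> kw; have h : sup (steps k) <= 2 * (C1 * osc w) `^ p^-1.
  by apply: ge_sup => //; exact: steps_osc.
have L0 := Lam_ge0 k; have d0 := delta_gt0.
have o0 : 0 <= C1 * osc w by apply: mulr_ge0; [exact: ltW|exact: mean_oscillation_ge0].
have -> : C1 * osc w = ((C1 * osc w) `^ p^-1) `^ p.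
  by rewrite -powRrM mulVf ?gt_eqF// powRr1.
have di0 : 0 <= delta / 2 by rewrite divr_ge0// ltW.
have Lk0 : 0 <= delta / 2 * Lam k by exact: mulr_ge0.
apply: ge0_ler_powR; rewrite ?nnegrE ?powR_ge0//.
have -> : delta / 2 * Lam k = sup (steps k) / 2.
  by rewrite /Lam; field; rewrite gt_eqF.
by rewrite ler_pdivrMr// mulrC.
Qed.

Let Lmax := delta^-1 * (2 *
  ((c * (2 * delta) `^ dh)^-1 * fine (\int[m]_x (`|f x| `^ p)%:E)) `^ p^-1).

Let Lam_le k : K k -> Lam k <= Lmax.
Proof.
move=> _; have d0 := delta_gt0; have dr := delta_r0.
apply: ler_wpM2l; first by rewrite invr_ge0 ltW.
have bd j : `|val j| <=
    ((c * (2 * delta) `^ dh)^-1 * fine (\int[m]_x (`|f x| `^ p)%:E)) `^ p^-1.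
  apply: le_powR_root => //.
  by apply: (mean_bounded c_gt0 volume p_ge1 mf fp); [exact: mulr_gt0|lra].
apply: ge_sup => // _ [j _ <-].
by have := ler_normB (val j) (val k); have := bd j; have := bd k; lra.
Qed.

Let finite x : exists n, forall k, K k -> d (a k) x < 5 * delta -> (k < n)%N.
Proof.
have dr := delta_r0; have d0 := delta_gt0.
by apply: (net_finite a c_gt0 volume) => //; lra.
Qed.

Let f1 := interp a K delta val Lam.

Let f1_AC : Defs.AC nu f1.
Proof. exact: (interp_AC H delta_gt0 delta_i0 cover finite Lam_ge0 Lam_le val_Lam). Qed.

Let f1_close y : `|f y - f1 y| `^ p <= C1 * osc y.
Proof.
have o0 : 0 <= C1 * osc y by apply: mulr_ge0; [exact: ltW|exact: mean_oscillation_ge0].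
have -> : C1 * osc y = ((C1 * osc y) `^ p^-1) `^ p.
  by rewrite -powRrM mulVf ?gt_eqF// powRr1.
apply: ge0_ler_powR; rewrite ?nnegrE ?powR_ge0//.
have [k [j [[Kk ky] [Kj jy] h1 h2]]] :=
  interp_between delta_gt0 cover finite Lam_ge0 val_Lam y.
have := @val_osc k y ltac:(have := delta_gt0; lra).
have := @val_osc j y ltac:(have := delta_gt0; lra).
rewrite !ler_norml -/f1 => /andP[? ?] /andP[? ?]; apply/andP.
by move: h1 h2; rewrite -/f1; split; lra.
Qed.

Let Y k : set X := \bigcup_j (if K j && (d (a j) (a k) < 8 * delta)
  then seg (a k) (a j) else set0).

Let M_step k j : M (if K j && (d (a j) (a k) < 8 * delta)
  then seg (a k) (a j) else set0).
Proof.
case: ifP => [/andP[_ jk]|_]; last exact: measurable0.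
by apply: (measurable_seg H); rewrite dC; have := delta_gt0; have := delta_i0; lra.
Qed.

Let nuY k : (nu (Y k) <= (overlap dh c C 8 * (8 * delta))%:E)%E.
Proof.
have dr := delta_r0; have d0 := delta_gt0; have di := delta_i0.
apply: (measure_bigcup_count (P := fun j => K j && (d (a j) (a k) < 8 * delta))).
- exact: mulr_ge0 (ltW _).
- exact: M_step.
- by move=> j /negbTE ->.
- move=> j Pj; rewrite Pj; case/andP: Pj => _ jk.
  by rewrite (nu_seg H) ?lee_fin dC ?ltW//; lra.
- by move=> n; apply: (net_count a c_gt0 volume) => //; lra.
Qed.

Let G k : R := if K k then (2 * Lam k) `^ p else 0.

Let grad_le : (\int[nu]_(z in S) (`|abs_gradient nu f1 z| `^ p)%:E <=
  \sum_(k <oo) (G k)%:E * nu (Y k))%E.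
Proof.
have [hm _] := AC_abs_gradient H f1_AC.
apply: integral_le_covering.
- exact: (measurable_S H).
- by move=> k; apply: bigcupT_measurable => j; exact: M_step.
- by move=> k; rewrite /G; case: ifP => // _; exact: powR_ge0.
- by apply: (measurableT_comp (measurable_powR p)); exact: measurableT_comp.
- by move=> z; exact: powR_ge0.
have null : \forall z \ae nu, forall n, z <> a n.
  apply/ae_foralln => n; have Sa : S (a n) by apply: (lt_sub H).
  exists [set a n]; split; [exact: (measurable_pt H Sa)|exact: (nu_pt H Sa)|].
  by move=> z /= /contrapT.
apply: aeS2 (interp_gradient H delta_gt0 delta_i0 cover finite Lam_ge0 Lam_le val_Lam)
  null => z + za Sz => /(_ Sz)[k [j [[Kk kz] [Kj jz] le zb]]]; rewrite -/f1 in le zb.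
have [->|h0] := eqVneq (abs_gradient nu f1 z) 0.
  by left; rewrite normr0 powR0// gt_eqF.
right; exists k.
  exists j => //; rewrite Kj ifT; last first.
    by have := dtri z (a j) (a k); have := dC z (a k); lra.
  by split; [exact: zb|exact: za|exact: za].
rewrite /G Kk; apply: ge0_ler_powR; rewrite ?nnegrE//.
by apply: mulr_ge0.
Qed.

Let q k : R := if K k then (delta / 2 * Lam k) `^ p / C1 else 0.

Let q_sum : (\sum_(k <oo) (q k)%:E * (c * (delta / 2) `^ dh)%:E <=
  KS_energy m p 0 f (16 * delta))%E.
Proof.
have dr := delta_r0; have d0 := delta_gt0.
have q0 k : 0 <= q k.
  by rewrite /q; case: ifP => // _; rewrite divr_ge0 ?powR_ge0// ltW.
pose b k : set X := if K k then ball (a k) (delta / 2) else set0.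
rewrite (KS_energy_osc c_gt0 volume p_ge1 mf fp); [|lra|lra].
apply: (@le_trans _ _ (\sum_(k <oo) (q k)%:E * m (b k))%E).
  apply: lee_nneseries => k _.
    move=> _; rewrite mule_ge0 ?lee_fin// mulr_ge0 ?powR_ge0//; exact: ltW.
  rewrite /q /b; case: ifP => _; last by rewrite !mul0e.
  apply: lee_wpmul2l; first by rewrite lee_fin divr_ge0 ?powR_ge0// ltW.
  by have /andP[] := @volume (a k) (delta / 2) ltac:(lra).
apply: patches_le_integral => //.
- by move=> k; rewrite /b; case: ifP => _; [exact: measurable_ball|exact: measurable0].
- apply/trivIsetP => i j _ _ ij; apply/seteqP; split => // x; rewrite /b.
  case: ifP => [Ki|_ []//]; case: ifP => [Kj|_ []//].
  move=> [/in_ball xi /in_ball xj]; have := net_sep Ki Kj ij.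
  by have := dtri x (a i) (a j); rewrite (dC x (a j)) leNgt => ? /negP; apply; lra.
- by move=> x; rewrite lee_fin mean_oscillation_ge0.
- move=> k x; rewrite /b /q; case: ifP => // _ /in_ball kx.
  by rewrite lee_fin ler_pdivrMr// [leRHS]mulrC; apply: Lam_osc; lra.
Qed.

(** The slope Lam k is controlled by the oscillation of f at every point of the
ball of radius delta / 2 around the k-th vertex. These balls are disjoint, and
to each vertex belong boundedly many segments of length at most 8 delta on
which the gradient can differ from zero, so the p-th powers of the slopes sum
up to the energy. *)
Lemma interpolant_of_means : exists f1, [/\ Defs.AC nu f1,
  (forall y, `|f y - f1 y| `^ p <= C1 * mean_oscillation m p f (16 * delta) y) &
  ((c * (delta / 2) `^ dh)%:E *
     \int[nu]_(z in S) (`|abs_gradient nu f1 z| `^ p)%:E <=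
   (C1 * (4 / delta) `^ p * (overlap dh c C 8 * (8 * delta)))%:E *
     KS_energy m p 0 f (16 * delta))%E].
Proof.
have d0 := delta_gt0.
exists f1; split; [exact: f1_AC|exact: f1_close|].
have cd0 : 0 <= c * (delta / 2) `^ dh by rewrite mulr_ge0 ?powR_ge0// ltW.
set cd := c * _ in cd0 *; set N := overlap _ _ _ _ * _.
have N0 : 0 <= N by rewrite mulr_ge0 ?overlap_ge0// mulr_ge0// ltW.
have q0 k : 0 <= q k.
  by rewrite /q; case: ifP => // _; rewrite divr_ge0 ?powR_ge0// ltW.
have C1_ge0 := ltW C1_gt0.
have A0 : 0 <= C1 * (4 / delta) `^ p * N.
  by apply: mulr_ge0 => //; apply: mulr_ge0 => //; exact: powR_ge0.
have cdE : (0 <= cd%:E)%E by rewrite lee_fin.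
apply: (le_trans (lee_wpmul2l cdE grad_le)).
have AE : (0 <= (C1 * (4 / delta) `^ p * N)%:E)%E by rewrite lee_fin.
apply: le_trans (lee_wpmul2l AE q_sum).
rewrite -!nneseriesZl; last 2 first.
- by move=> k _; rewrite mule_ge0 ?lee_fin.
- move=> k _; rewrite mule_ge0// lee_fin /G; case: ifP => // _; exact: powR_ge0.
apply: lee_nneseries => k _.
  move=> _; rewrite !mule_ge0// lee_fin /G; case: ifP => // _; exact: powR_ge0.
have GE : G k = C1 * (4 / delta) `^ p * q k.
  rewrite /G /q; case: ifP => _; last by rewrite mulr0.
  have -> : 2 * Lam k = (4 / delta) * (delta / 2 * Lam k) by field; rewrite gt_eqF.
  rewrite [LHS]powRM; last 2 first.
  - by rewrite divr_ge0// ltW.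
  - by apply: mulr_ge0 (Lam_ge0 k); rewrite divr_ge0// ltW.
  by field; rewrite gt_eqF.
apply: (@le_trans _ _ (cd%:E * ((G k)%:E * N%:E))%E).
  apply: lee_wpmul2l => //; apply: lee_wpmul2l; last exact: nuY.
  rewrite lee_fin GE; apply: mulr_ge0 => //.
  by apply: mulr_ge0 => //; exact: powR_ge0.
rewrite -!EFinM lee_fin GE le_eqVlt; apply/orP; left; apply/eqP.
by rewrite -/cd; ring.
Qed.

End one_function.
End interpolant_of_means.

(** * Lebesgue and energy spaces *)

Section lebesgue_spaces.
Context {R : realType} {X : pointedMetricType R}.
Variable m : {measure set (borel X) -> \bar R}.
Variable p : R.
Hypothesis p_ge1 : 1 <= p.
Let p_gt0 : 0 < p. Proof. by move: p_ge1; lra. Qed.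
Implicit Types f g : X -> R.

Lemma Lp_normE f : Lp_norm m p f = ((\int[m]_x (`|f x| `^ p)%:E) `^ p^-1)%E.
Proof. by rewrite /Lp_norm unlock. Qed.

Lemma LpP f : Lp m p f <-> measurable_fun setT (f : borel X -> R) /\
  (\int[m]_x (`|f x| `^ p)%:E < +oo)%E.
Proof.
split=> [/andP[mf nf]|[mf nf]].
  split; first by rewrite inE in mf.
  move: nf; rewrite inE /= /finite_norm -/(Lp_norm m p f) Lp_normE.
  by apply: lty_poweRy; rewrite invr_neq0// gt_eqF.
apply/andP; split; first by rewrite inE.
by rewrite inE /= /finite_norm -/(Lp_norm m p f) Lp_normE poweR_lty.
Qed.

Lemma LpD f g : Lp m p f -> Lp m p g -> Lp m p (f \+ g).
Proof. by move=> ff gg; apply: (proj2 (@Lfun_addr_closed _ _ _ m p%:E _)). Qed.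

Lemma LpN f : Lp m p f -> Lp m p (\- f).
Proof. by move=> ff; apply: (@Lfun_oppr_closed _ _ _ m p%:E). Qed.

Lemma Lp_normD f g : Lp m p f -> Lp m p g ->
  (Lp_norm m p (fun x => f x + g x)%R <= Lp_norm m p f + Lp_norm m p g)%E.
Proof. by move=> /LpP[mf _] /LpP[mg _]; exact: (@eminkowski _ _ _ m f g p%:E). Qed.

Lemma Lp_norm_ae f g : measurable_fun setT (f : borel X -> R) ->
  measurable_fun setT (g : borel X -> R) -> f = g %[ae m] ->
  (\int[m]_x (`|f x| `^ p)%:E = \int[m]_x (`|g x| `^ p)%:E)%E.
Proof.
have mpow h : measurable_fun setT (h : borel X -> R) ->
    measurable_fun setT (fun x : borel X => (`|h x| `^ p)%:E).
  move=> mh; apply/measurable_EFinP/(measurableT_comp (measurable_powR p)).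
  exact: measurableT_comp.
move=> mf mg fg; apply: ae_eq_integral => //; [exact: mpow|exact: mpow|].
by apply: aeS fg => x /= fgx _; rewrite fgx.
Qed.

(** The set where f and g differ is open, hence empty or of positive mass. *)
Lemma continuous_ae_eq f g : full_support m -> continuous f -> continuous g ->
  f = g %[ae m] -> f = g.
Proof.
move=> supp cf cg [N [mN N0 fgN]]; apply/funext => x; apply: contrapT => ne.
pose U := [set y | f y - g y != 0].
have Uo : open U.
  apply: (@open_comp _ _ (fun y => f y - g y) [set t | t != 0]).
    by move=> y _; apply: cvgB; [exact: cf|exact: cg].
  exact: open_neq.
have : (0 < m U)%E by apply: supp => //; exists x; rewrite /U /= subr_eq0; exact/eqP.
rewrite ltNge => /negP; apply; rewrite -N0.
apply: le_measure; rewrite ?inE//; first exact: sub_sigma_algebra.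
move=> y /= /eqP Uy; apply: fgN => /= /(_ I) E; apply: Uy.
by rewrite E subrr.
Qed.

Lemma continuous_borel f : continuous f -> measurable_fun setT (f : borel X -> R).
Proof.
move=> cf _; apply: (measurability _ (RGenOpens.measurableE R)) => //.
move=> _ [_ [a [b ->]] <-]; rewrite setTI.
apply: sub_sigma_algebra; apply: open_comp; last exact: interval_open.
by move=> y _; exact: cf.
Qed.

End lebesgue_spaces.

Section energy_spaces.
Context {R : realType} {X : pointedMetricType R} (iota : X -> R) (V : set X).
Variables (nu : {measure set (skel_type iota V) -> \bar R}).
Variable m : {measure set (borel X) -> \bar R}.
Local Notation S := (skeleton iota).
Hypothesis m_support : full_support m.
Implicit Types (f g : X -> R) (p : R).

Lemma sobolev_gradient_version p f ft : is_ACp_version nu m p f ft ->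
  sobolev_gradient nu m p f = abs_gradient nu ft.
Proof.
move=> fft; rewrite /sobolev_gradient; congr abs_gradient.
case: xgetP => [gt _ [[[cg _] _] gf]|/(_ ft)//].
have [[[cf _] _] ftf] := fft.
apply: (continuous_ae_eq m_support cg cf).
by apply: aeS2 gf ftf => x /= h1 h2 _; rewrite h1// h2.
Qed.

Lemma W1p_version p f : W1p nu m p f -> exists2 ft, is_ACp_version nu m p f ft &
  sobolev_gradient nu m p f = abs_gradient nu ft.
Proof. by move=> [_ [ft h]]; exists ft => //; exact: sobolev_gradient_version. Qed.

Lemma W1p_AC p f : Lp m p f -> ACp nu p f -> W1p nu m p f /\
  sobolev_gradient nu m p f = abs_gradient nu f.
Proof.
move=> Lf Af; have v : is_ACp_version nu m p f f by split=> //; exact: aeW.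
by split; [split=> //; exists f|exact: sobolev_gradient_version].
Qed.

Lemma BV_le_sobolev f : W1p nu m 1 f ->
  (BV_seminorm nu m f <= sobolev_seminorm nu m 1 f)%E.
Proof.
move=> Wf; apply: ereal_inf_lbound; exists (fun _ => f).
  split=> //=; have -> : Lp_norm m 1 (fun x => f x - f x) = 0%E.
    rewrite Lp_normE integral0_eq ?poweR0r ?invr1 ?oner_eq0//.
    by move=> x _; rewrite subrr normr0 powR0// oner_eq0.
  exact: cvg_cst.
rewrite is_cvg_limn_einfE; last exact: is_cvg_cst.
rewrite lim_cst// /sobolev_seminorm invr1 poweRe1; last first.
  by apply: integral_ge0 => x _; rewrite lee_fin powR_ge0.
by apply: eq_integral => z _; rewrite powRr1.
Qed.

Lemma W1p_energy p f : 1 <= p -> W1p nu m p f -> energy_space nu m p f /\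
  (energy_seminorm nu m p f <= sobolev_seminorm nu m p f)%E.
Proof.
move=> p1 Wf; rewrite /energy_space /energy_seminorm; case: eqP => [E|]; last by [].
rewrite E in Wf *; have le := BV_le_sobolev Wf; split=> //; split; first exact: proj1 Wf.
apply: (le_lt_trans le); have [ft [[_ fin] _] E'] := W1p_version Wf.
by rewrite /sobolev_seminorm E'; exact: poweR_lty.
Qed.

Lemma energy_space_Lp p f : energy_space nu m p f -> Lp m p f.
Proof. by rewrite /energy_space; case: eqP => [->|_] []. Qed.

Lemma energy_seminorm_fin p f : energy_space nu m p f ->
  (energy_seminorm nu m p f < +oo)%E.
Proof.
rewrite /energy_space /energy_seminorm; case: eqP => [_ []//|_ Wf].
have [ft [[_ fin] _] E'] := W1p_version Wf.
by rewrite /sobolev_seminorm E'; exact: poweR_lty.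
Qed.

Lemma energy_seminorm_ge0 p f : (0 <= energy_seminorm nu m p f)%E.
Proof.
rewrite /energy_seminorm; case: eqP => [_|_]; last exact: poweR_ge0.
apply: le_ereal_inf_tmp => _ [f_ _ <-]; rewrite limn_einf_lim.
apply: lime_ge; first exact: is_cvg_einfs.
apply: nearW => n; apply: le_ereal_inf_tmp => _ [k _ <-].
by apply: integral_ge0 => z _; rewrite lee_fin.
Qed.

(** Elements of the energy space are approximated by Sobolev functions, almost
without increasing the seminorm; this is the definition of BV when p = 1. *)
Lemma energy_approx p f (e : R) : 1 <= p -> energy_space nu m p f -> 0 < e ->
  exists g, [/\ W1p nu m p g, (Lp_norm m p (fun x => g x - f x)%R <= e%:E)%E &
    (sobolev_seminorm nu m p g <= energy_seminorm nu m p f + e%:E)%E].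
Proof.
move=> p1 + e0; have en0 := energy_seminorm_ge0 p f; move: en0.
rewrite /energy_space /energy_seminorm; case: eqP => [->|_] en0; last first.
  move=> Wf; exists f; split=> //; last by rewrite leeDl// lee_fin ltW.
  have p0 : p != 0 by rewrite gt_eqF//; lra.
  rewrite Lp_normE integral0_eq; first by rewrite poweR0r ?invr_neq0// lee_fin ltW.
  by move=> x _; rewrite subrr normr0 powR0.
move=> [Lf BVf].
have BVfin : BV_seminorm nu m f \is a fin_num by rewrite ge0_fin_numE.
have [_ [f_ [Wf_ cf_] <-]] := lb_ereal_inf_adherent e0 BVfin.
rewrite -/(BV_seminorm nu m f); set u := (fun n => _) => lt_u.
have [N _ hN] : \forall n \near \oo, (Lp_norm m 1 (fun x => f_ n x - f x)%R < e%:E)%E.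
  have nb : nbhs (0%E : \bar R) [set y | (y < e%:E)%E].
    by apply: open_nbhs_nbhs; split; [exact: open_ereal_lt_ereal|rewrite /= lte_fin].
  exact: (cf_ _ nb).
have [n Nn un] : exists2 n, (N <= n)%N & (u n < BV_seminorm nu m f + e%:E)%E.
  have : (einfs u N < BV_seminorm nu m f + e%:E)%E.
    apply: le_lt_trans lt_u; rewrite limn_einf_lim.
    rewrite (cvg_lim (@ereal_hausdorff R) (@cvg_einfs_sup R u)).
    by apply: ereal_sup_ubound; exists N.
  by move=> /ereal_inf_lt[_ [n Nn <-] h]; exists n.
exists (f_ n); split=> //; first by apply/ltW/hN.
apply: ltW; apply: le_lt_trans un.
rewrite /sobolev_seminorm invr1 poweRe1; last first.
  by apply: integral_ge0 => x _; rewrite lee_fin powR_ge0.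
by under eq_integral do rewrite powRr1//.
Qed.

End energy_spaces.

(** * The K-functional at small scales *)

Section K_functional_bounds.
Context {R : realType} {X : pointedMetricType R} (iota : X -> R) (V : set X).
Variables (nu : {measure set (skel_type iota V) -> \bar R}) (i0 : R).
Variable m : {measure set (borel X) -> \bar R}.
Variables (dh p r0 c C : R).
Local Notation d := (@mdist R X).
Local Notation S := (skeleton iota).
Hypothesis H : length_tree nu i0.
Hypotheses (c_gt0 : 0 < c) (C_gt0 : 0 < C).
Hypothesis volume : forall (x : X) (r : R), 0 < r < r0 ->
  ((c * r `^ dh)%:E <= m (ball x r) <= (C * r `^ dh)%:E)%E.
Hypothesis p_ge1 : 1 <= p.
Hypothesis m_support : full_support m.
Let p_gt0 : 0 < p. Proof. by move: p_ge1; lra. Qed.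
Let p_ge0 : 0 <= p. Proof. exact: ltW. Qed.
Let p_neq0 : p != 0. Proof. by rewrite gt_eqF. Qed.

Local Notation alpha := (1 + (dh - 1) / p).

Lemma powR_alpha (r : R) : (r `^ alpha) `^ p = r `^ (p + dh - 1).
Proof. by rewrite -powRrM; congr (_ `^ _); field. Qed.

(** The difference between g and its continuous version is moved to f0. *)
Lemma sobolev_lower : exists2 C1 : R, 0 < C1 & forall (f f0 g : X -> R) (r : R),
  0 < r -> 8 * r < r0 -> 8 * r < i0 -> Lp m p f0 -> W1p nu m p g ->
  (forall x, f x = f0 x + g x) ->
  (KS_energy m p 0 f r `^ p^-1 <=
   C1%:E * (Lp_norm m p f0 + (r `^ alpha)%:E * sobolev_seminorm nu m p g))%E.
Proof.
have [C0 C00 KS] := KS_energy_le H c_gt0 C_gt0 volume p_ge1.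
exists ((C0 * 2) `^ p^-1); first by rewrite powR_gt0// mulr_gt0.
move=> f f0 g r rp rr0 ri0 Lf0 Wg fE.
have [ft [[ftAC _] ftg] sgE] := W1p_version m_support Wg.
have [mf0 _] := (LpP m p_ge1 _).1 Lf0.
have [mg _] := (LpP m p_ge1 _).1 (proj1 Wg).
have mft := continuous_borel (proj1 ftAC).
pose f0' x := f0 x + g x - ft x.
have mf0' : measurable_fun setT (f0' : borel X -> R).
  by apply: measurable_funB => //; exact: measurable_funD.
have f0E : f0' = f0 %[ae m].
  by apply: aeS ftg => x /= h _; rewrite /f0' h// addrK.
have fE' x : f x = f0' x + ft x by rewrite /f0' subrK.
have := KS _ _ _ _ mf0' mft ftAC fE' rp rr0 ri0.
rewrite (Lp_norm_ae p mf0' mf0 f0E) Lp_normE /sobolev_seminorm sgE.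
set I0 := (\int[m]_x _)%E; set J := (\int[nu]_(z in S) _)%E => le.
have I00 : (0 <= I0)%E by apply: integral_ge0 => x _; rewrite lee_fin powR_ge0.
have J0 : (0 <= J)%E by apply: integral_ge0 => x _; rewrite lee_fin powR_ge0.
have root (I : \bar R) : (0 <= I)%E -> I = ((I `^ p^-1) `^ p)%E.
  by move=> I1; rewrite -poweRrM mulVf// poweRe1.
set t := r `^ alpha; have t0 : (0 <= t%:E)%E by rewrite lee_fin powR_ge0.
set N0 := (I0 `^ p^-1)%E; set B := (J `^ p^-1)%E.
have N00 : (0 <= N0)%E by exact: poweR_ge0.
have B0 : (0 <= t%:E * B)%E by apply: mule_ge0 => //; exact: poweR_ge0.
have Z0 : (0 <= N0 + t%:E * B)%E by exact: adde_ge0.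
have le2 : (KS_energy m p 0 f r <= (C0 * 2)%:E * (N0 + t%:E * B) `^ p)%E.
  apply: (le_trans le); rewrite EFinM -muleA.
  apply: lee_wpmul2l; first by rewrite lee_fin ltW.
  have -> : (2%:E * (N0 + t%:E * B) `^ p =
      (N0 + t%:E * B) `^ p + (N0 + t%:E * B) `^ p)%E.
    by rewrite -mule2n mule_natl.
  apply: leeD.
    by rewrite (root I0 I00); apply: le_poweR => //; rewrite leeDl.
  rewrite (root J J0) -powR_alpha -/t -poweR_EFin -poweRM//; last exact: poweR_ge0.
  by apply: le_poweR => //; rewrite leeDr.
apply: (le_trans (le_poweR _ _ le2)).
- by rewrite invr_ge0.
- apply: integral_ge0 => x _; apply: mule_ge0; first by rewrite inve_ge0.
  by apply: integral_ge0 => y _; rewrite lee_fin divr_ge0// powR_ge0.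
rewrite poweRM ?poweR_ge0//; last by rewrite lee_fin mulr_ge0// ltW.
by rewrite poweR_EFin -poweRrM mulfV// poweRe1.
Qed.

Lemma energy_lower : exists2 C1 : R, 0 < C1 & forall (f f0 f1 : X -> R) (r : R),
  0 < r -> 8 * r < r0 -> 8 * r < i0 -> Lp m p f0 -> energy_space nu m p f1 ->
  f = f0 \+ f1 ->
  (KS_energy m p 0 f r `^ p^-1 <=
   C1%:E * (Lp_norm m p f0 + (r `^ alpha)%:E * energy_seminorm nu m p f1))%E.
Proof.
have [C1 C10 low] := sobolev_lower; exists C1 => // f f0 f1 r rp rr0 ri0 Lf0 Ef1 fE.
apply/lee_addgt0Pr => e e0.
set t := r `^ alpha; have t0 : 0 <= t by exact: powR_ge0.
have Ct : 0 < C1 * (1 + t) by apply: mulr_gt0 => //; lra.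
(* the approximation errors enter with the factor C1 * (1 + t) *)
pose e1 := e / (C1 * (1 + t)).
have e10 : 0 < e1 by exact: divr_gt0.
have [g [Wg gf sg]] := energy_approx p_ge1 Ef1 e10.
have Lf1 := energy_space_Lp Ef1; have Lg := proj1 Wg.
have Lgf : Lp m p (fun x => g x - f1 x) := LpD p_ge1 Lg (LpN Lf1).
have Lh : Lp m p (fun x => f0 x + - (g x - f1 x)) := LpD p_ge1 Lf0 (LpN Lgf).
have fE' x : f x = (f0 x + - (g x - f1 x)) + g x by rewrite fE /=; ring.
apply: (le_trans (low _ _ _ _ rp rr0 ri0 Lh Wg fE')); rewrite -/t.
have nh : (Lp_norm m p (fun x => f0 x + - (g x - f1 x))%R <=
    Lp_norm m p f0 + e1%:E)%E.
  apply: (le_trans (Lp_normD p_ge1 Lf0 (LpN Lgf))); apply: leeD => //.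
  apply: le_trans gf; rewrite !Lp_normE.
  by under eq_integral do rewrite normrN.
have tE : (0 <= t%:E)%E by rewrite lee_fin.
apply: (@le_trans _ _ (C1%:E * ((Lp_norm m p f0 + e1%:E) +
    t%:E * (energy_seminorm nu m p f1 + e1%:E)))%E).
  apply: lee_wpmul2l; first by rewrite lee_fin ltW.
  by apply: leeD => //; exact: lee_wpmul2l.
have s0 := energy_seminorm_ge0 nu m p f1.
have n0 : (0 <= Lp_norm m p f0)%E by rewrite Lp_normE poweR_ge0.
have sfin : energy_seminorm nu m p f1 \is a fin_num.
  by rewrite ge0_fin_numE//; exact: (energy_seminorm_fin m_support Ef1).
have nfin : Lp_norm m p f0 \is a fin_num.
  rewrite ge0_fin_numE// Lp_normE; apply: poweR_lty.
  by have [] := (LpP m p_ge1 _).1 Lf0.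
rewrite -(fineK sfin) -(fineK nfin) -!(EFinD, EFinM) lee_fin le_eqVlt.
apply/orP; left; apply/eqP; rewrite /e1; field.
have := C10; have := t0; move=> h1 h2; rewrite !gt_eqF//; lra.
Qed.

(** The interpolant of the means at scale delta = r / 16, whose oscillations live
on balls of radius exactly r. *)
Lemma energy_upper : exists2 C2 : R, 0 < C2 & forall (f : X -> R) (r : R),
  0 < r -> r < r0 -> 2 * r < i0 -> Lp m p f -> (KS_energy m p 0 f r < +oo)%E ->
  exists f0 f1, [/\ Lp m p f0, energy_space nu m p f1, f = f0 \+ f1 &
  (Lp_norm m p f0 + (r `^ alpha)%:E * energy_seminorm nu m p f1 <=
   C2%:E * KS_energy m p 0 f r `^ p^-1)%E].
Proof.
have [a [Va a_dense]] := V_dense_seq H.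
set C1 := C / c * 8 `^ dh.
have C10 : 0 < C1 by rewrite mulr_gt0 ?powR_gt0 ?divr_gt0.
set N := overlap dh c C 8.
have N0 : 0 <= N by exact: overlap_ge0.
(* the constant of [interpolant_of_means] times r^(p + dh - 1) is independent
of r *)
pose Q := C1 * (N / 2) * 64 `^ p * 32 `^ dh / c.
have Q0 : 0 <= Q.
  apply: divr_ge0 (ltW c_gt0); apply: mulr_ge0 (powR_ge0 _ _).
  apply: mulr_ge0 (powR_ge0 _ _); apply: mulr_ge0 (ltW C10) _.
  exact: divr_ge0.
exists (C1 `^ p^-1 + Q `^ p^-1).
  by rewrite ltr_wpDr ?powR_ge0// powR_gt0.
move=> f r rp rr0 ri0 Lf Efin; have [mf fp] := (LpP m p_ge1 _).1 Lf.
have d0 : 0 < r / 16 by lra.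
have dr : 16 * (r / 16) < r0 by lra.
have di : 20 * (r / 16) < i0 by lra.
have E16 : 16 * (r / 16) = r by field.
have [f1 [f1AC close grad]] := interpolant_of_means H c_gt0 C_gt0 volume p_ge1
  Va a_dense mf fp d0 dr di.
rewrite E16 -/C1 -/N in close grad.
set E := KS_energy m p 0 f r in Efin grad *.
set J := (\int[nu]_(z in S) _)%E in grad.
have J0 : (0 <= J)%E by apply: integral_ge0 => x _; rewrite lee_fin powR_ge0.
have E0 : (0 <= E)%E.
  apply: integral_ge0 => x _; apply: mule_ge0; first by rewrite inve_ge0.
  by apply: integral_ge0 => y _; rewrite lee_fin divr_ge0// powR_ge0.
have mf1 := continuous_borel (proj1 f1AC).
pose f0 x := f x - f1 x.
have f0E : (\int[m]_x (`|f0 x| `^ p)%:E <= C1%:E * E)%E.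
  rewrite /E (KS_energy_osc c_gt0 volume p_ge1 mf fp rp rr0).
  rewrite -integral_scale_nonmeas//; last by move=> x; rewrite lee_fin mean_oscillation_ge0.
  apply: le_integral_nonmeas => x _; first by rewrite lee_fin powR_ge0.
  by rewrite -EFinM lee_fin; exact: close.
have C1E : (C1%:E * E < +oo)%E by apply: lte_mul_pinfty; rewrite ?lee_fin// ltW.
have Lf0 : Lp m p f0.
  apply/(LpP m p_ge1); split; first exact: measurable_funB.
  exact: le_lt_trans f0E C1E.
have tJ : ((r `^ alpha `^ p)%:E * J <= Q%:E * E)%E.
  have cd0 : 0 < c * (r / 16 / 2) `^ dh by rewrite mulr_gt0 ?powR_gt0//; lra.
  have w0 : 0 <= r `^ (p + dh - 1) / (c * (r / 16 / 2) `^ dh).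
    by rewrite divr_ge0 ?powR_ge0// ltW.
  rewrite -lee_fin in w0; have := lee_wpmul2l w0 grad.
  rewrite !muleA -!EFinM divfK ?gt_eqF// powR_alpha => h; apply: (le_trans h).
  apply: lee_wpmul2r => //; rewrite lee_fin.
  have e1 : (4 / (r / 16)) `^ p * r `^ p = 64 `^ p.
    rewrite -powRM; [congr (_ `^ _); field; rewrite gt_eqF//| |].
    - by rewrite !divr_ge0// ltW.
    - exact: ltW.
  have e2 : (r / 16 / 2) `^ dh * 32 `^ dh = r `^ dh.
    rewrite -powRM//; first by congr (_ `^ _); field.
    by rewrite !divr_ge0// ltW.
  have e3 : r `^ (p + dh - 1) * r = r `^ p * r `^ dh.
    rewrite -{2}(powRr1 (ltW rp)) -!powRD ?(gt_eqF rp) ?implybT//.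
    by congr (_ `^ _); ring.
  have w1 : 0 < (r / 16 / 2) `^ dh by rewrite powR_gt0//; lra.
  rewrite le_eqVlt; apply/orP; left; apply/eqP; rewrite /Q.
  set u := (4 / (r / 16)) `^ p in e1 *; set w := (r / 16 / 2) `^ dh in e2 w1 *.
  set v := r `^ (p + dh - 1) in e3 *; rewrite -e1.
  have -> : v / (c * w) * (C1 * u * (N * (8 * (r / 16)))) =
      C1 * (N / 2) * u * (v * r) / (c * w) by field; rewrite !gt_eqF.
  by rewrite e3 -e2; field; rewrite !gt_eqF.
have QE : (Q%:E * E < +oo)%E by apply: lte_mul_pinfty; rewrite ?lee_fin.
have t0 : 0 < r `^ alpha by exact: powR_gt0.
have Jfin : (J < +oo)%E.
  rewrite -(@lte_pmul2l _ ((r `^ alpha) `^ p)%:E)// ?lte_fin ?powR_gt0//.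
  by rewrite gt0_muley ?lte_fin ?powR_gt0//; exact: le_lt_trans tJ QE.
have Lf1 : Lp m p f1.
  have -> : f1 = (fun x => f x + - f0 x).
    by apply/funext => x; rewrite /f0; ring.
  exact: (LpD p_ge1 Lf (LpN Lf0)).
have [Wf1 sg] := W1p_AC m_support Lf1 (conj f1AC Jfin).
have [Ef1 le1] := W1p_energy m_support p_ge1 Wf1.
exists f0, f1; split=> //; first by apply/funext => x; rewrite /f0 /= subrK.
have pi0 : 0 <= p^-1 by rewrite invr_ge0.
have EFp0 : (0 <= E `^ p^-1)%E by exact: poweR_ge0.
rewrite EFinD ge0_muleDl ?lee_fin ?powR_ge0//; apply: leeD.
  rewrite Lp_normE -poweR_EFin -poweRM//; last by rewrite lee_fin ltW.
  apply: le_poweR => //.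
  by apply: integral_ge0 => x _; rewrite lee_fin powR_ge0.
have tE : (0 <= (r `^ alpha)%:E)%E by rewrite lee_fin ltW.
apply: (le_trans (lee_wpmul2l tE le1)).
rewrite /sobolev_seminorm sg -/J -(poweR_EFin Q) -poweRM ?lee_fin//.
have -> : ((r `^ alpha)%:E = ((r `^ alpha) `^ p)%:E `^ p^-1)%E.
  by rewrite poweR_EFin -powRrM mulfV// powRr1// ltW.
rewrite -poweRM//; last by rewrite lee_fin powR_ge0.
by apply: le_poweR => //; apply: mule_ge0 => //; rewrite lee_fin powR_ge0.
Qed.

End K_functional_bounds.

Lemma lty_pmul {R : realType} (k : R) (x : \bar R) : 0 < k ->
  (k%:E * x < +oo)%E -> (x < +oo)%E.
Proof.
move=> k0; rewrite -[X in (_ < X)%E -> _](@gt0_muley _ k%:E) ?lte_fin//.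
by rewrite lte_pmul2l ?lte_fin.
Qed.

(** * Dependence of the energy on the exponent and the scale *)

Section energy_scaling.
Context {R : realType} {X : pointedMetricType R}.
Variable m : {measure set (borel X) -> \bar R}.
Implicit Types (f : X -> R) (p r : R).

Lemma KS_energy_ge0 p alpha f r : (0 <= KS_energy m p alpha f r)%E.
Proof.
apply: integral_ge0 => x _; apply: mule_ge0; first by rewrite inve_ge0.
by apply: integral_ge0 => y _; rewrite lee_fin divr_ge0// powR_ge0.
Qed.

Let mpow p f a : measurable_fun setT (f : borel X -> R) ->
  measurable_fun setT (fun y : borel X => (`|f y - a| `^ p)%:E).
Proof.
move=> mf; apply/measurable_EFinP/(measurableT_comp (measurable_powR p)).
by apply: measurableT_comp => //; exact: measurable_funB.
Qed.

Lemma KS_energy_scale p alpha f r : measurable_fun setT (f : borel X -> R) ->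
  0 < r -> KS_energy m p alpha f r =
    ((r `^ (- (p * alpha)))%:E * KS_energy m p 0 f r)%E.
Proof.
move=> mf rp; have w0 : 0 < r `^ (- (p * alpha)) by exact: powR_gt0.
rewrite /KS_energy -integral_scale_nonmeas//; last first.
  move=> x; apply: mule_ge0; first by rewrite inve_ge0.
  by apply: integral_ge0 => y _; rewrite lee_fin divr_ge0// powR_ge0.
apply: eq_integral => x _; rewrite muleCA; congr (_ * _)%E.
under [in RHS]eq_integral do rewrite mulr0 powRr0 divr1.
rewrite -ge0_integralZl//; last first.
- by rewrite lee_fin ltW.
- exact: measurable_funTS (mpow _ _ mf).
- exact: measurable_ball.
by apply: eq_integral => y _; rewrite -EFinM powRN mulrC.
Qed.

(** At scales bounded below the balls have volumes bounded below, so that the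
norm of f and the total mass control the energy. *)
Lemma KS_energy_large p f (rho v : R) : 1 <= p -> (m setT < +oo)%E ->
  0 < v -> (forall x : X, v%:E <= m (ball x rho))%E -> Lp m p f ->
  exists2 B : R, 0 <= B & forall r, rho <= r -> (KS_energy m p 0 f r <= B%:E)%E.
Proof.
move=> p1 mX v0 mv /(LpP m p1)[mf fp].
have p0 : 0 <= p by lra.
set I := (\int[m]_x _)%E in fp.
have I0 : (0 <= I)%E by apply: integral_ge0 => x _; rewrite lee_fin powR_ge0.
have q0 : 0 <= 2 `^ p :> R by exact: powR_ge0.
have mf0 := mpow p 0 mf.
have mf1 : measurable_fun setT (fun y : borel X => (`|f y| `^ p)%:E).
  by move: mf0; under eq_fun do rewrite subr0.
have pw0 y : (0 <= (`|f y| `^ p)%:E)%E by rewrite lee_fin powR_ge0.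
pose J x := ((2 `^ p)%:E * (I + m setT * (`|f x| `^ p)%:E))%E.
have inner r x : (\int[m]_(y in ball x r) (`|f y - f x| `^ p / r `^ (p * 0))%:E <= J x)%E.
  have mb := measurable_ball x r.
  under eq_integral do rewrite mulr0 powRr0 divr1.
  apply: (@le_trans _ _ (\int[m]_y (`|f y - f x| `^ p)%:E)%E).
    by apply: ge0_subset_integral => //; exact: mpow.
  apply: (@le_trans _ _ (\int[m]_y ((2 `^ p)%:E *
      ((`|f y| `^ p)%:E + (`|f x| `^ p)%:E)))%E).
    apply: le_integral_nonmeas => y _; first by rewrite lee_fin powR_ge0.
    rewrite -EFinD -EFinM lee_fin.
    apply: le_trans (powR_add_le p0 (normr_ge0 _) (normr_ge0 _)).
    by apply: ge0_ler_powR; rewrite ?nnegrE ?addr_ge0// ler_normB.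
  rewrite ge0_integralZl//; last 2 first.
  - by apply: emeasurable_funD => //; exact: measurable_cst.
  - by move=> y _; exact: adde_ge0.
  rewrite ge0_integralD// integral_cst// [X in (_ * (_ + X))%E]muleC.
  exact: lexx.
have J0 x : (0 <= J x)%E.
  by rewrite /J mule_ge0 ?lee_fin// adde_ge0// mule_ge0.
pose B := ((v^-1)%:E * ((2 `^ p)%:E * (I * m setT + m setT * I)))%E.
have B0 : (0 <= B)%E.
  by rewrite /B !mule_ge0 ?lee_fin ?invr_ge0 ?(ltW v0)// adde_ge0// mule_ge0.
have Bfin : (B < +oo)%E.
  have IX : (I * m setT < +oo)%E.
    by apply: lte_mul_pinfty => //; rewrite ge0_fin_numE.
  rewrite /B; apply: lte_mul_pinfty; rewrite ?lee_fin ?invr_ge0 ?(ltW v0)//.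
  apply: lte_mul_pinfty; rewrite ?lee_fin//.
  by apply: lte_add_pinfty => //; rewrite muleC.
exists (fine B) => [|r rr]; first exact: fine_ge0.
rewrite fineK ?ge0_fin_numE//.
apply: (@le_trans _ _ (\int[m]_x ((v^-1)%:E * J x))%E).
  apply: le_integral_nonmeas => x _.
    apply: mule_ge0; first by rewrite inve_ge0.
    by apply: integral_ge0 => y _; rewrite lee_fin divr_ge0// powR_ge0.
  have mb := measurable_ball x r; have mb' := measurable_ball x rho.
  have vr : (v%:E <= m (ball x r))%E.
    apply: (le_trans (mv x)); apply: le_measure; rewrite ?inE//.
    by move=> y /in_ball h; apply/in_ball; exact: lt_le_trans rr.
  have E : m (ball x r) = (fine (m (ball x r)))%:E.
    rewrite fineK// ge0_fin_numE//; apply: le_lt_trans mX.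
    by apply: le_measure; rewrite ?inE.
  apply: lee_pmul => //.
  - by rewrite inve_ge0.
  - by apply: integral_ge0 => y _; rewrite lee_fin divr_ge0// powR_ge0.
  rewrite E lee_fin in vr; rewrite E inver gt_eqF ?(lt_le_trans v0 vr)//.
  by rewrite lee_fin lef_pV2// posrE (lt_le_trans v0 vr).
have mJ0 : measurable_fun setT (fun x : borel X => (m setT * (`|f x| `^ p)%:E)%E).
  exact: measurable_funeM.
have mD : measurable_fun setT (fun x : borel X => (I + m setT * (`|f x| `^ p)%:E)%E).
  by apply: emeasurable_funD => //; exact: measurable_cst.
have D0 x : (0 <= I + m setT * (`|f x| `^ p)%:E)%E by rewrite adde_ge0// mule_ge0.
rewrite ge0_integralZl//; last 2 first.
- exact: measurable_funeM.
- by rewrite lee_fin invr_ge0 ltW.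
rewrite ge0_integralZl// ge0_integralD//.
by rewrite integral_cst// ge0_integralZl.
Qed.

Lemma compact_finite_mass (rho : R) : 0 < rho -> compact [set: X] ->
  (forall x : X, m (ball x rho) < +oo)%E -> (m setT < +oo)%E.
Proof.
move=> rho0 cX bfin.
have bo (x : X) : open (ball x rho).
  rewrite openE => y /= /in_ball xy; apply/nbhs_ballP.
  exists (rho - mdist x y) => /=; first by rewrite subr_gt0.
  by move=> z /in_ball yz; apply/in_ball; have := dtri y x z; lra.
move: cX; rewrite compact_cover => /(_ X setT (fun x => ball x rho)).
case=> // [x _|D _ cov]; first by exists x => //; exact: ballxx.
apply: (@le_lt_trans _ _ (\sum_(x <- finmap.enum_fset D) m (ball (x : X) rho))%E).
  apply: (@le_trans _ _ (m (\big[setU/set0]_(x <- finmap.enum_fset D) ball (x : X) rho))).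
    apply: le_measure; rewrite ?inE//.
      by apply: bigsetU_measurable => x _; exact: measurable_ball.
    by move=> x _; have [y Dy xy] := cov x I; rewrite -bigcup_fset; exists y.
  elim: (finmap.enum_fset D) => [|x s IH]; first by rewrite !big_nil measure0.
  rewrite !big_cons.
  have mU : measurable (\big[setU/set0]_(y <- s) ball (y : X) rho : set (borel X)).
    by apply: bigsetU_measurable => y _; exact: measurable_ball.
  apply: (le_trans (measureU2 m (measurable_ball x rho) mU)).
  exact: leeD.
elim: (finmap.enum_fset D) => [|x s IH]; first by rewrite big_nil ltry.
by rewrite big_cons; exact: lte_add_pinfty.
Qed.

End energy_scaling.

(** * Besov spaces as interpolation spaces *)

Section interpolation.
Context {R : realType} {X : pointedMetricType R} (iota : X -> R) (V : set X).
Variables (nu : {measure set (skel_type iota V) -> \bar R}) (i0 : R).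
Variable m : {measure set (borel X) -> \bar R}.
Variables (dh p r0 c C : R).
Hypothesis H : length_tree nu i0.
Hypotheses (r0_gt0 : 0 < r0) (c_gt0 : 0 < c) (C_gt0 : 0 < C) (dh_ge1 : 1 <= dh).
Hypothesis volume : forall (x : X) (r : R), 0 < r < r0 ->
  ((c * r `^ dh)%:E <= m (ball x r) <= (C * r `^ dh)%:E)%E.
Hypothesis p_ge1 : 1 <= p.
Hypothesis m_support : full_support m.
Let p_gt0 : 0 < p. Proof. by move: p_ge1; lra. Qed.
Let p_neq0 : p != 0. Proof. by rewrite gt_eqF. Qed.
Let pV_ge0 : 0 <= p^-1. Proof. by rewrite invr_ge0 ltW. Qed.

Local Notation alpha_p := (1 + (dh - 1) / p).
Local Notation X0 := (Lp m p).
Local Notation X1 := (energy_space nu m p).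
Local Notation n0 := (Lp_norm m p).
Local Notation n1 := (energy_seminorm nu m p).
Local Notation K := (K_functional X0 X1 n0 n1).
Local Notation E := (KS_energy m p 0).

Let alpha_p_gt0 : 0 < alpha_p.
Proof.
have : 0 <= (dh - 1) / p by rewrite divr_ge0 ?(ltW p_gt0)// subr_ge0.
by lra.
Qed.

Lemma sum_space_Lp f : sum_space X0 X1 f -> Lp m p f.
Proof. by move=> [f0 [f1 [L0 L1 ->]]]; exact: (LpD p_ge1 L0 (energy_space_Lp L1)). Qed.

Lemma K_two_sided : exists r1 C1 C2 : R, [/\ 0 < r1 /\ r1 < r0, 0 < C1, 0 < C2,
  forall f r, 0 < r < r1 -> Lp m p f -> (E f r < +oo)%E -> sum_space X0 X1 f &
  forall f r, Lp m p f -> 0 < r < r1 ->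
  (C1%:E * E f r `^ p^-1 <= K f (r `^ alpha_p)%R <= C2%:E * E f r `^ p^-1)%E].
Proof.
have [c1 c10 low] := energy_lower H c_gt0 C_gt0 volume p_ge1 m_support.
have [c2 c20 upp] := energy_upper H c_gt0 C_gt0 volume p_ge1 m_support.
have I0 := i0_gt0 H.
pose r1 := Num.min r0 i0 / 8.
have m0 : 0 < Num.min r0 i0 by rewrite lt_min r0_gt0.
have mr : Num.min r0 i0 <= r0 by rewrite ge_min lexx.
have mi : Num.min r0 i0 <= i0 by rewrite ge_min lexx orbT.
have r1E : 8 * r1 = Num.min r0 i0 by rewrite /r1; field.
exists r1, c1^-1, c2; split; rewrite ?invr_gt0//.
- by split; lra.
- move=> f r /andP[rp rr1] Lf Ef; have R0 := r0_gt0.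
  have [f0 [f1 [L0 L1 fE _]]] := upp f r rp ltac:(lra) ltac:(lra) Lf Ef.
  by exists f0, f1.
move=> f r Lf /andP[rp rr1]; apply/andP; split.
  apply: le_ereal_inf_tmp => _ [f0 [f1 [L0 L1 fE ->]]].
  by rewrite lee_pdivrMl//; apply: low => //; lra.
have [Efin|] := ltP (E f r) +oo%E; last first.
  by rewrite leye_eq => /eqP ->; rewrite poweRyr ?invr_neq0// gt0_muley ?lte_fin// leey.
have [f0 [f1 [L0 L1 fE le]]] := upp f r rp ltac:(lra) ltac:(lra) Lf Efin.
apply: le_trans le; apply: ereal_inf_lbound.
by exists f0, f1.
Qed.

(** The trivial splitting f = f + 0. In place of 0 stands the function which
the upper bound provides for the zero function: its norm and its seminorm
vanish. *)
Lemma K_le_norm f t : Lp m p f -> (K f t <= n0 f)%E.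
Proof.
move=> Lf; have R0 := r0_gt0; have I0 := i0_gt0 H.
have [c2 c20 upp] := energy_upper H c_gt0 C_gt0 volume p_ge1 m_support.
have m0 : 0 < Num.min r0 i0 by rewrite lt_min r0_gt0.
have mr : Num.min r0 i0 <= r0 by rewrite ge_min lexx.
have mi : Num.min r0 i0 <= i0 by rewrite ge_min lexx orbT.
set r := Num.min r0 i0 / 4.
have rE : 4 * r = Num.min r0 i0 by rewrite /r; field.
have rp : 0 < r by lra.
have E0 : E (cst 0) r = 0%E.
  apply: integral0_eq => x _; rewrite integral0_eq ?mule0// => y _.
  by rewrite /= subrr normr0 powR0// mul0r.
have L0 : Lp m p (cst 0).
  apply/(LpP m p_ge1); split; first exact: measurable_cst.
  by rewrite integral0_eq// => x _; rewrite /= normr0 powR0.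
have [g0 [g1 [Lg0 Eg1 gE]]] := upp (cst 0) r rp ltac:(lra) ltac:(lra) L0
  ltac:(by rewrite E0).
rewrite E0 poweR0r ?invr_neq0// mule0 => le.
have g00 : (0 <= n0 g0)%E by rewrite Lp_normE poweR_ge0.
have g10 := energy_seminorm_ge0 nu m p g1.
have tr : 0 < r `^ alpha_p by exact: powR_gt0.
have trn : (0 <= (r `^ alpha_p)%:E * n1 g1)%E by rewrite mule_ge0// lee_fin ltW.
have ng0 : n0 g0 = 0%E.
  by apply/eqP; rewrite eq_le g00 andbT; apply: le_trans le; rewrite leeDl.
have ng1 : n1 g1 = 0%E.
  apply/eqP; rewrite eq_le g10 andbT -(@lee_pmul2l _ (r `^ alpha_p)%:E)//.
  by rewrite mule0; apply: le_trans le; rewrite leeDr.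
apply: (@le_trans _ _ (n0 (fun x => f x + g0 x)%R + t%:E * n1 g1)%E).
  apply: ereal_inf_lbound; exists (fun x => f x + g0 x), g1; split=> //.
    exact: (LpD p_ge1 Lf Lg0).
  apply/funext => x /=; rewrite -addrA.
  by have /(congr1 (fun h => h x)) /= <- := gE; rewrite addr0.
rewrite ng1 mule0 adde0; apply: (le_trans (Lp_normD p_ge1 Lf Lg0)).
by rewrite ng0 adde0.
Qed.

(** With t = r^alpha_p, the quotient K f t / t^theta is comparable with the p-th
root of the energy of exponent alpha at scale r, as long as r is small. At large
scales both sides are bounded by the norm of f, since the mass is finite. *)
Lemma besov_interpolation alpha : compact [set: X] -> 0 <= alpha ->
  besov m alpha p = interpolation_space X0 X1 n0 n1 (alpha / alpha_p).
Proof.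
move=> cX a0.
have [r1 [C1 [C2 [[r10 r1r0] C10 C20 sum Kb]]]] := K_two_sided.
pose r2 := Num.min r1 1.
have r20 : 0 < r2 by rewrite lt_min r10 ltr01.
have r21 : r2 <= r1 by rewrite ge_min lexx.
have r2le1 : r2 <= 1 by rewrite ge_min lexx orbT.
set theta := alpha / alpha_p.
have th0 : 0 <= theta by rewrite divr_ge0// ltW.
have root (I : \bar R) : (0 <= I)%E -> I = ((I `^ p^-1) `^ p)%E.
  by move=> I1; rewrite -poweRrM mulVf// poweRe1.
have E0 f r : (0 <= E f r)%E by exact: KS_energy_ge0.
have scale f r : Lp m p f -> 0 < r ->
    ((r `^ alpha_p `^ (- theta))%:E * E f r `^ p^-1 =
     KS_energy m p alpha f r `^ p^-1)%E.
  move=> /(LpP m p_ge1)[mf _] rp; rewrite (KS_energy_scale m p alpha mf rp).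
  have w0 : (0 <= (r `^ (- (p * alpha)))%:E)%E by rewrite lee_fin powR_ge0.
  rewrite (poweRM _ w0 (E0 f r)) poweR_EFin -!powRrM; congr (_%:E * _)%E; congr (_ `^ _).
  have := lt0r_neq0 alpha_p_gt0; rewrite /theta; set q := alpha_p => q0.
  by field; rewrite p_neq0.
apply/seteqP; split => f [].
- move=> Lf; set B := ereal_sup _ => Bfin.
  have Bub r : 0 < r < 1 -> (KS_energy m p alpha f r <= B)%E.
    by move=> r01; apply: ereal_sup_ubound; exists r.
  have [mf _] := (LpP m p_ge1 f).1 Lf.
  have h01 : 0 < r2 / 2 < 1 by apply/andP; split; lra.
  have B0 : (0 <= B)%E by apply: le_trans (Bub _ h01); exact: KS_energy_ge0.
  have fsum : sum_space X0 X1 f.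
    apply: (sum f (r2 / 2)) => //; first by apply/andP; split; lra.
    have := le_lt_trans (Bub _ h01) Bfin.
    rewrite (KS_energy_scale m p alpha mf) ?divr_gt0//.
    by apply: lty_pmul; rewrite powR_gt0// divr_gt0.
  split=> //.
  have [_ ffin] := (LpP m p_ge1 f).1 Lf.
  have nfin : (n0 f < +oo)%E by rewrite Lp_normE poweR_lty.
  have nf0 : (0 <= n0 f)%E by rewrite Lp_normE poweR_ge0.
  (* the bounds for t^(1/alpha_p) < r2 and for larger t *)
  set D1 := (C2%:E * B `^ p^-1)%E; set D2 := ((r2 `^ alpha_p `^ (- theta))%:E * n0 f)%E.
  have D10 : (0 <= D1)%E by rewrite mule_ge0 ?poweR_ge0// lee_fin ltW.
  have D20 : (0 <= D2)%E by rewrite mule_ge0// lee_fin powR_ge0.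
  apply: (@le_lt_trans _ _ (D1 + D2)%E); last first.
    apply: lte_add_pinfty; apply: lte_mul_pinfty; rewrite ?lee_fin ?powR_ge0 ?(ltW C20)//.
    exact: poweR_lty.
  apply: ge_ereal_sup => _ [t /= t0 <-].
  have [r rp tE] : exists2 r, 0 < r & t = r `^ alpha_p.
    exists (t `^ alpha_p^-1); first exact: powR_gt0.
    by rewrite -powRrM mulVf ?gt_eqF// powRr1// ltW.
  have tm0 : (0 <= (t `^ (- theta))%:E)%E by rewrite lee_fin powR_ge0.
  have [rr2|rr2] := ltP r r2.
    apply: (@le_trans _ _ D1); last by rewrite leeDl.
    have /andP[_ K2] := Kb f r Lf ltac:(apply/andP; split; lra).
    rewrite -tE in K2; apply: (le_trans (lee_wpmul2l tm0 K2)).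
    rewrite muleCA tE scale//; apply: lee_wpmul2l; first by rewrite lee_fin ltW.
    apply: le_poweR => //; first exact: KS_energy_ge0.
    by apply: Bub; apply/andP; split; lra.
  apply: (@le_trans _ _ D2); last by rewrite leeDr.
  apply: (le_trans (lee_wpmul2l tm0 (K_le_norm t Lf))).
  apply: lee_wpmul2r => //; rewrite lee_fin tE -!powRrM mulrN.
  have at0 : 0 <= alpha_p * theta by rewrite mulr_ge0// ltW.
  rewrite !powRN lef_pV2 ?posrE ?powR_gt0//.
  by apply: ge0_ler_powR; rewrite ?nnegrE ?(ltW rp) ?(ltW r20).
- move=> fsum; set B := ereal_sup _ => Bfin; have Lf := sum_space_Lp fsum.
  split=> //; have [mf _] := (LpP m p_ge1 f).1 Lf.
  have bfin (x : X) : (m (ball x (r1 / 2)) < +oo)%E.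
    have /andP[_ v2] := @volume x (r1 / 2) ltac:(apply/andP; split; lra).
    by apply: le_lt_trans v2 (ltry _).
  have mX : (m setT < +oo)%E by apply: (compact_finite_mass (rho := r1 / 2)) => //; lra.
  have v0 : 0 < c * (r1 / 2) `^ dh by rewrite mulr_gt0// powR_gt0//; lra.
  have mv (x : X) : ((c * (r1 / 2) `^ dh)%:E <= m (ball x (r1 / 2)))%E.
    by have /andP[] := @volume x (r1 / 2) ltac:(apply/andP; split; lra).
  have [B1 B10 large] := KS_energy_large p_ge1 mX v0 mv Lf.
  have small r : 0 < r -> r < r1 ->
      (KS_energy m p alpha f r <= (C1^-1%:E * B) `^ p)%E.
    move=> rp rr1; rewrite (root _ (KS_energy_ge0 m p alpha f r)).
    apply: le_poweR; rewrite ?poweR_ge0 ?(ltW p_gt0)//.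
    rewrite lee_pdivlMl// -scale// muleCA.
    have /andP[K1 _] := Kb f r Lf ltac:(apply/andP; split; lra).
    apply: (@le_trans _ _ ((r `^ alpha_p `^ (- theta))%:E * K f (r `^ alpha_p)%R)%E).
      by apply: lee_wpmul2l => //; rewrite lee_fin powR_ge0.
    apply: ereal_sup_ubound; exists (r `^ alpha_p) => //=; exact: powR_gt0.
  set D2 := ((r1 / 2) `^ (- (p * alpha)) * B1)%:E.
  have D20 : (0 <= D2)%E by rewrite lee_fin mulr_ge0// powR_ge0.
  apply: (@le_lt_trans _ _ ((C1^-1%:E * B) `^ p + D2)%E); last first.
    apply: lte_add_pinfty; last exact: ltry.
    apply: poweR_lty; apply: lte_mul_pinfty; rewrite ?lee_fin ?invr_ge0 ?(ltW C10)//.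
  apply: ge_ereal_sup => _ [r /= /andP[rp rr1] <-].
  have [h|h] := ltP r r1.
    by apply: (le_trans (small _ rp h)); rewrite leeDl.
  apply: (@le_trans _ _ D2); last by rewrite leeDr// poweR_ge0.
  rewrite (KS_energy_scale m p alpha mf rp) /D2 EFinM.
  have pa0 : 0 <= p * alpha by rewrite mulr_ge0// ltW.
  apply: lee_pmul => //; first by rewrite lee_fin powR_ge0.
    rewrite lee_fin !powRN lef_pV2 ?posrE ?powR_gt0//; last lra.
    by apply: ge0_ler_powR; rewrite ?nnegrE//; lra.
  by apply: large; lra.
Qed.

End interpolation.
Theorem theorem3p11 (R : realType) (X : pointedMetricType R)
  (iota : X -> R) (V : set X)
  (nu : {measure set (skel_type iota V) -> \bar R})
  (m : {measure set (borel X) -> \bar R}) (dh p : R)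
  (X_locally_compact : locally_compact [set: X])
  (X_connected : connected [set: X])
  (X_separable : separable X)
  (X_local_tree : is_local_tree iota)
  (X_uniform : is_uniform_local_tree iota)
  (V_countable : countable V)
  (V_sub : V `<=` skeleton iota)
  (V_dense : skeleton iota `<=` closure V)
  (nu_length : is_length_measure nu)
  (m_radon : is_radon m)
  (m_support : full_support m)
  (dh_ge1 : 1 <= dh)
  (m_volume : uniform_volume_control m (fun r => r `^ dh))
  (p_ge1 : 1 <= p) :
  let alpha_p := 1 + (dh - 1) / p in
  let X0 := Lp m p in
  let X1 := energy_space nu m p in
  let K := K_functional X0 X1 (Lp_norm m p) (energy_seminorm nu m p) in
  (exists r1 C1 C2 : R, [/\ 0 < r1, 0 < C1, 0 < C2 &
     forall (f : X -> R) (r : R), sum_space X0 X1 f -> 0 < r < r1 ->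
       (C1%:E * KS_energy m p 0 f r `^ p^-1 <= K f (r `^ alpha_p)%R
          <= C2%:E * KS_energy m p 0 f r `^ p^-1)%E]) /\
  (compact [set: X] -> forall alpha : R, 0 <= alpha <= alpha_p ->
     besov m alpha p =
     interpolation_space X0 X1 (Lp_norm m p) (energy_seminorm nu m p)
       (alpha / alpha_p)).
Proof.
have [iota0 [iota00 le_diam tree0 iota0_le]] := X_uniform.
(* a single point would have diameter 0 *)
have two : exists x y : X, x <> y.
  apply: contrapT => no; move: le_diam; rewrite leNgt => /negP; apply.
  apply: (@le_lt_trans _ _ 0%E); last by rewrite lte_fin.
  apply: ge_ereal_sup => _ [[x y] _ <-] /=.
  have -> : x = y by apply: contrapT => ne; apply: no; exists x, y.
  by rewrite mdistxx.
have H : length_tree nu iota0.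
  split=> // x; exact: (proj2 (X_local_tree x)).
have [r0 [c [C [r0_gt0 c_gt0 C_gt0 volume]]]] := m_volume.
move=> alpha_p X0 X1 K; split.
  have [r1 [C1 [C2 [[r10 _] C10 C20 _ Kb]]]] :=
    K_two_sided H r0_gt0 c_gt0 C_gt0 volume p_ge1 m_support.
  exists r1, C1, C2; split=> // f r fsum rr1; apply: Kb => //.
  exact: (sum_space_Lp p_ge1 fsum).
move=> cX alpha /andP[alpha_ge0 _].
exact: (besov_interpolation H r0_gt0 c_gt0 C_gt0 dh_ge1 volume p_ge1 m_support
  cX alpha_ge0).
Qed.
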